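(* Let $n\ge 1$ and let $\varphi=(\varphi_1,\ldots,\varphi_{n+1}): E\rightarrow D_{n,1}$ be a $\mathcal{K}_{D_{n,1}}$-geodesic for $(\varphi(0),\varphi'(0))$ with $\varphi'(0)\neq 0$. Then $\varphi$ extends smoothly onto the closure $\overline{E}$, and $\varphi(\partial E)\subseteq \partial D_{n,1}$.
   Context: $E$ is the open unit disk in $\mathbb{C}$. For $n,m\geq 1$ the Fock-Bargmann-Hartogs domain is $D_{n,m}=\{(z,w)\in\mathbb{C}^n\times\mathbb{C}^m:\ \|w\|^2<e^{-\|z\|^2}\}$, with $\|\cdot\|$ the Euclidean norm. For a domain $D\subset\mathbb{C}^N$ the Kobayashi pseudometric is, for $(z,\zeta)\in D\times\mathbb{C}^N$, $$\mathcal{K}_D(z,\zeta)=\inf_f\{|\alpha|:\ \exists f:E\to D \text{ holomorphic},\ f(0)=z,\ f'(0)\alpha=\zeta\}.$$ A holomorphic mapping $\varphi:E\to D$ is a $\mathcal{K}_D$-geodesic for $(z,\zeta)$ if $\varphi$ achieves the minimum in this definition, i.e. $\varphi(0)=z$ and $\varphi'(0)\alpha=\zeta$ for some $\alpha$ with $|\alpha|=\mathcal{K}_D(z,\zeta)$. *)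

(* Defs.v *)
From HB Require Import structures.
From mathcomp Require Import all_boot all_order all_algebra.
From mathcomp Require Import complex.
From mathcomp Require Import all_classical all_reals all_analysis.

Set Implicit Arguments.
Unset Strict Implicit.
Unset Printing Implicit Defensive.

Import Order.TTheory GRing.Theory Num.Theory.
Import numFieldNormedType.Exports.

Local Open Scope classical_set_scope.
Local Open Scope ring_scope.

(* The metric topology of [R[i]], that is, the one every [numFieldType] gets
   from its norm. *)
HB.instance Definition _ (R : rcfType) := NormedModule.copy R[i] R[i]^o.

Section Defs.
Variable R : realType.
Local Notation C := R[i].

Definition unit_disk : set C := [set z | `|z| < 1].

Definition boundary (T : topologicalType) (A : set T) : set T :=
  closure A `\` A°.

(* The norm of the library on row vectors is the sup norm, hence this explicit
   squared Euclidean norm. *)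
Definition sqnorm (N : nat) (v : 'rV[C]_N) : R :=
  \sum_(j < N) Normc.normc (v 0 j) ^+ 2.

(* A point of [C^n * C^m] is a row vector of size [n + m]. *)
Definition fock_bargmann_hartogs (n m : nat) : set 'rV[C]_(n + m) :=
  [set p | sqnorm (rsubmx p) < expR (- sqnorm (lsubmx p))].

Definition holomorphic_disk (N : nat) (D : set 'rV[C]_N) (f : C -> 'rV[C]_N) :=
  (forall z, unit_disk z -> derivable f z 1) /\ f @` unit_disk `<=` D.

Definition kobayashi (N : nat) (D : set 'rV[C]_N) (z zeta : 'rV[C]_N) : \bar R :=
  ereal_inf [set (Normc.normc alpha)%:E | alpha in
    [set alpha : C | exists f : C -> 'rV[C]_N,
      [/\ holomorphic_disk D f, f 0 = z & alpha *: derive1 f 0 = zeta]]].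

Definition kobayashi_geodesic (N : nat) (D : set 'rV[C]_N)
    (z zeta : 'rV[C]_N) (phi : C -> 'rV[C]_N) :=
  [/\ holomorphic_disk D phi, phi 0 = z &
    exists2 alpha : C, alpha *: derive1 phi 0 = zeta &
      (Normc.normc alpha)%:E = kobayashi D z zeta].

(* Derivative of [u] at [z] along [v] with respect to a real parameter. *)
Definition rderivable (v : C) (u : C -> R) (z : C) :=
  derivable (fun t : R => u (z + t%:C%C * v)) 0 1.

Definition rderive (v : C) (u : C -> R) (z : C) : R :=
  derive1 (fun t : R => u (z + t%:C%C * v)) 0.

Fixpoint Ck (k : nat) (U : set C) (u : C -> R) : Prop :=
  (forall z, U z -> {for z, continuous u}) /\
  if k is k'.+1 then
    [/\ forall z, U z -> rderivable 1 u z /\ rderivable 'i%C u z,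
        Ck k' U (rderive 1 u) & Ck k' U (rderive 'i%C u)]
  else True.

Definition smooth_on (N : nat) (U : set C) (f : C -> 'rV[C]_N) :=
  forall (j : 'I_N) (k : nat),
    Ck k U (fun z => complex.Re (f z 0 j)) /\
    Ck k U (fun z => complex.Im (f z 0 j)).

(* A map is smooth on the closed disk when it is the restriction of a smooth
   map defined on an open neighbourhood of it. *)
Definition smooth_extension (N : nat) (phi psi : C -> 'rV[C]_N) :=
  (forall z, unit_disk z -> psi z = phi z) /\
  exists U : set C,
    [/\ open U, closure unit_disk `<=` U & smooth_on U psi].

End Defs.

Arguments unit_disk {R}.

(* Main.v *)
Require Import Defs.
From HB Require Import structures.
From mathcomp Require Import all_boot all_order all_algebra.
From mathcomp Require Import complex ring lra.
From mathcomp Require Import all_classical all_reals all_analysis.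

Set Implicit Arguments.
Unset Strict Implicit.
Unset Printing Implicit Defensive.

Import Order.TTheory GRing.Theory Num.Theory.
Import numFieldNormedType.Exports.

Local Open Scope classical_set_scope.
Local Open Scope ring_scope.

(** The domain is [|w|^2 * exp (|z|^2) < 1], and the proof determines all
    geodesics explicitly. Let [phi = (z, w)] be a geodesic for its own jet at
    the centre, so that the Kobayashi metric is one there: no disk in the domain
    has the same centre and a derivative stretched by a factor larger than one
    ([geodesic_extremal]). Hence ([slack]) the jet of [phi] at the centre is not
    attained by any [(z', h * g)] with [(z', g)] in the closed domain, [g]
    nonzero at the centre, and [h] bounded away from modulus one: such a disk
    leaves room to stretch.

    Zeros of [w] are divided out by Moebius maps, and the maximum principle keeps
    [(z, g)] in the closed domain. A product of two maps of the disk, neither of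
    them a unimodular constant, shares its jet with a map into a smaller disk,
    by the lemma of Schwarz and Pick ([product_not_extremal]). So at most one
    Moebius factor occurs: [w = b * g] where [g] has no zeros
    ([extremal_factor]), and [g = exp u].

    Off [w = 0] the exponential map is a covering of the domain by the Siegel
    domain [2 Re u + |z|^2 < 0], which is biholomorphic to the ball; the disk
    [(z, u)] becomes a disk [G] in the closed ball with [G 0 = 0]. If the
    derivative [G'(0)] had norm less than one, the linear disk with this
    derivative would contradict [slack]. Hence it has norm one, and equality in
    the Schwarz lemma makes [G] linear. Mapped back, [z] and [u] are rational
    with at most one pole ([extremal_extends]). The pole lies on the circle only if
    [z] is constant, and this is excluded by halving [u] and using
    [product_not_extremal] again. So [phi] continues past the circle, and there
    [|b| = 1] while the linear disk reaches the sphere, that is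
    [|w|^2 * exp (|z|^2) = 1]. The degenerate case in which [(z, g)] already
    touches the boundary inside the disk gives constant [z] and [g].

    The function theory of one variable that this takes is developed from
    pointwise complex differentiability: integrals are defined by antiderivatives,
    the theorem of Goursat gives primitives, even in the presence of an
    exceptional point, and from these follow the Cauchy formula, the holomorphy
    of derivatives and of quotients by zeros, the maximum principle, the Schwarz
    lemma and logarithms. *)

Notation nc := (@Normc.normc _).
Notation Re := complex.Re.
Notation Im := complex.Im.

(** * Modulus, real and imaginary parts *)

Section Norm.
Variable R : realType.
Local Notation C := R[i].
Implicit Types (z w : C) (x y : R).

Lemma norm_ncE z : `|z| = (nc z)%:C%C.
Proof. by case: z. Qed.

Lemma ncD z w : nc (z + w) <= nc z + nc w.
Proof. by rewrite -lecR rmorphD /= -!norm_ncE ler_normD. Qed.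

Lemma ncN z : nc (- z) = nc z.
Proof. by apply: (@complexI R); rewrite -!norm_ncE normrN. Qed.

Lemma ncB z w : nc (z - w) <= nc z + nc w.
Proof. by rewrite -(ncN w) ncD. Qed.

Lemma ncBC z w : nc (z - w) = nc (w - z).
Proof. by rewrite -ncN opprB. Qed.

Lemma ncB_ge z w : nc z - nc w <= nc (z - w).
Proof. by rewrite lerBlDr -{1}(subrK w z) ncD. Qed.


Lemma ncM z w : nc (z * w) = nc z * nc w.
Proof. exact: Normc.normcM. Qed.

Lemma ncV z : nc z^-1 = (nc z)^-1.
Proof. exact: Normc.normcV. Qed.

Lemma ncX z k : nc (z ^+ k) = nc z ^+ k.
Proof.
elim: k => [|k IH]; first by rewrite !expr0 Normc.normc1.
by rewrite !exprS ncM IH.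
Qed.

Lemma nc_ge0 z : 0 <= nc z.
Proof. by case: z => a b; rewrite sqrtr_ge0. Qed.

Lemma nc0 : nc (0 : C) = 0.
Proof. exact: Normc.normc0. Qed.

Lemma nc1 : nc (1 : C) = 1.
Proof. exact: Normc.normc1. Qed.

Lemma nc_eq0 z : (nc z == 0) = (z == 0).
Proof.
by apply/eqP/eqP => [/Normc.eq0_normc//|->]; rewrite nc0.
Qed.

Lemma nc_gt0 z : (0 < nc z) = (z != 0).
Proof. by rewrite lt_neqAle nc_ge0 andbT eq_sym nc_eq0. Qed.

Lemma nc_real x : nc (x%:C%C) = `|x|.
Proof. by rewrite /= expr0n /= addr0 sqrtr_sqr. Qed.

Lemma nc_sqr z : nc z ^+ 2 = Re z ^+ 2 + Im z ^+ 2.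
Proof. by case: z => a b /=; rewrite sqr_sqrtr // addr_ge0 ?sqr_ge0. Qed.

Lemma Re_le_nc z : `|Re z| <= nc z.
Proof.
by rewrite -ler_sqr ?nnegrE ?nc_ge0 // real_normK ?num_real // nc_sqr lerDl sqr_ge0.
Qed.

Lemma Im_le_nc z : `|Im z| <= nc z.
Proof.
by rewrite -ler_sqr ?nnegrE ?nc_ge0 // real_normK ?num_real // nc_sqr lerDr sqr_ge0.
Qed.

Lemma nc_le_ReIm z : nc z <= `|Re z| + `|Im z|.
Proof.
rewrite -ler_sqr ?nnegrE ?nc_ge0 ?addr_ge0 // nc_sqr sqrrD !real_normK ?num_real //.
by rewrite lerD2r lerDl mulrn_wge0 // mulr_ge0.
Qed.

Lemma ReD z w : Re (z + w) = Re z + Re w. Proof. by case: z; case: w. Qed.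
Lemma ImD z w : Im (z + w) = Im z + Im w. Proof. by case: z; case: w. Qed.
Lemma ReN z : Re (- z) = - Re z. Proof. by case: z. Qed.
Lemma ImN z : Im (- z) = - Im z. Proof. by case: z. Qed.
Lemma Re_mul z w : Re (z * w) = Re z * Re w - Im z * Im w.
Proof. by case: z; case: w. Qed.
Lemma Im_mul z w : Im (z * w) = Re z * Im w + Im z * Re w.
Proof. by case: z; case: w. Qed.
Lemma ReC x : Re (x%:C%C) = x. Proof. by []. Qed.
Lemma ImC x : Im (x%:C%C) = 0. Proof. by []. Qed.
Lemma Re1 : Re (1 : C) = 1. Proof. by []. Qed.
Lemma Im1 : Im (1 : C) = 0. Proof. by []. Qed.
Lemma Re0 : Re (0 : C) = 0. Proof. by []. Qed.
Lemma Im0 : Im (0 : C) = 0. Proof. by []. Qed.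
Definition ReImE := (ReD, ImD, ReN, ImN, Re_mul, Im_mul, ReC, ImC, Re1, Im1, Re0, Im0).

Lemma eq_ReIm z w : Re z = Re w -> Im z = Im w -> z = w.
Proof. by case: z w => [a b] [c d] /= -> ->. Qed.

Lemma ReJ z : Re (conjc z) = Re z. Proof. by case: z. Qed.
Lemma ImJ z : Im (conjc z) = - Im z. Proof. by case: z. Qed.
Lemma ncJ z : nc (conjc z) = nc z.
Proof. by case: z => a b /=; rewrite sqrrN. Qed.

Lemma mulJ z : z * conjc z = ((nc z ^+ 2)%:C)%C.
Proof. by apply: eq_ReIm; rewrite ReImE ReJ ImJ ReImE ?nc_sqr; ring. Qed.

Lemma lt1C z : (`|z| < 1) = (nc z < 1).
Proof. by rewrite norm_ncE -[1]/(1%:C)%C ltcR. Qed.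

Lemma disk0 : unit_disk (0 : C).
Proof. by rewrite /unit_disk /= normr0 ltr01. Qed.

End Norm.

(** * Derivatives of complex functions and of complex-valued paths *)

(** The Taylor form of differentiability: remainders are estimated without
    dividing by the increment. *)
Lemma is_derive_epsP (K : numFieldType) (f : K -> K) (z d : K) :
  is_derive z 1 f d <->
  (forall e, 0 < e -> exists2 k, 0 < k & forall w, `|w - z| < k ->
     `|f w - f z - d * (w - z)| <= e * `|w - z|).
Proof.
pose q h := h^-1 *: (f (h *: (1 : K) + z) - f z).
have step e w : w != z -> (`|d - q (w - z)| <= e) =
    (`|f w - f z - d * (w - z)| <= e * `|w - z|).
  move=> wz; have h0 : w - z != 0 by rewrite subr_eq0.
  have -> : f w - f z - d * (w - z) = (w - z) * (q (w - z) - d).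
    have -> : q (w - z) = (w - z)^-1 * (f ((w - z) * 1 + z) - f z) by [].
    rewrite mulr1 subrK.
    by field.
  by rewrite normrM [e * _]mulrC ler_pM2l ?normr_gt0 // distrC.
split=> [[df df_val] e e0|H].
  have : q @ 0^' --> d by rewrite -df_val; exact: df.
  move=> /cvgrPdist_le /(_ e e0) /nbhs_ballP[k /= k0 Hk].
  exists k => // w wk; have [->|wz] := eqVneq w z.
    by rewrite !subrr mulr0 subrr !normr0 mulr0.
  rewrite -step //; apply: Hk; last by rewrite subr_eq0.
  by rewrite /ball /= sub0r normrN.
have Hq : q @ 0^' --> d.
  apply/cvgrPdist_le => e e0; have [k k0 Hk] := H e e0.
  apply/nbhs_ballP; exists k => //= h; rewrite /ball /= sub0r normrN => hk h0.
  have := step e (h + z); rewrite addrK -subr_eq0 addrK => /(_ h0) ->.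
  by have := Hk (h + z); rewrite addrK; apply.
split; first by apply/cvg_ex; exists d.
exact/cvg_lim.
Qed.

Section Diff.
Variable R : realType.
Local Notation C := R[i].
Implicit Types (f g : C -> C) (z w d : C) (A : R -> C).

(** Estimates are carried out in [R], hence the real-valued modulus and the
    real epsilons; [cdiffP] identifies this with [is_derive]. *)
Definition cdiff f z d := forall e : R, 0 < e -> exists2 k : R, 0 < k &
  forall w, nc (w - z) < k -> nc (f w - f z - d * (w - z)) <= e * nc (w - z).

(** [R[i]] is a normed module over itself and not over [R], so the derivative
    of a path in a real parameter needs a definition of its own. *)
Definition rdiff A (t : R) d := forall e : R, 0 < e -> exists2 k : R, 0 < k &
  forall s, `|s - t| < k ->
    nc (A s - A t - d * ((s - t)%:C)%C) <= e * `|s - t|.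

Lemma pos_complex (e : C) : 0 < e -> exists2 x : R, 0 < x & e = (x%:C)%C.
Proof.
case: e => a b; rewrite ltcE /= => /andP[/eqP b0 a0]; exists a => //.
by rewrite /= b0.
Qed.

Lemma norm_ltE z (k : R) : (`|z| < (k%:C)%C) = (nc z < k).
Proof. by rewrite norm_ncE ltcR. Qed.

Lemma norm_leE z w (k : R) : (`|z| <= (k%:C)%C * `|w|) = (nc z <= k * nc w).
Proof. by rewrite !norm_ncE -rmorphM lecR. Qed.

Lemma cdiffP f z d : cdiff f z d <-> is_derive z 1 f d.
Proof.
rewrite is_derive_epsP; split=> H e.
  move=> /pos_complex[x x0 ->]; have [k k0 Hk] := H x x0.
  exists (k%:C)%C; first by rewrite ltcR.
  move=> w wk; have wk' := etrans (esym (norm_ltE _ _)) wk.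
  exact: (etrans (norm_leE _ _ _) (Hk w wk')).
move=> e0; have e0' : 0 < (e%:C)%C by rewrite ltcR.
have [_ /pos_complex[k k0 ->] Hk] := H _ e0'.
exists k => // w wk; have wk' := etrans (norm_ltE _ _) wk.
exact: (etrans (esym (norm_leE _ _ _)) (Hk w wk')).
Qed.

Lemma cdiff_ext f g z d : (forall w, f w = g w) -> cdiff f z d -> cdiff g z d.
Proof. by move=> /funext ->. Qed.

Lemma cdiff_eq f z d d' : d = d' -> cdiff f z d -> cdiff f z d'.
Proof. by move=> ->. Qed.

Lemma cdiff_near f g z d (k : R) : 0 < k ->
  (forall w, nc (w - z) < k -> f w = g w) -> cdiff f z d -> cdiff g z d.
Proof.
move=> k0 fg H e e0; have [l l0 Hl] := H e e0.
exists (Num.min k l); first by rewrite lt_min k0.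
move=> w; rewrite lt_min => /andP[wk wl]; rewrite -!fg //.
  exact: Hl.
by rewrite subrr nc0.
Qed.

Lemma cdiff_uniq f z d d' : cdiff f z d -> cdiff f z d' -> d = d'.
Proof. by move=> /cdiffP H1 /cdiffP H2; rewrite -(@derive_val _ _ _ _ _ _ _ H1) -(@derive_val _ _ _ _ _ _ _ H2). Qed.

Lemma cdiff_cst c z : cdiff (fun=> c) z 0.
Proof. apply/cdiffP; exact: is_derive_cst. Qed.

Lemma cdiff_id z : cdiff id z 1.
Proof. apply/cdiffP; exact: is_derive_id. Qed.

Lemma cdiffD f g z d d' : cdiff f z d -> cdiff g z d' ->
  cdiff (fun w => f w + g w) z (d + d').
Proof. by move=> /cdiffP H1 /cdiffP H2; apply/cdiffP; exact: is_deriveD. Qed.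

Lemma cdiffN f z d : cdiff f z d -> cdiff (fun w => - f w) z (- d).
Proof. by move=> /cdiffP H1; apply/cdiffP; exact: is_deriveN. Qed.

Lemma cdiffB f g z d d' : cdiff f z d -> cdiff g z d' ->
  cdiff (fun w => f w - g w) z (d - d').
Proof. by move=> H1 H2; apply: cdiffD => //; exact: cdiffN. Qed.

Lemma cdiffM f g z d d' : cdiff f z d -> cdiff g z d' ->
  cdiff (fun w => f w * g w) z (d * g z + f z * d').
Proof.
move=> /cdiffP H1 /cdiffP H2; apply: (cdiffP _ _ _).2.
rewrite addrC [d * _]mulrC; exact: is_deriveM.
Qed.

Lemma cdiffZ c f z d : cdiff f z d -> cdiff (fun w => c * f w) z (c * d).
Proof.
move=> H; have := cdiffM (cdiff_cst c z) H; by rewrite mul0r add0r.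
Qed.

Lemma cdiffV f z d : f z != 0 -> cdiff f z d ->
  cdiff (fun w => (f w)^-1) z (- d / (f z ^+ 2)).
Proof.
move=> f0 /cdiffP[df df_val]; apply/cdiffP; split; first exact: derivableV.
by rewrite deriveV // df_val /GRing.scale /= mulrC mulNr mulrN.
Qed.

Lemma cdiff_sum (I : Type) (r : seq I) (F : I -> C -> C) (dF : I -> C) z :
  (forall i, cdiff (F i) z (dF i)) ->
  cdiff (fun w => \sum_(i <- r) F i w) z (\sum_(i <- r) dF i).
Proof.
move=> H; elim: r => [|i r IH].
  by rewrite big_nil; apply: cdiff_ext (cdiff_cst 0 z) => ?; rewrite big_nil.
rewrite big_cons; apply: cdiff_ext (cdiffD (H i) IH) => w.
by rewrite big_cons.
Qed.

Lemma cdiff_lip f z d : cdiff f z d -> exists2 k : R, 0 < k &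
  forall w, nc (w - z) < k -> nc (f w - f z) <= (nc d + 1) * nc (w - z).
Proof.
move=> H; have [k k0 Hk] := H 1 ltr01; exists k => // w wk.
have -> : f w - f z = d * (w - z) + (f w - f z - d * (w - z)) by ring.
by rewrite (le_trans (ncD _ _)) // mulrDl lerD ?Hk // ncM.
Qed.

Lemma cdiff_comp f g z d d' : cdiff f z d -> cdiff g (f z) d' ->
  cdiff (fun w => g (f w)) z (d' * d).
Proof.
move=> Hf Hg e e0; have [k k0 Hk] := cdiff_lip Hf.
pose L := nc d + 1; have L0 : 0 < L by rewrite ltr_wpDl ?nc_ge0.
pose e1 := e / (2 * L); have e10 : 0 < e1 by rewrite divr_gt0 ?mulr_gt0.
pose e2 := e / (2 * (nc d' + 1)).
have L'0 : 0 < nc d' + 1 by rewrite ltr_wpDl ?nc_ge0.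
have e20 : 0 < e2 by rewrite divr_gt0 ?mulr_gt0.
have [k1 k10 Hk1] := Hg e1 e10; have [k2 k20 Hk2] := Hf e2 e20.
exists (Num.min k (Num.min k2 (k1 / L))); first by rewrite !lt_min k0 k20 divr_gt0.
move=> w; rewrite !lt_min ltr_pdivlMr // => /and3P[wk wk2 wk1].
have fw := Hk w wk; have fw1 : nc (f w - f z) < k1.
  by apply: le_lt_trans fw _; rewrite mulrC.
have -> : g (f w) - g (f z) - d' * d * (w - z) =
  (g (f w) - g (f z) - d' * (f w - f z)) + d' * (f w - f z - d * (w - z)) by ring.
apply: le_trans (ncD _ _) _; rewrite ncM.
apply: le_trans (lerD (Hk1 _ fw1) (ler_wpM2l (nc_ge0 _) (Hk2 _ wk2))) _.
have le1 : nc d' * (e2 * nc (w - z)) <= (nc d' + 1) * (e2 * nc (w - z)).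
  by rewrite ler_wpM2r ?lerDl ?ler01 // mulr_ge0 ?nc_ge0 // ltW.
apply: le_trans (lerD (ler_wpM2l (ltW e10) fw) le1) _.
rewrite -/L !mulrA -mulrDl ler_wpM2r ?nc_ge0 //.
rewrite /e1 /e2 le_eqVlt; apply/orP; left; apply/eqP; field.
by rewrite !gt_eqF.
Qed.

Definition ccont f z := forall e : R, 0 < e -> exists2 k : R, 0 < k &
  forall w, nc (w - z) < k -> nc (f w - f z) <= e.

Lemma cdiff_cont f z d : cdiff f z d -> ccont f z.
Proof.
move=> /cdiff_lip[k k0 Hk] e e0.
have L0 : 0 < nc d + 1 by rewrite ltr_wpDl ?nc_ge0.
exists (Num.min k (e / (nc d + 1))); first by rewrite lt_min k0 divr_gt0.
move=> w; rewrite lt_min ltr_pdivlMr // => /andP[wk we].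
by apply: le_trans (Hk w wk) _; rewrite mulrC ltW.
Qed.

Lemma rdiffD A B t d d' : rdiff A t d -> rdiff B t d' ->
  rdiff (fun s => A s + B s) t (d + d').
Proof.
move=> HA HB e e0; have e20 : 0 < e / 2 by rewrite divr_gt0.
have [k k0 Hk] := HA _ e20; have [l l0 Hl] := HB _ e20.
exists (Num.min k l); first by rewrite lt_min k0.
move=> s; rewrite lt_min => /andP[sk sl].
have -> : A s + B s - (A t + B t) - (d + d') * ((s - t)%:C)%C =
 (A s - A t - d * ((s - t)%:C)%C) + (B s - B t - d' * ((s - t)%:C)%C) by ring.
apply: le_trans (ncD _ _) _; apply: le_trans (lerD (Hk _ sk) (Hl _ sl)) _.
by rewrite -mulrDl -splitr.
Qed.

Lemma rdiff_comp A f t d d' : rdiff A t d -> cdiff f (A t) d' ->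
  rdiff (fun s => f (A s)) t (d' * d).
Proof.
move=> Hf Hg e e0.
pose L := nc d + 1; have L0 : 0 < L by rewrite ltr_wpDl ?nc_ge0.
have [k k0 Hk'] := Hf 1 ltr01.
have Hk (w : R) : `|w - t| < k -> nc (A w - A t) <= L * `|w - t|.
  move=> wk; have -> : A w - A t = d * ((w - t)%:C)%C + (A w - A t - d * ((w - t)%:C)%C) by ring.
  by rewrite (le_trans (ncD _ _)) // mulrDl lerD ?Hk' // ncM nc_real.
pose e1 := e / (2 * L); have e10 : 0 < e1 by rewrite divr_gt0 ?mulr_gt0.
pose e2 := e / (2 * (nc d' + 1)).
have L'0 : 0 < nc d' + 1 by rewrite ltr_wpDl ?nc_ge0.
have e20 : 0 < e2 by rewrite divr_gt0 ?mulr_gt0.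
have [k1 k10 Hk1] := Hg e1 e10; have [k2 k20 Hk2] := Hf e2 e20.
exists (Num.min k (Num.min k2 (k1 / L))); first by rewrite !lt_min k0 k20 divr_gt0.
move=> w; rewrite !lt_min ltr_pdivlMr // => /and3P[wk wk2 wk1].
have fw := Hk w wk; have fw1 : nc (A w - A t) < k1.
  by apply: le_lt_trans fw _; rewrite mulrC.
have -> : f (A w) - f (A t) - d' * d * ((w - t)%:C)%C =
  (f (A w) - f (A t) - d' * (A w - A t)) + d' * (A w - A t - d * ((w - t)%:C)%C) by ring.
apply: le_trans (ncD _ _) _; rewrite ncM.
apply: le_trans (lerD (Hk1 _ fw1) (ler_wpM2l (nc_ge0 _) (Hk2 _ wk2))) _.
have le1 : nc d' * (e2 * `|w - t|) <= (nc d' + 1) * (e2 * `|w - t|).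
  by rewrite ler_wpM2r ?lerDl ?ler01 // mulr_ge0 ?nc_ge0 // ltW.
apply: le_trans (lerD (ler_wpM2l (ltW e10) fw) le1) _.
rewrite -/L !mulrA -mulrDl ler_wpM2r //.
rewrite /e1 /e2 le_eqVlt; apply/orP; left; apply/eqP; field.
by rewrite !gt_eqF.
Qed.

Lemma cdiff_affine c c' z : cdiff (fun w => c + c' * w) z c'.
Proof.
have := cdiffD (cdiff_cst c z) (cdiffZ c' (cdiff_id z)).
by rewrite add0r mulr1.
Qed.

Lemma rdiff_lin c c' t : rdiff (fun s => c + c' * (s%:C)%C) t c'.
Proof.
move=> e e0; exists 1 => // s _.
have -> : c + c' * (s%:C)%C - (c + c' * (t%:C)%C) - c' * ((s - t)%:C)%C = 0.
  by rewrite rmorphB /=; ring.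
by rewrite nc0 mulr_ge0 // ltW.
Qed.

Lemma rdiff_aff A (p q t : R) d : rdiff A (p + q * t) d ->
  rdiff (fun s => A (p + q * s)) t ((q%:C)%C * d).
Proof.
move=> H e e0; have q0 : 0 < `|q| + 1 by rewrite ltr_wpDl.
have [k k0 Hk] := H _ (divr_gt0 e0 q0).
exists (k / (`|q| + 1)); first by rewrite divr_gt0.
move=> s; rewrite ltr_pdivlMr // => sk.
have E : p + q * s - (p + q * t) = q * (s - t) by ring.
have := Hk (p + q * s); rewrite E rmorphM /= normrM mulrA [d * _]mulrC.
have qs : `|q| * `|s - t| <= `|s - t| * (`|q| + 1).
  by rewrite mulrC ler_wpM2l // lerDl ler01.
move=> /(_ (le_lt_trans qs sk)) /le_trans; apply.
rewrite -mulrA ler_wpM2l ?(ltW e0) // ler_pdivrMl // mulrC //.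
by rewrite mulrC ler_wpM2r // lerDl ler01.
Qed.

Lemma rdiff_Re c A t d : rdiff A t d -> is_derive t 1 (fun s : R => Re (c * A s)) (Re (c * d)).
Proof.
move=> H; apply/is_derive_epsP => e e0.
have c0 : 0 < nc c + 1 by rewrite ltr_wpDl ?nc_ge0.
have [k k0 Hk] := H _ (divr_gt0 e0 c0); exists k => // s sk.
have -> : Re (c * A s) - Re (c * A t) - Re (c * d) * (s - t) =
  Re (c * (A s - A t - d * ((s - t)%:C)%C)) by rewrite !ReImE; ring.
apply: le_trans (Re_le_nc _) _; rewrite ncM.
apply: le_trans (ler_wpM2l (nc_ge0 _) (Hk s sk)) _.
rewrite mulrA ler_wpM2r // mulrCA ger_pMr // ler_pdivrMr // mul1r.
by rewrite lerDl ler01.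
Qed.

Lemma rdiffP_ReIm (a b : R -> R) (t x y : R) :
  is_derive t 1 a x -> is_derive t 1 b y ->
  rdiff (fun s => Complex (a s) (b s)) t (Complex x y).
Proof.
move=> /is_derive_epsP Ha /is_derive_epsP Hb e e0.
have e20 : 0 < e / 2 by rewrite divr_gt0.
have [k k0 Hk] := Ha _ e20; have [l l0 Hl] := Hb _ e20.
exists (Num.min k l); first by rewrite lt_min k0.
move=> s; rewrite lt_min => /andP[sk sl].
apply: le_trans (nc_le_ReIm _) _; rewrite !ReImE /= !mulr0 subr0 add0r.
by apply: le_trans (lerD (Hk _ sk) (Hl _ sl)) _; rewrite -mulrDl -splitr.
Qed.

(** The real mean value theorem, applied to the component of [A] along the
    increment [A 1 - A 0]. *)
Lemma rdiff_mvt A (dA : R -> C) (M : R) :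
  (forall t : R, 0 <= t <= 1 -> rdiff A t (dA t)) ->
  (forall t : R, 0 <= t <= 1 -> nc (dA t) <= M) -> nc (A 1 - A 0) <= M.
Proof.
move=> HA HM; have M0 : 0 <= M by apply: le_trans (nc_ge0 _) (HM 0 _); lra.
have [->|v0] := eqVneq (A 1 - A 0) 0; first by rewrite nc0.
pose v := A 1 - A 0; pose c := conjc v.
have Hd (t : R) : t \in `]0, 1[ -> is_derive t 1 (fun s : R => Re (c * A s)) (Re (c * dA t)).
  by rewrite in_itv /= => /andP[? ?]; apply: rdiff_Re; apply: HA; rewrite !ltW.
have Hc : {within `[(0 : R), 1], continuous (fun s => Re (c * A s))}.
  apply: derivable_within_continuous => t; rewrite in_itv /= => tt.
  by have [] := rdiff_Re c (HA t tt).
have [t t01 E] := MVT ltr01 Hd Hc.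
have E2 : nc v ^+ 2 = Re (c * dA t).
  move: E; rewrite subr0 mulr1 => <-.
  have -> : Re (c * A 1) - Re (c * A 0) = Re (v * c) by rewrite /v !ReImE; ring.
  by rewrite /c mulJ.
have : nc v ^+ 2 <= nc v * M.
  rewrite E2 (le_trans (ler_norm _)) // (le_trans (Re_le_nc _)) // ncM ncJ.
  rewrite ler_wpM2l ?nc_ge0 // HM //.
  by move: t01; rewrite in_itv /= => /andP[? ?]; rewrite !ltW.
by rewrite expr2 ler_pM2l // nc_gt0.
Qed.

End Diff.

(** * Integration through antiderivatives *)

Section Integral.
Variable R : realType.
Local Notation C := R[i].
Implicit Types (h : R -> C) (k : C -> C) (a b m v : C) (t s : R).

Definition rcont h := forall t (e : R), 0 < e -> exists2 d : R, 0 < d &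
  forall s, `|s - t| < d -> nc (h s - h t) <= e.

Lemma real_cont_eps (f : R -> R) :
  (forall t (e : R), 0 < e -> exists2 d : R, 0 < d &
    forall s, `|s - t| < d -> `|f s - f t| <= e) -> continuous f.
Proof.
move=> H t; apply/cvgrPdist_le => e e0; have [d d0 Hd] := H t e e0.
apply/nbhs_ballP; exists d => //= s; rewrite /ball /= distrC => /Hd.
by rewrite distrC.
Qed.

Lemma antiderivative (f : R -> R) : continuous f ->
  exists F : R -> R, forall t, 0 <= t <= 1 -> is_derive t (1 : R) F (f t).
Proof.
move=> cf; exists (fun x => \int[lebesgue_measure]_(t in `[(-1 : R), x]) f t)%R.
move=> t /andP[t0 t1].
have t2 : t < 2 by lra.
have int : lebesgue_measure.-integrable `[(-1 : R), 2] (EFin \o f).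
  apply: continuous_compact_integrable; first exact: segment_compact.
  exact: continuous_subspaceT.
have t1' : -1 < t by lra.
have [D1 D2] := continuous_FTC1_closed t2 int t1' (cf t).
by split; [exact: D1|rewrite -derive1E; exact: D2].
Qed.

(** The integral over the unit interval is defined through antiderivatives, so
    that its properties come from the uniqueness of antiderivatives. *)
Definition rprim h v := exists2 A : R -> C,
  (forall t, 0 <= t <= 1 -> rdiff A t (h t)) & A 1 - A 0 = v.

Definition rint h := exists v, rprim h v.

Definition cint h : C := xget 0 [set v | rprim h v].

Lemma rcont_rint h : rcont h -> rint h.
Proof.
move=> ch; have cR : continuous (fun t => Re (h t)).
  apply: real_cont_eps => t e e0; have [d d0 Hd] := ch t e e0; exists d => // s sd.
  have -> : Re (h s) - Re (h t) = Re (h s - h t) by rewrite !ReImE.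
  by rewrite (le_trans (Re_le_nc _)) // Hd.
have cI : continuous (fun t => Im (h t)).
  apply: real_cont_eps => t e e0; have [d d0 Hd] := ch t e e0; exists d => // s sd.
  have -> : Im (h s) - Im (h t) = Im (h s - h t) by rewrite !ReImE.
  by rewrite (le_trans (Im_le_nc _)) // Hd.
have [F HF] := antiderivative cR; have [G HG] := antiderivative cI.
exists (Complex (F 1) (G 1) - Complex (F 0) (G 0)).
exists (fun s => Complex (F s) (G s)) => // t t01.
have := rdiffP_ReIm (HF t t01) (HG t t01).
by case: (h t).
Qed.

Lemma rprim_ext h h' v : (forall t, 0 <= t <= 1 -> h t = h' t) ->
  rprim h v -> rprim h' v.
Proof.
by move=> E [A HA <-]; exists A => // t t01; rewrite -E //; exact: HA.
Qed.

Lemma rprim_lin h h' c v v' : rprim h v -> rprim h' v' ->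
  rprim (fun t => h t + c * h' t) (v + c * v').
Proof.
move=> [A HA <-] [B HB <-]; exists (fun t => A t + c * B t); last by ring.
move=> t t01; apply: rdiffD; first exact: HA.
apply: (rdiff_comp (HB t t01)).
by apply: cdiff_ext (cdiff_affine 0 c _) => w; rewrite add0r.
Qed.

Lemma rprim_bound h v M : rprim h v ->
  (forall t, 0 <= t <= 1 -> nc (h t) <= M) -> nc v <= M.
Proof. by move=> [A HA <-]; exact: rdiff_mvt. Qed.

Lemma rprim_uniq h v v' : rprim h v -> rprim h v' -> v = v'.
Proof.
move=> H H'; have := rprim_lin (-1) H H'; rewrite mulN1r.
move=> /(@rprim_bound _ _ 0) H0.
apply/eqP; rewrite -subr_eq0 -nc_eq0 eq_le nc_ge0 andbT; apply: H0 => t _.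
by rewrite mulN1r subrr nc0.
Qed.

Lemma cintE h v : rprim h v -> cint h = v.
Proof.
by move=> H; apply: xget_unique => // w Hw; exact: rprim_uniq Hw H.
Qed.

Lemma rprim_cint h : rint h -> rprim h (cint h).
Proof. by move=> [v Hv]; rewrite (cintE Hv). Qed.

Lemma cint_ext h h' : (forall t, 0 <= t <= 1 -> h t = h' t) -> cint h = cint h'.
Proof.
move=> E; congr xget; apply/seteqP; split=> v /=; apply: rprim_ext => // t t01.
by rewrite E.
Qed.

Lemma cint_lin h h' c : rint h -> rint h' ->
  cint (fun t => h t + c * h' t) = cint h + c * cint h'.
Proof. by move=> H H'; apply: cintE; apply: rprim_lin; exact: rprim_cint. Qed.

Lemma cint_bound h M : rint h -> (forall t, 0 <= t <= 1 -> nc (h t) <= M) ->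
  nc (cint h) <= M.
Proof. by move=> H; apply: rprim_bound; exact: rprim_cint. Qed.

Lemma rint_lin h h' c : rint h -> rint h' -> rint (fun t => h t + c * h' t).
Proof.
by move=> [v Hv] [v' Hv']; exists (v + c * v'); exact: rprim_lin.
Qed.

Lemma rcontM h h' : rcont h -> rcont h' -> rcont (fun t => h t * h' t).
Proof.
move=> ch ch' t e e0.
pose p := nc (h t) + 1; pose q := nc (h' t) + 1.
have p0 : 0 < p by rewrite ltr_wpDl ?nc_ge0.
have q0 : 0 < q by rewrite ltr_wpDl ?nc_ge0.
pose e1 := Num.min 1 (e / (2 * q)); pose e2 := e / (2 * p).
have e10 : 0 < e1 by rewrite lt_min ltr01 divr_gt0 ?mulr_gt0.
have e20 : 0 < e2 by rewrite divr_gt0 ?mulr_gt0.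
have [d d0 Hd] := ch t e1 e10; have [d' d'0 Hd'] := ch' t e2 e20.
exists (Num.min d d'); first by rewrite lt_min d0.
move=> s; rewrite lt_min => /andP[/Hd A1 /Hd' A2].
have -> : h s * h' s - h t * h' t = h s * (h' s - h' t) + (h s - h t) * h' t by ring.
apply: le_trans (ncD _ _) _; rewrite !ncM.
have hs : nc (h s) <= p.
  rewrite /p -lerBlDl; apply: le_trans (ncB_ge _ _) _.
  by apply: le_trans A1 _; rewrite ge_min lexx.
have B1 : nc (h s) * nc (h' s - h' t) <= p * e2 by rewrite ler_pM ?nc_ge0.
have B2 : nc (h s - h t) * nc (h' t) <= e / (2 * q) * q.
  apply: ler_pM; rewrite ?nc_ge0 //; last by rewrite /q lerDl ler01.
  by apply: le_trans A1 _; rewrite ge_min lexx orbT.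
apply: le_trans (lerD B1 B2) _; rewrite /e2 le_eqVlt; apply/orP; left; apply/eqP.
by field; rewrite !gt_eqF.
Qed.

Lemma rcont_cst c : rcont (fun=> c).
Proof. by move=> t e e0; exists 1 => // s _; rewrite subrr nc0 ltW. Qed.

Lemma rcont_comp h k : rcont h -> (forall t, ccont k (h t)) ->
  rcont (fun t => k (h t)).
Proof.
move=> ch ck t e e0; have [d d0 Hd] := ck t e e0.
have d20 : 0 < d / 2 by rewrite divr_gt0.
have [l l0 Hl] := ch t _ d20; exists l => // s /Hl sl; apply: Hd.
by apply: le_lt_trans sl _; lra.
Qed.

Lemma rdiff_rcont h dh : (forall t, rdiff h t (dh t)) -> rcont h.
Proof.
move=> H t e e0; have [d d0 Hd] := H t 1 ltr01.
have L0 : 0 < nc (dh t) + 1 by rewrite ltr_wpDl ?nc_ge0.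
exists (Num.min d (e / (nc (dh t) + 1))); first by rewrite lt_min d0 divr_gt0.
move=> s; rewrite lt_min ltr_pdivlMr // => /andP[/Hd sd se].
have -> : h s - h t = dh t * ((s - t)%:C)%C + (h s - h t - dh t * ((s - t)%:C)%C) by ring.
apply: le_trans (ncD _ _) _; rewrite ncM nc_real.
apply: le_trans (lerD (lexx _) sd) _; rewrite -mulrDl mulrC; exact: ltW.
Qed.

Definition seg a b t := a + (b - a) * (t%:C)%C.

Definition contseg k a b := forall t, 0 <= t <= 1 -> ccont k (seg a b t).

Definition sint k a b := cint (fun t => (b - a) * k (seg a b t)).

(** Antiderivatives are obtained for functions continuous on the whole line;
    clamping extends the integrand beyond the ends of a segment. *)
Definition clamp t : R := Num.max 0 (Num.min t 1).

Lemma clamp_lip s t : `|clamp s - clamp t| <= `|s - t|.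
Proof.
have H (u v : R) : u <= v -> 0 <= clamp v - clamp u <= v - u.
  rewrite /clamp => uv; apply/andP; split.
    rewrite subr_ge0 ge_max le_max lexx /= le_max ge_min.
    by rewrite !le_min ge_min uv /= ge_min lexx !orbT.
  case: (leP u 1) => u1; case: (leP v 1) => v1; rewrite ?(max_r ler01);
  case: (leP 0 u) => u0; case: (leP 0 v) => v0; lra.
have [st|/ltW ts] := leP s t.
  rewrite distrC [leRHS]distrC; have /andP[h0 h1] := H _ _ st.
  by rewrite !ger0_norm // subr_ge0.
have /andP[h0 h1] := H _ _ ts.
by rewrite !ger0_norm // subr_ge0.
Qed.

Lemma clamp01 t : 0 <= clamp t <= 1.
Proof.
by rewrite /clamp le_max lexx /= ge_max ler01 /= ge_min lexx orbT.
Qed.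

Lemma clamp_id t : 0 <= t <= 1 -> clamp t = t.
Proof. by move=> /andP[t0 t1]; rewrite /clamp min_l // max_r. Qed.

Lemma seg_rint k a b : contseg k a b -> rint (fun t => (b - a) * k (seg a b t)).
Proof.
move=> ck.
have : rcont (fun t => (b - a) * k (seg a b (clamp t))).
  apply: rcontM; first exact: rcont_cst.
  apply: (@rcont_comp (fun t => seg a b (clamp t)) k).
    move=> t e e0; have ba : 0 < nc (b - a) + 1 by rewrite ltr_wpDl ?nc_ge0.
    exists (e / (nc (b - a) + 1)); first by rewrite divr_gt0.
    move=> s; rewrite ltr_pdivlMr // => st.
    have -> : seg a b (clamp s) - seg a b (clamp t) =
      (b - a) * ((clamp s - clamp t)%:C)%C by rewrite /seg rmorphB /=; ring.
    rewrite ncM nc_real; apply: le_trans (ltW st).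
    rewrite mulrC ler_pM ?nc_ge0 ?normr_ge0 ?clamp_lip //.
    by rewrite lerDl ler01.
  by move=> t; apply: ck; exact: clamp01.
move=> /rcont_rint[v Hv]; exists v; apply: rprim_ext Hv => t t01.
by rewrite clamp_id.
Qed.

Lemma seg0 a b : seg a b 0 = a. Proof. by rewrite /seg rmorph0 mulr0 addr0. Qed.
Lemma seg1 a b : seg a b 1 = b.
Proof. by rewrite /seg rmorph1 mulr1 addrC subrK. Qed.

Lemma sint_split k a b s : contseg k a b -> 0 <= s <= 1 ->
  sint k a b = sint k a (seg a b s) + sint k (seg a b s) b.
Proof.
move=> ck /andP[s0 s1]; have [A HA EA] := rprim_cint (seg_rint ck).
have E1 : sint k a (seg a b s) = A s - A 0.
  apply: cintE; exists (fun t => A (0 + s * t)); last by rewrite mulr1 mulr0 !add0r.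
  move=> t /andP[t0 t1].
  have := rdiff_aff (HA (0 + s * t) _); rewrite add0r.
  have st : 0 <= s * t <= 1 by rewrite mulr_ge0 // mulr_ile1.
  move=> /(_ st); congr rdiff.
  have -> : seg a (seg a b s) t = seg a b (s * t).
    by rewrite /seg rmorphM /=; ring.
  by rewrite /seg; ring.
have E2 : sint k (seg a b s) b = A 1 - A s.
  apply: cintE; exists (fun t => A (s + (1 - s) * t)).
    move=> t /andP[t0 t1].
    have st : 0 <= s + (1 - s) * t <= 1.
      have -> : s + (1 - s) * t = s * (1 - t) + t by ring.
      apply/andP; split; first by rewrite addr_ge0 ?mulr_ge0 ?subr_ge0.
      by rewrite -lerBrDr ler_piMl ?subr_ge0.
    have := rdiff_aff (HA _ st); congr rdiff.
    have -> : seg (seg a b s) b t = seg a b (s + (1 - s) * t).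
      by rewrite /seg rmorphD rmorphM rmorphB /= rmorph1; ring.
    by rewrite rmorphB rmorph1 /seg; ring.
  by congr (A _ - A _); ring.
by rewrite E1 E2 /sint -EA; ring.
Qed.

Lemma sint_rev k a b : contseg k a b -> sint k b a = - sint k a b.
Proof.
move=> ck; have [A HA EA] := rprim_cint (seg_rint ck).
apply: cintE; exists (fun t => A (1 + (-1) * t)); last first.
  by rewrite /sint -EA !mulr1 mulr0 subrr addr0; ring.
move=> t /andP[t0 t1].
have st : 0 <= 1 + (-1) * t <= 1 by apply/andP; split; lra.
have := rdiff_aff (HA _ st); congr rdiff.
have -> : seg b a t = seg a b (1 + (-1) * t).
  by rewrite /seg rmorphD rmorphM rmorphN /= rmorph1; ring.
by rewrite rmorphN rmorph1; ring.
Qed.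


Lemma rdiff_seg a b t : rdiff (seg a b) t (b - a).
Proof. exact: rdiff_lin. Qed.

(** The only estimate of segment integrals that is needed: with [p] zero it
    bounds them, with [p] constant it differentiates them, with [p] affine it
    drives the theorem of Goursat. *)
Lemma sint_approx k P p a b M : contseg k a b ->
  (forall t, 0 <= t <= 1 -> cdiff P (seg a b t) (p (seg a b t))) ->
  (forall t, 0 <= t <= 1 -> nc (k (seg a b t) - p (seg a b t)) <= M) ->
  nc (sint k a b - (P b - P a)) <= M * nc (b - a).
Proof.
move=> ck HP HM.
have H1 : rprim (fun t => (b - a) * p (seg a b t)) (P b - P a).
  exists (fun t => P (seg a b t)); last by rewrite seg0 seg1.
  by move=> t t01; rewrite mulrC; apply: rdiff_comp (rdiff_seg _ _ _) (HP t t01).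
have := rprim_lin (-1) (rprim_cint (seg_rint ck)) H1.
rewrite mulN1r => /rprim_bound; apply=> t t01.
rewrite mulN1r -mulrBr ncM mulrC ler_wpM2r ?nc_ge0 //; exact: HM.
Qed.

End Integral.

(** * Goursat's theorem for triangles *)

Section Goursat.
Variable R : realType.
Local Notation C := R[i].
Implicit Types (k : C -> C) (a b c z : C) (K : C -> Prop).

(** Completeness, through the supremum of the lower ends of nested intervals. *)
Lemma geometric_cvg (x : nat -> R) (d : R) : 0 <= d ->
  (forall n, `|x n.+1 - x n| <= d / 2 ^+ n) ->
  exists l, forall n, `|x n - l| <= 2 * d / 2 ^+ n.
Proof.
move=> d0 Hx; pose r n : R := 2 * d / 2 ^+ n.
have rS n : r n.+1 = d / 2 ^+ n by rewrite /r exprS; field; rewrite expf_neq0.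
have r2 n : r n = d / 2 ^+ n + d / 2 ^+ n by rewrite /r; ring.
have r0 n : 0 <= r n by rewrite /r divr_ge0 ?mulr_ge0 ?exprn_ge0.
have lo n m : (n <= m)%N -> x n - r n <= x m - r m.
  elim: m => [|m IH]; first by rewrite leqn0 => /eqP ->.
  rewrite leq_eqVlt ltnS => /orP[/eqP -> //|/IH /le_trans]; apply.
  by have := Hx m; rewrite ler_norml => /andP[]; rewrite rS r2; lra.
have hi n m : (n <= m)%N -> x m + r m <= x n + r n.
  elim: m => [|m IH]; first by rewrite leqn0 => /eqP ->.
  rewrite leq_eqVlt ltnS => /orP[/eqP -> //|/IH]; apply: le_trans.
  by have := Hx m; rewrite ler_norml => /andP[]; rewrite rS r2; lra.
have lohi n m : x n - r n <= x m + r m.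
  have [nm|/ltnW mn] := leqP n m.
    by apply: le_trans (lo _ _ nm) _; have := r0 m; lra.
  by apply: le_trans (hi _ _ mn); have := r0 n; lra.
pose E := [set y | exists n, y = x n - r n].
have E0 : E !=set0 by exists (x 0%N - r 0%N), 0%N.
have hub m : ubound E (x m + r m) by move=> _ [n ->]; exact: lohi.
have hs : has_sup E by split=> //; exists (x 0%N + r 0%N); exact: hub.
exists (sup E) => n; rewrite -/(r n) ler_norml.
have A1 : x n - r n <= sup E by apply: ub_le_sup; [case: hs|exists n].
have A2 : sup E <= x n + r n by apply: ge_sup => //; exact: hub.
by apply/andP; split; lra.
Qed.

Lemma geometric_cvgC (u : nat -> C) (d : R) : 0 <= d ->
  (forall n, nc (u n.+1 - u n) <= d / 2 ^+ n) ->
  exists l, forall n, nc (u n - l) <= 4 * d / 2 ^+ n.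
Proof.
move=> d0 Hu.
have [|x Hx] := @geometric_cvg (fun n => Re (u n)) d d0.
  move=> n; apply: le_trans (Hu n).
  have -> : Re (u n.+1) - Re (u n) = Re (u n.+1 - u n) by rewrite !ReImE.
  exact: Re_le_nc.
have [|y Hy] := @geometric_cvg (fun n => Im (u n)) d d0.
  move=> n; apply: le_trans (Hu n).
  have -> : Im (u n.+1) - Im (u n) = Im (u n.+1 - u n) by rewrite !ReImE.
  exact: Im_le_nc.
exists (Complex x y) => n; apply: le_trans (nc_le_ReIm _) _.
rewrite !ReImE /=; apply: le_trans (lerD (Hx n) (Hy n)) _.
by rewrite le_eqVlt; apply/orP; left; apply/eqP; ring.
Qed.

Definition cdiffable k z := exists d, cdiff k z d.

Definition cconvex K := forall a b, K a -> K b ->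
  forall t : R, 0 <= t <= 1 -> K (seg a b t).

Definition cclosed K := forall p,
  (forall e : R, 0 < e -> exists2 x, K x & nc (x - p) <= e) -> K p.

Definition tri k a b c := sint k a b + sint k b c + sint k c a.

Definition mid a b := seg a b (2^-1 : R).

Lemma half01 : 0 <= (2^-1 : R) <= 1. Proof. by apply/andP; split; lra. Qed.

Lemma midE a b : mid a b = a + (b - a) / 2.
Proof.
rewrite /mid /seg; congr (_ + _ * _).
by rewrite rmorphV ?unitfE // rmorph_nat.
Qed.

Lemma nc_half z : nc (z / 2) = nc z / 2.
Proof.
by rewrite ncM ncV; congr (_ / _); rewrite -[2](rmorph_nat (real_complex R)) nc_real normr_nat.
Qed.

(** One step of the bisection: a quarter of the integral survives on one of
    the four triangles cut out by the midpoints. *)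
Lemma bisect K k a b c (d tau : R) : cconvex K -> (forall z, K z -> ccont k z) ->
  K a -> K b -> K c -> nc (a - b) <= d -> nc (b - c) <= d -> nc (c - a) <= d ->
  tau <= nc (tri k a b c) ->
  exists a', exists b', exists c',
  [/\ [/\ K a', K b' & K c'],
      [/\ nc (a' - b') <= d / 2, nc (b' - c') <= d / 2 & nc (c' - a') <= d / 2],
      tau / 4 <= nc (tri k a' b' c') & nc (a' - a) <= d].
Proof.
move=> cK ck Ka Kb Kc ab bc ca Ht.
have d0 : 0 <= d by apply: le_trans (nc_ge0 _) ab.
have cs x y : K x -> K y -> contseg k x y.
  by move=> Kx Ky t t01; apply: ck; exact: cK.
have Km x y : K x -> K y -> K (mid x y) by move=> Kx Ky; exact: cK half01.
have sp x y : K x -> K y -> sint k x y = sint k x (mid x y) + sint k (mid x y) y.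
  by move=> Kx Ky; apply: sint_split half01; exact: cs.
pose p := mid a b; pose q := mid b c; pose r := mid c a.
have [Kp Kq Kr] : [/\ K p, K q & K r] by split; exact: Km.
have rv x y : K x -> K y -> sint k x y = - sint k y x.
  by move=> Kx Ky; apply: sint_rev; exact: cs.
have E : tri k a b c = tri k a p r + tri k p b q + tri k r q c + tri k p q r.
  rewrite /tri (sp a b) // (sp b c) // (sp c a) // -/p -/q -/r.
  by rewrite (rv p r) // (rv q p) // (rv r q) //; ring.
have pe : p = a + (b - a) / 2 by exact: midE.
have qe : q = b + (c - b) / 2 by exact: midE.
have re : r = c + (a - c) / 2 by exact: midE.
have h2 x y z w : nc (x - y) <= d -> z - w = (x - y) / 2 -> nc (z - w) <= d / 2.
  by move=> xy ->; rewrite nc_half ler_pM2r.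
have h2' x y z w : nc (x - y) <= d -> z - w = (x - y) / 2 -> nc (z - w) <= d.
  by move=> xy /(h2 _ _ _ _ xy) /le_trans; apply; lra.
have ba : nc (b - a) <= d by rewrite ncBC.
have cb : nc (c - b) <= d by rewrite ncBC.
have ac : nc (a - c) <= d by rewrite ncBC.
have [H|H1] := leP (tau / 4) (nc (tri k a p r)).
  exists a, p, r; split=> //; last by rewrite subrr nc0.
  by split; [apply: (h2 a b)|apply: (h2 b c)|apply: (h2 c a)] => //;
    rewrite ?pe ?qe ?re; field.
have [H|H2] := leP (tau / 4) (nc (tri k p b q)).
  exists p, b, q; split=> //; last by apply: (h2' b a) => //; rewrite pe; field.
  by split; [apply: (h2 a b)|apply: (h2 b c)|apply: (h2 c a)] => //;
    rewrite ?pe ?qe ?re; field.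
have [H|H3] := leP (tau / 4) (nc (tri k r q c)).
  exists r, q, c; split=> //; last by apply: (h2' c a) => //; rewrite re; field.
  by split; [apply: (h2 a b)|apply: (h2 b c)|apply: (h2 c a)] => //;
    rewrite ?pe ?qe ?re; field.
have [H|H4] := leP (tau / 4) (nc (tri k p q r)).
  exists p, q, r; split=> //; last by apply: (h2' b a) => //; rewrite pe; field.
  by split; [apply: (h2 a c)|apply: (h2 b a)|apply: (h2 c b)] => //;
    rewrite ?pe ?qe ?re; field.
exfalso; move: Ht; rewrite E leNgt => /negP; apply.
apply: le_lt_trans (ncD _ _) _.
have := ncD (tri k a p r + tri k p b q) (tri k r q c).
have := ncD (tri k a p r) (tri k p b q); lra.
Qed.

(** The nested triangles shrink to a point where [k] is affine up to a small
    multiple of the distance; affine functions have primitives, hence do not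
    contribute. The set [K] need only be convex and closed, so that the theorem
    also covers intersections of disks. *)
Lemma goursat K k a b c : cconvex K -> cclosed K ->
  (forall z, K z -> cdiffable k z) -> K a -> K b -> K c -> tri k a b c = 0.
Proof.
move=> cK clK dK Ka Kb Kc; apply/eqP/negPn/negP => t0.
pose tau := nc (tri k a b c); have tau0 : 0 < tau by rewrite nc_gt0.
have ck z : K z -> ccont k z by move=> /dK[d Hd]; exact: cdiff_cont Hd.
pose d := nc (a - b) + nc (b - c) + nc (c - a) + 1.
have [n1 n2 n3] : [/\ 0 <= nc (a - b), 0 <= nc (b - c) & 0 <= nc (c - a)].
  by rewrite !nc_ge0.
have d0 : 0 < d by rewrite /d; lra.
pose P n (T : C * C * C) := [/\ [/\ K T.1.1, K T.1.2 & K T.2],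
  [/\ nc (T.1.1 - T.1.2) <= d / 2 ^+ n, nc (T.1.2 - T.2) <= d / 2 ^+ n &
   nc (T.2 - T.1.1) <= d / 2 ^+ n] &
   tau / 4 ^+ n <= nc (tri k T.1.1 T.1.2 T.2)].
have step (nT : nat * (C * C * C)) : exists T', P nT.1 nT.2 -> P nT.1.+1 T' /\
    nc (T'.1.1 - nT.2.1.1) <= d / 2 ^+ nT.1.
  case: nT => n [[x y] z] /=; have [HP|HP] := pselect (P n (x, y, z)); last by exists (x, y, z).
  case: (HP) => /= -[Kx Ky Kz] [xy yz zx] tt.
  have [x' [y' [z' [[? ? ?] [? ? ?] ? ?]]]] := bisect cK ck Kx Ky Kz xy yz zx tt.
  exists (x', y', z') => _; split=> //=.
  have E2 : d / 2 ^+ n.+1 = d / 2 ^+ n / 2 by rewrite exprS invfM mulrA mulrAC.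
  have E4 : tau / 4 ^+ n.+1 = tau / 4 ^+ n / 4 by rewrite exprS invfM mulrA mulrAC.
  by rewrite /P /= E2 E4.
have {step} [F HF] := choice step.
pose T := fix T n := if n is m.+1 then F (m, T m) else (a, b, c).
have PT n : P n (T n).
  elim: n => [|n IH]; last by have [] := HF (n, T n) IH.
  by rewrite /P /= !expr0 !divr1; split => //; split; rewrite /d; lra.
have [|p Hp] := @geometric_cvgC (fun n => (T n).1.1) d (ltW d0).
  by move=> n; have [] := HF (n, T n) (PT n).
have d2 (e : R) : 0 < e -> exists n, 6 * d / 2 ^+ n < e.
  move=> e0; exists (Num.bound (6 * d / e)).
  by rewrite ltr_pdivrMr ?exprn_gt0 // -ltr_pdivrMl // [_^-1 * _]mulrC upper_nthrootP.
have Kp : K p.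
  apply: clK => e /d2[n Hn]; have [[? _ _] _ _] := PT n; exists (T n).1.1 => //.
  apply: le_trans (Hp n) _; apply: le_trans (ltW Hn).
  by rewrite ler_pM2r ?invr_gt0 ?exprn_gt0 // ler_pM2r //; lra.
have [D HD] := dK p Kp.
(* three sides, each within [6 * r] of the limit: this choice of [e] bounds the
   surviving integral by one half of what bisection guarantees *)
pose e := tau / (36 * d ^+ 2).
have e0 : 0 < e by rewrite divr_gt0 // mulr_gt0 // exprn_gt0.
have [l l0 Hl] := HD e e0; have [n Hn] := d2 l l0.
have [[K1 K2 K3] [s1 s2 s3] Ht] := PT n.
move: (Hp n) K1 K2 K3 s1 s2 s3 Ht; case: (T n) => [[x y] z] /= xp K1 K2 K3 s1 s2 s3 Ht.
pose r := d / 2 ^+ n; rewrite -/r in s1 s2 s3.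
have r0 : 0 < r by rewrite divr_gt0 ?exprn_gt0.
have {}xp : nc (x - p) <= 4 * r by rewrite /r mulrA.
have {}Hn : 6 * r < l by rewrite /r mulrA.
have near u v : K u -> K v -> nc (u - x) <= r -> nc (v - u) <= r ->
  nc (sint k u v - ((k p * v + D * ((v - p) ^+ 2 / 2)) - (k p * u + D * ((u - p) ^+ 2 / 2))))
   <= e * (6 * r) * r.
  move=> Ku Kv ux vu.
  have segp t : 0 <= t <= 1 -> nc (seg u v t - p) <= 6 * r.
    move=> /andP[t0' t1].
    have -> : seg u v t - p = (u - x) + (x - p) + (v - u) * (t%:C)%C by rewrite /seg; ring.
    apply: le_trans (ncD _ _) _; rewrite ncM nc_real ger0_norm //.
    have := ncD (u - x) (x - p).
    have : nc (v - u) * t <= r by apply: le_trans vu; rewrite ler_piMr ?nc_ge0.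
    by lra.
  apply: (@le_trans _ _ (e * (6 * r) * nc (v - u))); last first.
    by rewrite ler_wpM2l // mulr_ge0 ?(ltW e0) // mulr_ge0 // ltW.
  apply: (@sint_approx _ _ (fun w => k p * w + D * ((w - p) ^+ 2 / 2))
    (fun w => k p + D * (w - p))).
  - by move=> t t01; apply: ck; exact: cK.
  - move=> t t01; move: (seg u v t) => w.
    have H1 := cdiffB (cdiff_id w) (cdiff_cst p w).
    have H2 := cdiffM (cdiffM H1 H1) (cdiff_cst (2^-1) w).
    have H3 := cdiffD (cdiffZ (k p) (cdiff_id w)) (cdiffZ D H2).
    apply: cdiff_ext (cdiff_eq _ H3); first by move=> ? /=; rewrite expr2.
    by rewrite /=; field.
  - move=> t t01; rewrite opprD addrA.
    apply: le_trans (Hl _ _) _; first exact: le_lt_trans (segp t t01) Hn.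
    by rewrite ler_pM2l // segp.
have N1 := near x y K1 K2.
have N2 := near y z K2 K3.
have N3 := near z x K3 K1.
move: N1 N2 N3; rewrite subrr nc0 (ncBC y x) (ncBC z y) (ncBC x z).
move=> /(_ (ltW r0) s1) N1 /(_ s1 s2) N2 /(_ s3 s3) N3.
set Q := fun u => k p * u + D * ((u - p) ^+ 2 / 2).
have B : nc (tri k x y z) <= 3 * (e * (6 * r) * r).
  have -> : tri k x y z = (sint k x y - (Q y - Q x)) + (sint k y z - (Q z - Q y)) +
     (sint k z x - (Q x - Q z)) by rewrite /tri; ring.
  apply: le_trans (ncD _ _) _; rewrite /Q.
  have := ncD (sint k x y - (Q y - Q x)) (sint k y z - (Q z - Q y)); rewrite /Q; lra.
have : tau / 4 ^+ n <= tau / 2 / 4 ^+ n.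
  apply: (le_trans Ht); apply: (le_trans B); rewrite le_eqVlt; apply/orP; left; apply/eqP.
  have -> : (4 : R) = 2 * 2 by ring.
  rewrite exprMn /e /r; field.
  by rewrite expf_neq0 // gt_eqF.
rewrite ler_pM2r ?invr_gt0 ?exprn_gt0 //; lra.
Qed.

End Goursat.

(** * Primitives in the presence of an exceptional point *)

Section Primitive.
Variable R : realType.
Local Notation C := R[i].
Implicit Types (k q f P : C -> C) (a b c z w : C).

Lemma seg_convex a b c t (r : R) : 0 <= t <= 1 -> nc (a - c) <= r ->
  nc (b - c) <= r -> nc (seg a b t - c) <= r.
Proof.
move=> /andP[t0 t1] ac bc.
have -> : seg a b t - c = ((1 - t)%:C)%C * (a - c) + (t%:C)%C * (b - c).
  by rewrite /seg rmorphB rmorph1; ring.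
apply: le_trans (ncD _ _) _; rewrite !ncM !nc_real !ger0_norm ?subr_ge0 //.
have t1' : 0 <= 1 - t by rewrite subr_ge0.
have := ler_wpM2l t1' ac; have := ler_wpM2l t0 bc; lra.
Qed.

Lemma seg_ball a b t (r : R) : 0 <= t <= 1 -> nc a < r -> nc b < r ->
  nc (seg a b t) < r.
Proof.
move=> t01 ar br; pose m := Num.max (nc a) (nc b).
have am : nc (a - 0) <= m by rewrite subr0 le_max lexx.
have bm : nc (b - 0) <= m by rewrite subr0 le_max lexx orbT.
have := seg_convex t01 am bm; rewrite subr0 => /le_lt_trans; apply.
by rewrite gt_max ar br.
Qed.

Lemma seg_near a b t : 0 <= t <= 1 -> nc (seg a b t - a) <= nc (b - a).
Proof. by move=> t01; apply: seg_convex => //; rewrite subrr nc0 nc_ge0. Qed.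


Lemma cball_closed c (r : R) : cclosed (fun z => nc (z - c) <= r).
Proof.
move=> p Hp; apply/ler_addgt0Pr => e /Hp[x xr xp].
have -> : p - c = (x - c) - (x - p) by ring.
by apply: le_trans (ncB _ _) _; rewrite lerD.
Qed.

(** The two triangles that are cut off lie in a disk avoiding the exceptional
    point. *)
Lemma tri_shrink (r : R) q beta z b : nc beta < r ->
  (forall w, nc w < r -> ccont q w) ->
  (forall w, nc w < r -> w != beta -> cdiffable q w) ->
  nc z < r -> nc b < r -> nc (b - z) < nc (z - beta) / 2 ->
  tri q beta z b = tri q beta (mid beta z) (mid beta b).
Proof.
move=> br cq dq zr wr near.
pose u := z - beta; pose z' := mid beta z; pose b' := mid beta b.
have z'E : z' = beta + (z - beta) / 2 by exact: midE.
have b'E : b' = beta + (b - beta) / 2 by exact: midE.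
have z'r : nc z' < r by apply: seg_ball => //; exact: half01.
have b'r : nc b' < r by apply: seg_ball => //; exact: half01.
have cs x y : nc x < r -> nc y < r -> contseg q x y.
  by move=> xr yr t t01; apply: cq; exact: seg_ball.
have rv x y : nc x < r -> nc y < r -> sint q x y = - sint q y x.
  by move=> Kx Ky; apply: sint_rev; exact: cs.
have spz : sint q beta z = sint q beta z' + sint q z' z.
  by apply: sint_split (half01 _); exact: cs.
have spb : sint q beta b = sint q beta b' + sint q b' b.
  by apply: sint_split (half01 _); exact: cs.
(* [c] is the midpoint of [z'] and [z]; the disk of radius [rho] about it holds
   the four points and misses [beta], at distance [3 / 4 * nc u] *)
pose c := beta + 3 / 4 * u.
pose rho := nc (b - z) + nc u / 4.
pose r' := Num.max (nc beta) (Num.max (nc z) (nc b)).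
have r'r : r' < r by rewrite !gt_max br zr wr.
pose K w := nc (w - 0) <= r' /\ nc (w - c) <= rho.
have cK : cconvex K.
  by move=> x y [x1 x2] [y1 y2] t t01; split; exact: seg_convex.
have clK : cclosed K.
  move=> p Hp; split; [apply: (@cball_closed 0 r')|apply: (@cball_closed c rho)];
    by move=> e /Hp[x [x1 x2] xp]; exists x.
have dK w : K w -> cdiffable q w.
  move=> [w1 w2]; apply: dq; first by apply: le_lt_trans r'r; rewrite -(subr0 w).
  apply/eqP => wb; move: w2; rewrite wb.
  have -> : beta - c = - (3 / 4 * u) by rewrite /c; ring.
  have n34 : nc (3 / 4 : C) = 3 / 4.
    have -> : (3 / 4 : C) = ((3 / 4)%:C)%C by rewrite rmorphM rmorphV ?unitfE // !rmorph_nat.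
    by rewrite nc_real ger0_norm.
  by rewrite ncN ncM n34 /rho -/u; rewrite -/u in near; lra.
have nq : nc (u / 4) = nc u / 4.
  by rewrite ncM ncV; congr (_ / _); rewrite -[4](rmorph_nat (real_complex R)) nc_real normr_nat.
have bz0 := nc_ge0 (b - z).
have Kz : K z.
  split; first by rewrite subr0 !le_max lexx !orbT.
  have -> : z - c = u / 4 by rewrite /c /u; field.
  by rewrite nq /rho; lra.
have Kz' : K z'.
  split.
    by apply: seg_convex (half01 _) _ _; rewrite subr0 !le_max lexx ?orbT.
  have -> : z' - c = - (u / 4) by rewrite z'E /c /u; field.
  by rewrite ncN nq /rho; lra.
have Kb : K b.
  split; first by rewrite subr0 !le_max lexx !orbT.
  have -> : b - c = (b - z) + u / 4 by rewrite /c /u; field.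
  by apply: le_trans (ncD _ _) _; rewrite nq.
have Kb' : K b'.
  split.
    by apply: seg_convex (half01 _) _ _; rewrite subr0 !le_max lexx ?orbT.
  have -> : b' - c = (b - z) / 2 - u / 4 by rewrite b'E /c /u; field.
  by apply: le_trans (ncB _ _) _; rewrite nq nc_half /rho; lra.
have T1 := goursat cK clK dK Kz' Kz Kb.
have T2 := goursat cK clK dK Kz' Kb Kb'.
rewrite /tri -/z' -/b'.
rewrite (rv b beta) // spb spz (rv b' beta) // (rv z' b') //.
move: T1 T2; rewrite /tri (rv b z') // (rv b b') // => T1 T2.
apply/eqP; rewrite -subr_eq0; apply/eqP.
transitivity ((sint q z' z + sint q z b + - sint q z' b) +
   (sint q z' b + - sint q b' b + sint q b' z')); first by ring.
by rewrite T1 T2 addr0.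
Qed.

(** Iterating, the triangle shrinks to the exceptional point, where continuity
    makes its integral tend to zero. *)
Lemma tri_exceptional (r : R) q beta z b : nc beta < r ->
  (forall w, nc w < r -> ccont q w) ->
  (forall w, nc w < r -> w != beta -> cdiffable q w) ->
  nc z < r -> nc b < r -> nc (b - z) < nc (z - beta) / 2 ->
  tri q beta z b = 0.
Proof.
move=> br cq dq zr wr near.
pose zi n := iter n (mid beta) z; pose bi n := iter n (mid beta) b.
have ziE n : zi n - beta = (z - beta) / 2 ^+ n.
  elim: n => [|n IH]; first by rewrite expr0 divr1.
  rewrite /zi iterS -/(zi n) midE exprS invfM.
  by transitivity ((zi n - beta) / 2); [field|rewrite IH; ring].
have biE n : bi n - beta = (b - beta) / 2 ^+ n.
  elim: n => [|n IH]; first by rewrite expr0 divr1.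
  rewrite /bi iterS -/(bi n) midE exprS invfM.
  by transitivity ((bi n - beta) / 2); [field|rewrite IH; ring].
have n2 n : nc ((2 : C) ^+ n) = 2 ^+ n.
  by rewrite ncX -[2](rmorph_nat (real_complex R)) nc_real normr_nat.
have zir n : nc (zi n) < r.
  by elim: n => // n IH; rewrite /zi iterS; apply: seg_ball => //; exact: half01.
have bir n : nc (bi n) < r.
  by elim: n => // n IH; rewrite /bi iterS; apply: seg_ball => //; exact: half01.
have bzi n : bi n - zi n = (b - z) / 2 ^+ n.
  have -> : bi n - zi n = (bi n - beta) - (zi n - beta) by ring.
  by rewrite ziE biE; ring.
have E n : tri q beta z b = tri q beta (zi n) (bi n).
  elim: n => // n ->; apply: (@tri_shrink r) => //.
  rewrite bzi ziE !ncM !ncV n2 mulrAC ltr_pM2r // invr_gt0 exprn_gt0 //.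
have [k k0 Hk] := cq _ br 1 ltr01.
pose M := nc (q beta) + 1; have M0 : 0 < M by rewrite ltr_wpDl ?nc_ge0.
have HM w : nc (w - beta) < k -> nc (q w) <= M.
  move=> /Hk wk; rewrite /M -lerBlDl; apply: le_trans (ncB_ge _ _) wk.
pose L := nc (z - beta) + nc (b - z) + nc (b - beta).
have [l1 l2 l3] : [/\ 0 <= nc (z - beta), 0 <= nc (b - z) & 0 <= nc (b - beta)].
  by rewrite !nc_ge0.
have small x y : nc (x - beta) < k -> nc (y - beta) < k -> nc x < r -> nc y < r ->
    nc (sint q x y) <= M * nc (y - x).
  move=> xk yk xr yr.
  have := @sint_approx R q (fun=> 0) (fun=> 0) x y M; rewrite subrr subr0; apply.
  - by move=> t t01; apply: cq; exact: seg_ball.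
  - by move=> t _; exact: cdiff_cst.
  - move=> t t01; rewrite subr0; apply: HM.
    apply: le_lt_trans (seg_convex (r := Num.max (nc (x - beta)) (nc (y - beta))) t01 _ _) _.
    + by rewrite le_max lexx.
    + by rewrite le_max lexx orbT.
    + by rewrite gt_max xk yk.
apply/eqP; rewrite -nc_eq0 eq_le nc_ge0 andbT; apply/ler_addgt0Pr => e e0.
rewrite add0r.
pose X := (L + 1) / k + M * (L + 1) / e.
have L0 : 0 <= L by rewrite /L; lra.
have A1 : 0 < (L + 1) / k by rewrite divr_gt0 //; lra.
have A2 : 0 < M * (L + 1) / e by rewrite divr_gt0 // mulr_gt0 //; lra.
pose n := Num.bound X.
have n0 : 0 < (2 : R) ^+ n by rewrite exprn_gt0.
have HX : X < 2 ^+ n by exact: upper_nthrootP.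
have H1 : (L + 1) / 2 ^+ n < k.
  by rewrite ltr_pdivrMr // -ltr_pdivrMl // [_^-1 * _]mulrC; apply: lt_trans HX; rewrite /X; lra.
have H2 : M * (L + 1) / 2 ^+ n < e.
  by rewrite ltr_pdivrMr // -ltr_pdivrMl // [_^-1 * _]mulrC; apply: lt_trans HX; rewrite /X; lra.
have dv x : x <= L -> x / 2 ^+ n < k.
  by move=> xL; apply: le_lt_trans H1; rewrite ler_pM2r ?invr_gt0 //; lra.
have zk : nc (zi n - beta) < k by rewrite ziE ncM ncV n2 dv // /L; lra.
have bk : nc (bi n - beta) < k by rewrite biE ncM ncV n2 dv // /L; lra.
have tk : nc (beta - beta) < k by rewrite subrr nc0.
rewrite (E n) /tri.
have S1 := small _ _ tk zk br (zir n).
have S2 := small _ _ zk bk (zir n) (bir n).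
have S3 := small _ _ bk tk (bir n) br.
rewrite ziE ncM ncV n2 in S1; rewrite bzi ncM ncV n2 in S2.
rewrite ncBC biE ncM ncV n2 in S3.
apply: le_trans (ncD _ _) _; apply: le_trans (lerD (ncD _ _) (lexx _)) _.
apply: le_trans (lerD (lerD S1 S2) S3) _; apply: le_trans (ltW H2).
rewrite -!mulrDr -!mulrDl mulrA ler_pM2r ?invr_gt0 // ler_pM2l // /L; lra.
Qed.

(** The primitive integrates along segments issued from the exceptional point,
    so that only triangles with a vertex there have to vanish. *)
Lemma primitive (r : R) q beta : nc beta < r ->
  (forall w, nc w < r -> ccont q w) ->
  (forall w, nc w < r -> w != beta -> cdiffable q w) ->
  exists P, forall z, nc z < r -> cdiff P z (q z).
Proof.
move=> br cq dq; exists (fun z => sint q beta z) => z zr e e0.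
have cs x y : nc x < r -> nc y < r -> contseg q x y.
  by move=> xr yr t t01; apply: cq; exact: seg_ball.
have [k k0 Hk] := cq z zr e e0.
have main : exists2 l, 0 < l & forall w, nc (w - z) < l -> nc w < r ->
    sint q beta w - sint q beta z = sint q z w.
  have [->|zb] := eqVneq z beta.
    have s0 : sint q beta beta = 0.
      have /eqP := sint_rev (cs _ _ br br).
      rewrite -addr_eq0 -mulr2n => /eqP H; apply/eqP.
      by move/eqP: H; rewrite mulrn_eq0.
    by exists 1 => // w _ _; rewrite s0 subr0.
  exists (nc (z - beta) / 2); first by rewrite divr_gt0 // nc_gt0 subr_eq0.
  move=> w wz wr.
  have := tri_exceptional br cq dq zr wr wz; rewrite /tri => T.
  have rv := sint_rev (cs _ _ br wr); rewrite rv in T.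
  by move/eqP: T; rewrite subr_eq0 => /eqP <-; ring.
have [l l0 Hl] := main.
exists (Num.min k (Num.min l (r - nc z))); first by rewrite !lt_min k0 l0 subr_gt0.
move=> w; rewrite !lt_min => /and3P[wk wl wr].
have wr' : nc w < r.
  by rewrite -(subrK z w); apply: le_lt_trans (ncD _ _) _; rewrite -ltrBrDr.
rewrite (Hl w) //.
have -> : q z * (w - z) = q z * w - q z * z by rewrite mulrBr.
apply: (@sint_approx _ _ (fun x => q z * x) (fun=> q z)).
- exact: cs.
- by move=> t _; have := cdiffZ (q z) (cdiff_id (seg z w t)); rewrite mulr1.
- move=> t t01; apply: Hk; apply: le_lt_trans wk; exact: seg_near.
Qed.

End Primitive.

(** * The complex exponential *)

Section Cexp.
Variable R : realType.
Local Notation C := R[i].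
Implicit Types (z w : C) (x y : R).

Definition cexp z : C :=
  Complex (expR (Re z) * cos (Im z)) (expR (Re z) * sin (Im z)).

Lemma cexpD z w : cexp (z + w) = cexp z * cexp w.
Proof.
by apply: eq_ReIm; rewrite ?Re_mul ?Im_mul /cexp /= ?ReD ?ImD expRD ?cosD ?sinD; ring.
Qed.

Lemma cexp0 : cexp 0 = 1.
Proof. by apply: eq_ReIm; rewrite /cexp /= expR0 ?cos0 ?sin0 ?mulr1 ?mulr0. Qed.

Lemma nc_cexp z : nc (cexp z) = expR (Re z).
Proof.
rewrite /cexp /= !exprMn -mulrDr cos2Dsin2 mulr1 sqrtr_sqr ger0_norm //.
Qed.

Lemma cexp_neq0 z : cexp z != 0.
Proof. by rewrite -nc_gt0 nc_cexp expR_gt0. Qed.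

Lemma cexp_surj z : z != 0 -> exists c, cexp c = z.
Proof.
rewrite -nc_gt0 => z0; pose r := nc z; pose x := Re z / r; pose y := Im z / r.
have xy : x ^+ 2 + y ^+ 2 = 1.
  rewrite /x /y !exprMn -mulrDl -nc_sqr exprVn divff //.
  by rewrite expf_neq0 // gt_eqF.
have x1 : -1 <= x <= 1.
  by rewrite -ler_norml -(@expr_le1 _ 2) ?normr_ge0 // real_normK ?num_real // -xy lerDl sqr_ge0.
have [a0 ax] := acos_def x1.
have s0 := sin_ge0_pi a0.
have sy : sin (acos x) ^+ 2 = y ^+ 2.
  by have := cos2Dsin2 (acos x); rewrite ax -xy => /addrI.
have rx : r * x = Re z by rewrite /x mulrC divfK // gt_eqF.
have ry : r * y = Im z by rewrite /y mulrC divfK // gt_eqF.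
have er : expR (ln r) = r by rewrite lnK // posrE.
move/eqP: sy; rewrite eqf_sqr => /orP[/eqP sy|/eqP sy].
  exists (Complex (ln r) (acos x)); apply: eq_ReIm; rewrite /cexp /= er.
    by rewrite ax.
  by rewrite sy.
exists (Complex (ln r) (- acos x)); apply: eq_ReIm; rewrite /cexp /= er.
  by rewrite cosN ax.
by rewrite sinN sy opprK.
Qed.

(** The general case follows by the functional equation. *)
Lemma cdiff_cexp0 : cdiff cexp 0 1.
Proof.
move=> e e0; pose e1 := Num.min 1 (e / 9).
have e10 : 0 < e1 by rewrite lt_min ltr01 divr_gt0.
have e11 : e1 <= 1 by rewrite /e1 ge_min lexx.
have e19 : 9 * e1 <= e by rewrite mulrC -ler_pdivlMr // /e1 ge_min lexx orbT.
clearbody e1.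
have [kE kE0 HE] := (is_derive_epsP _ _ _).1 (@is_derive_expR R 0) _ e10.
have [kc kc0 Hc] := (is_derive_epsP _ _ _).1 (@is_derive_cos R 0) _ e10.
have [ks ks0 Hs] := (is_derive_epsP _ _ _).1 (@is_derive_sin R 0) _ e10.
exists (Num.min (Num.min kE kc) (Num.min ks e1)); first by rewrite !lt_min kE0 kc0 ks0 e10.
move=> w; rewrite subr0 !lt_min => /andP[/andP[wE wc] /andP[ws we]].
set x := Re w; set y := Im w.
have xw : `|x| <= nc w by exact: Re_le_nc.
have yw : `|y| <= nc w by exact: Im_le_nc.
have := HE x; have := Hc y; have := Hs y.
rewrite !subr0 sin0 cos0 expR0 subr0 !mul1r oppr0 mul0r subr0.
move=> /(_ (le_lt_trans yw ws)) Bs /(_ (le_lt_trans yw wc)) Bc.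
move=> /(_ (le_lt_trans xw wE)) BE.
have x0 := normr_ge0 x; have y0 := normr_ge0 y.
have ex1 : e1 * `|x| <= `|x| by rewrite ler_piMl.
have B1 : `|expR x - 1| <= 2 * `|x|.
  have -> : expR x - 1 = (expR x - 1 - x) + x by ring.
  by apply: le_trans (ler_normD _ _) _; lra.
have B3 : expR x <= 3 by move: B1; rewrite ler_norml => /andP[_]; lra.
have E0 := expR_gt0 x.
have -> : cexp w - cexp 0 - w =
  Complex ((expR x - 1 - x) + expR x * (cos y - 1))
          (expR x * (sin y - y) + (expR x - 1) * y).
  by rewrite cexp0; apply: eq_ReIm; rewrite ?(ReD,ReN,ImD,ImN) /cexp /= -/x -/y; ring.
apply: le_trans (nc_le_ReIm _) _ => /=.
have R1 : `|expR x * (cos y - 1)| <= 3 * (e1 * `|y|).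
  by rewrite normrM (gtr0_norm E0) ler_pM // ltW.
have R2 : `|expR x * (sin y - y)| <= 3 * (e1 * `|y|).
  by rewrite normrM (gtr0_norm E0) ler_pM // ltW.
have R3 : `|(expR x - 1) * y| <= 2 * e1 * `|y|.
  rewrite normrM ler_wpM2r //; apply: le_trans B1 _.
  by rewrite ler_pM2l //; apply: le_trans xw (ltW we).
have D1 := ler_normD (expR x - 1 - x) (expR x * (cos y - 1)).
have D2 := ler_normD (expR x * (sin y - y)) ((expR x - 1) * y).
have M1 : e1 * `|x| <= e1 * nc w by rewrite ler_pM2l.
have M2 : e1 * `|y| <= e1 * nc w by rewrite ler_pM2l.
have M3 : 9 * e1 * nc w <= e * nc w by rewrite ler_wpM2r ?nc_ge0.
lra.
Qed.

Lemma cdiff_cexp z : cdiff cexp z (cexp z).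
Proof.
have H : cdiff (fun w => w - z) z 1.
  by have := cdiffB (cdiff_id z) (cdiff_cst z z); rewrite subr0.
have E := cdiff_cexp0; rewrite -(subrr z) in E.
have := cdiffZ (cexp z) (cdiff_comp H E); rewrite !mulr1.
by apply: cdiff_ext => w; rewrite -cexpD addrC subrK.
Qed.

(** [tpi] is 2 pi i. With circles parametrised by the unit interval the
    measure dz / (2 pi i) becomes [circ r t] times Lebesgue measure, which
    removes all normalising constants from the Cauchy formula. *)
Definition tpi : C := Complex 0 (2 * pi).
Definition circ (r t : R) : C := (r%:C)%C * cexp (tpi * (t%:C)%C).

Lemma tpi_neq0 : tpi != 0.
Proof.
by rewrite eq_complex /= eqxx /= mulf_neq0 // ?pnatr_eq0 // gt_eqF // pi_gt0.
Qed.

Lemma nc_circ (r t : R) : 0 <= r -> nc (circ r t) = r.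
Proof.
move=> r0; rewrite /circ ncM nc_real ger0_norm // nc_cexp.
have -> : Re (tpi * (t%:C)%C) = 0 by rewrite ReImE /tpi /=; ring.
by rewrite expR0 mulr1.
Qed.

Lemma circ01 (r : R) : circ r 1 = circ r 0.
Proof.
rewrite /circ; congr (_ * _).
have -> : tpi * ((1 : R)%:C)%C = tpi by rewrite rmorph1 mulr1.
have -> : tpi * ((0 : R)%:C)%C = 0 by rewrite rmorph0 mulr0.
apply: eq_ReIm; rewrite /cexp /tpi /= ?expR0 mulr_natl ?cos2pi ?sin2pi ?cos0 ?sin0; ring.
Qed.

Lemma rdiff_circ (r t : R) : rdiff (circ r) t (tpi * circ r t).
Proof.
have H1 := rdiff_lin 0 tpi t.
have H2 := cdiffZ (r%:C)%C (cdiff_cexp (0 + tpi * (t%:C)%C)).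
have := rdiff_comp H1 H2; rewrite add0r.
have -> : (fun s => (r%:C)%C * cexp (0 + tpi * (s%:C)%C)) = circ r.
  by apply/funext => s; rewrite add0r.
by rewrite mulrC.
Qed.

End Cexp.

(** * Cauchy-type integrals over circles *)

Section Cauchy.
Variable R : realType.
Local Notation C := R[i].
Implicit Types (f q P : C -> C) (a b c z w : C) (h : R -> C).

Lemma rcont_circ (r : R) : rcont (@circ R r).
Proof. exact: rdiff_rcont (rdiff_circ r). Qed.

Lemma cdiffable_cont f z : cdiffable f z -> ccont f z.
Proof. by move=> [d]; exact: cdiff_cont. Qed.


Lemma rcont_bounded h : rcont h ->
  exists2 M : R, 0 < M & forall t : R, 0 <= t <= 1 -> nc (h t) <= M.
Proof.
move=> ch; have c' : continuous (fun t => nc (h t)).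
  apply: real_cont_eps => t e e0; have [d d0 Hd] := ch t e e0; exists d => // s /Hd sd.
  rewrite ler_norml; apply/andP; split; last exact: le_trans (ncB_ge _ _) sd.
  have := le_trans (ncB_ge (h t) (h s)) _ ; rewrite (ncBC (h t)) => /(_ _ sd); lra.
have [c _ Hc] := @EVT_max R (fun t => nc (h t)) 0 1 ler01 (continuous_subspaceT c').
exists (nc (h c) + 1); first by rewrite ltr_wpDl ?nc_ge0.
move=> t t01; apply: le_trans (Hc t _) _; first by rewrite in_itv.
by rewrite lerDl ler01.
Qed.

(** Differentiation under the integral sign, for a kernel with a quadratic
    remainder. *)
Lemma cdiff_cint (F : R -> C -> C) (F' : R -> C) a (M d : R) : 0 < d -> 0 < M ->
  (forall w, nc (w - a) < d -> rint (fun t => F t w)) -> rint F' ->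
  (forall t w, 0 <= t <= 1 -> nc (w - a) < d ->
     nc (F t w - F t a - F' t * (w - a)) <= M * nc (w - a) ^+ 2) ->
  cdiff (fun w => cint (fun t => F t w)) a (cint F').
Proof.
move=> d0 M0 HF HF' HM e e0.
exists (Num.min d (e / M)); first by rewrite lt_min d0 divr_gt0.
move=> w; rewrite lt_min ltr_pdivlMr // => /andP[wd we].
have aa : nc (a - a) < d by rewrite subrr nc0.
have I1 := rint_lin (-1) (HF w wd) (HF a aa).
have E1 := cint_lin (-1) (HF w wd) (HF a aa).
have I2 := rint_lin (- (w - a)) I1 HF'.
have E2 := cint_lin (- (w - a)) I1 HF'.
have -> : cint (F^~ w) - cint (F^~ a) - cint F' * (w - a) =
  cint (fun t => F t w + (-1) * F t a + (- (w - a)) * F' t).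
  by rewrite E2 E1; ring.
apply: cint_bound => // t t01.
have -> : F t w + (-1) * F t a + (- (w - a)) * F' t =
  F t w - F t a - F' t * (w - a) by ring.
apply: le_trans (HM t w t01 wd) _.
by rewrite expr2 mulrA ler_wpM2r ?nc_ge0 // mulrC ltW.
Qed.

Lemma circ_far (r : R) t a w : nc a < r -> nc (w - a) < (r - nc a) / 2 ->
  (r - nc a) / 2 <= nc (circ r t - w).
Proof.
move=> ar wa; have r0 : 0 <= r by apply: le_trans (ltW ar); exact: nc_ge0.
have := ncB_ge (circ r t) w; rewrite nc_circ //.
have := ncD (w - a) a; rewrite subrK; lra.
Qed.

Lemma nc_neq0 z : 0 < nc z -> z != 0. Proof. by rewrite nc_gt0. Qed.

Lemma rint_kernel h (r : R) w k : nc w < r -> rcont h ->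
  rint (fun t => h t / (circ r t - w) ^+ k).
Proof.
move=> wr ch; apply: rcont_rint; apply: rcontM => //.
apply: (@rcont_comp _ (circ r) (fun z => ((z - w) ^+ k)^-1)); first exact: rcont_circ.
move=> t; have n0 : circ r t - w != 0.
  apply: nc_neq0; apply: lt_le_trans (circ_far t wr (w := w) _).
    by rewrite divr_gt0 // subr_gt0.
  by rewrite subrr nc0 divr_gt0 // subr_gt0.
have Hk j : cdiffable (fun z => (z - w) ^+ j) (circ r t).
  elim: j => [|j [d Hd]]; first by exists 0; apply: cdiff_ext (cdiff_cst 1 _) => z; rewrite expr0.
  have H1 := cdiffB (cdiff_id (circ r t)) (cdiff_cst w _).
  by have H2 := cdiffM H1 Hd; eexists; apply: cdiff_ext H2 => z; rewrite exprS.
have [d Hd] := Hk k; apply: cdiffable_cont; eexists.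
by apply: cdiffV Hd; rewrite expf_neq0.
Qed.

(** The first two powers of the kernel are what it takes to differentiate the
    Cauchy formula twice. *)
Lemma cdiff_kernel1 h (r : R) a : nc a < r -> rcont h ->
  cdiff (fun w => cint (fun t => h t / (circ r t - w) ^+ 1)) a
        (cint (fun t => h t / (circ r t - a) ^+ 2)).
Proof.
move=> ar ch; have [M M0 HM] := rcont_bounded ch.
pose s := (r - nc a) / 2; have s0 : 0 < s by rewrite divr_gt0 // subr_gt0.
have wr w : nc (w - a) < s -> nc w < r.
  by move=> wa; have := ncD (w - a) a; rewrite subrK; rewrite /s in wa; lra.
apply: (@cdiff_cint _ _ a (M * (s^-1) ^+ 3) s) => //.
- by rewrite mulr_gt0 // exprn_gt0 // invr_gt0.
- by move=> w wa; apply: rint_kernel => //; exact: wr.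
- exact: rint_kernel.
move=> t w t01 wa.
have far u : nc (u - a) < s -> (s <= nc (circ r t - u)) by exact: circ_far.
have aa : nc (a - a) < s by rewrite subrr nc0.
have x0 : circ r t - a != 0 by apply: nc_neq0; apply: lt_le_trans (far _ aa).
have y0 : circ r t - w != 0 by apply: nc_neq0; apply: lt_le_trans (far _ wa).
have nx : nc (circ r t - a)^-1 <= s^-1.
  by rewrite ncV lef_pV2 ?far // posrE // nc_gt0.
have ny : nc (circ r t - w)^-1 <= s^-1.
  by rewrite ncV lef_pV2 ?far // posrE // nc_gt0.
have -> : h t / (circ r t - w) ^+ 1 - h t / (circ r t - a) ^+ 1 -
    h t / (circ r t - a) ^+ 2 * (w - a) =
  h t * ((circ r t - a)^-1 ^+ 2 * (circ r t - w)^-1) * (w - a) ^+ 2.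
  by field; rewrite x0 y0.
rewrite !(ncX, ncM) ler_wpM2r ?sqr_ge0 //.
rewrite ler_pM ?nc_ge0 ?HM ?mulr_ge0 ?exprn_ge0 ?nc_ge0 //.
rewrite [_ ^+ 3]exprSr ler_pM ?exprn_ge0 ?nc_ge0 //.
by rewrite ler_pXn2r ?nnegrE ?nc_ge0 // ltW ?invr_gt0.
Qed.

Lemma cdiff_kernel2 h (r : R) a : nc a < r -> rcont h ->
  cdiff (fun w => cint (fun t => h t / (circ r t - w) ^+ 2)) a
        (cint (fun t => (2 * h t) / (circ r t - a) ^+ 3)).
Proof.
move=> ar ch; have [M M0 HM] := rcont_bounded ch.
pose s := (r - nc a) / 2; have s0 : 0 < s by rewrite divr_gt0 // subr_gt0.
have wr w : nc (w - a) < s -> nc w < r.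
  by move=> wa; have := ncD (w - a) a; rewrite subrK; rewrite /s in wa; lra.
apply: (@cdiff_cint _ _ a (M * ((s^-1) ^+ 3 * (3 * s^-1))) s) => //.
- by rewrite !mulr_gt0 // ?exprn_gt0 // invr_gt0.
- by move=> w wa; apply: rint_kernel => //; exact: wr.
- by apply: rint_kernel => //; apply: rcontM => //; exact: rcont_cst.
move=> t w t01 wa.
have far u : nc (u - a) < s -> (s <= nc (circ r t - u)) by exact: circ_far.
have aa : nc (a - a) < s by rewrite subrr nc0.
have x0 : circ r t - a != 0 by apply: nc_neq0; apply: lt_le_trans (far _ aa).
have y0 : circ r t - w != 0 by apply: nc_neq0; apply: lt_le_trans (far _ wa).
have nx : nc (circ r t - a)^-1 <= s^-1.
  by rewrite ncV lef_pV2 ?far // posrE // nc_gt0.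
have ny : nc (circ r t - w)^-1 <= s^-1.
  by rewrite ncV lef_pV2 ?far // posrE // nc_gt0.
have -> : h t / (circ r t - w) ^+ 2 - h t / (circ r t - a) ^+ 2 -
    2 * h t / (circ r t - a) ^+ 3 * (w - a) =
  h t * ((circ r t - a)^-1 ^+ 2 * (circ r t - w)^-1 *
     ((circ r t - w)^-1 + (circ r t - a)^-1 + (circ r t - a)^-1)) * (w - a) ^+ 2.
  by field; rewrite x0 y0.
rewrite ncM [nc ((w - a) ^+ 2)]ncX ler_wpM2r ?sqr_ge0 //.
rewrite ncM ler_pM ?nc_ge0 ?HM //.
rewrite ncM ler_pM ?nc_ge0 //.
  rewrite ncM ncX [_ ^+ 3]exprSr ler_pM ?exprn_ge0 ?nc_ge0 //.
  by rewrite ler_pXn2r ?nnegrE ?nc_ge0 // ltW ?invr_gt0.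
apply: le_trans (ncD _ _) _; apply: le_trans (lerD (ncD _ _) (lexx _)) _; lra.
Qed.

End Cauchy.

(** * Holomorphic functions on disks about the origin *)

Section Holomorphic.
Variable R : realType.
Local Notation C := R[i].
Implicit Types (f g q P F : C -> C) (a b c z w : C) (r : R).

Definition hol r f := forall z, nc z < r -> cdiffable f z.

Definition cder f z : C := xget 0 [set d | cdiff f z d].

Lemma cderE f z d : cdiff f z d -> cder f z = d.
Proof. by move=> H; apply: xget_unique => // w Hw; exact: cdiff_uniq Hw H. Qed.

Lemma cderP f z : cdiffable f z -> cdiff f z (cder f z).
Proof. by move=> [d Hd]; rewrite (cderE Hd). Qed.

Lemma hol_ext r f g : (forall z, nc z < r -> f z = g z) -> hol r f -> hol r g.
Proof.
move=> E H z zr; have [d Hd] := H z zr; exists d.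
apply: (@cdiff_near _ f g z d (r - nc z)) => //; first by rewrite subr_gt0.
move=> w wz; apply: E; rewrite -(subrK z w); apply: le_lt_trans (ncD _ _) _.
by rewrite -ltrBrDr.
Qed.

Lemma hol_sub r r' f : r' <= r -> hol r f -> hol r' f.
Proof. by move=> rr H z zr; apply: H; exact: lt_le_trans rr. Qed.

Lemma hol_cst r c : hol r (fun=> c).
Proof. by move=> z _; exists 0; exact: cdiff_cst. Qed.
Lemma hol_id r : hol r id.
Proof. by move=> z _; exists 1; exact: cdiff_id. Qed.
Lemma holD r f g : hol r f -> hol r g -> hol r (fun z => f z + g z).
Proof. by move=> Hf Hg z zr; have [d Hd] := Hf z zr; have [e He] := Hg z zr; eexists; exact: cdiffD Hd He. Qed.
Lemma holN r f : hol r f -> hol r (fun z => - f z).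
Proof. by move=> Hf z zr; have [d Hd] := Hf z zr; eexists; exact: cdiffN Hd. Qed.
Lemma holB r f g : hol r f -> hol r g -> hol r (fun z => f z - g z).
Proof. by move=> Hf Hg; apply: holD => //; exact: holN. Qed.
Lemma holM r f g : hol r f -> hol r g -> hol r (fun z => f z * g z).
Proof. by move=> Hf Hg z zr; have [d Hd] := Hf z zr; have [e He] := Hg z zr; eexists; exact: cdiffM Hd He. Qed.
Lemma holX r f n : hol r f -> hol r (fun z => f z ^+ n).
Proof.
move=> Hf; elim: n => [|n IH]; first by apply: (hol_ext _ (@hol_cst r 1)) => z _; rewrite expr0.
by apply: (hol_ext _ (holM Hf IH)) => z _; rewrite exprS.
Qed.
Lemma holV r f : (forall z, nc z < r -> f z != 0) -> hol r f ->
  hol r (fun z => (f z)^-1).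
Proof. by move=> f0 Hf z zr; have [d Hd] := Hf z zr; eexists; exact: cdiffV (f0 z zr) Hd. Qed.
Lemma hol_comp r r' f g : (forall z, nc z < r -> nc (f z) < r') ->
  hol r f -> hol r' g -> hol r (fun z => g (f z)).
Proof.
move=> fr Hf Hg z zr; have [d Hd] := Hf z zr; have [e He] := Hg _ (fr z zr).
by eexists; exact: cdiff_comp Hd He.
Qed.
Lemma hol_cexp r f : hol r f -> hol r (fun z => cexp (f z)).
Proof.
move=> Hf z zr; have [d Hd] := Hf z zr.
by eexists; exact: cdiff_comp Hd (cdiff_cexp _).
Qed.
Lemma hol_sum (I : Type) (s : seq I) r (G : I -> C -> C) :
  (forall i, hol r (G i)) -> hol r (fun z => \sum_(i <- s) G i z).
Proof.
move=> H; elim: s => [|i s IH].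
  by apply: (hol_ext _ (@hol_cst r 0)) => z _; rewrite big_nil.
by apply: (hol_ext _ (holD (H i) IH)) => z _; rewrite big_cons.
Qed.

Lemma const_of_deriv0 r f : (forall z, nc z < r -> cdiff f z 0) ->
  forall z, nc z < r -> f z = f 0.
Proof.
move=> H z zr; have r0 : nc (0 : C) < r by rewrite nc0 (le_lt_trans (nc_ge0 z)).
have A t : 0 <= t <= 1 -> rdiff (fun t => f (seg 0 z t)) t 0.
  move=> t01; have := rdiff_comp (rdiff_seg 0 z t) (H _ (seg_ball t01 r0 zr)).
  by rewrite mul0r.
have M0 (t : R) : 0 <= t <= 1 -> nc (0 : C) <= 0 by rewrite nc0.
have := rdiff_mvt A M0; rewrite seg1 seg0 => H0.
by apply/eqP; rewrite -subr_eq0 -nc_eq0 eq_le nc_ge0 andbT.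
Qed.

Lemma circ_ne (r t : R) a : nc a < r -> circ r t - a != 0.
Proof.
move=> ar; have r0 : 0 <= r by rewrite ltW // (le_lt_trans (nc_ge0 a)).
by rewrite -nc_gt0 (lt_le_trans _ (ncB_ge _ _)) // nc_circ // subr_gt0.
Qed.

Lemma nc_gt0_ball r a : nc a < r -> 0 < r.
Proof. exact: le_lt_trans (nc_ge0 a). Qed.

(** Independent of [a], since the derivative in [a] integrates the derivative of
    a function along a closed path. *)
Lemma cint_circ_kernel (r : R) a : nc a < r ->
  cint (fun t => circ r t / (circ r t - a) ^+ 1) = 1.
Proof.
move=> ar; have r0 := nc_gt0_ball ar.
pose J w := cint (fun t => circ r t / (circ r t - w) ^+ 1).
have dJ w : nc w < r -> cdiff J w 0.
  move=> wr; have := cdiff_kernel1 wr (@rcont_circ R r); apply: cdiff_eq.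
  apply: cintE; exists (fun t => - (tpi R)^-1 * (circ r t - w)^-1); last first.
    by rewrite circ01 subrr.
  move=> t _; have ne := circ_ne t wr.
  have H1 := cdiffB (cdiff_id (circ r t)) (cdiff_cst w (circ r t)).
  have H2 := cdiffZ (- (tpi R)^-1) (cdiffV (f := fun z => z - w) ne H1).
  have := rdiff_comp (rdiff_circ r t) H2; congr rdiff.
  by rewrite /=; field; rewrite ne tpi_neq0.
rewrite -/(J a) (const_of_deriv0 dJ ar); apply: cintE.
exists (fun t => (t%:C)%C); last by rewrite rmorph1 rmorph0 subr0.
move=> t _; have -> : circ r t / (circ r t - 0) ^+ 1 = 1.
  rewrite subr0 expr1 divff // -nc_gt0 nc_circ ?ltW //.
have := rdiff_lin 0 1 t; congr rdiff.
by apply/funext => s; rewrite add0r mul1r.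
Qed.

Definition quot f a z := if z == a then cder f a else (f z - f a) / (z - a).

(** The quotient is continuous at [a] and differentiable elsewhere, hence has a
    primitive before its differentiability at [a] is known. *)
Lemma quot_primitive r f a : hol r f -> nc a < r ->
  exists P, forall z, nc z < r -> cdiff P z (quot f a z).
Proof.
move=> Hf ar; have da := cderP (Hf a ar).
have dq w : nc w < r -> w != a -> cdiffable (quot f a) w.
  move=> wr wa; have [d Hd] := Hf w wr.
  have wa0 : w - a != 0 by rewrite subr_eq0.
  have H1 := cdiffB Hd (cdiff_cst (f a) w).
  have H2 := cdiffV (f := fun z => z - a) wa0 (cdiffB (cdiff_id w) (cdiff_cst a w)).
  have H3 := cdiffM H1 H2; eexists.
  apply: (cdiff_near (k := nc (w - a))) H3; first by rewrite nc_gt0.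
  move=> z zw; rewrite /quot ifN //; apply/eqP => za; move: zw.
  by rewrite za ncBC ltxx.
have cq w : nc w < r -> ccont (quot f a) w.
  move=> wr; have [->|wa] := eqVneq w a; last exact: cdiffable_cont (dq w wr wa).
  move=> e e0; have [k k0 Hk] := da e e0; exists k => // z zk.
  rewrite {2}/quot eqxx /quot; case: (eqVneq z a) => [_|za]; first by rewrite subrr nc0 ltW.
  have za0 : z - a != 0 by rewrite subr_eq0.
  have -> : (f z - f a) / (z - a) - cder f a =
    (f z - f a - cder f a * (z - a)) / (z - a) by field.
  by rewrite ncM ncV ler_pdivrMr ?nc_gt0 // Hk.
exact: primitive ar cq dq.
Qed.

Lemma cauchy_formula r rho f a : hol r f -> nc a < rho -> rho < r ->
  f a = cint (fun t => (f (circ rho t) * circ rho t) / (circ rho t - a) ^+ 1).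
Proof.
move=> Hf ar rr; have ar' : nc a < r by exact: lt_trans rr.
have r0 := nc_gt0_ball ar; set q := quot f a.
have [P HP] := quot_primitive Hf ar'; rewrite -/q in HP.
have circr t : nc (circ rho t) < r by rewrite nc_circ // ltW.
have I0 : cint (fun t => q (circ rho t) * circ rho t) = 0.
  apply: cintE; exists (fun t => (tpi R)^-1 * P (circ rho t)); last by rewrite circ01 subrr.
  move=> t _; have := rdiff_comp (rdiff_circ rho t) (cdiffZ (tpi R)^-1 (HP _ (circr t))).
  by congr rdiff; field; exact: tpi_neq0.
have cf : rcont (fun t => f (circ rho t) * circ rho t).
  apply: rcontM; last exact: rcont_circ.
  apply: rcont_comp; first exact: rcont_circ.
  by move=> t; apply: cdiffable_cont; exact: Hf.
have i1 := rint_kernel 1 ar cf.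
have i2 := rint_kernel 1 ar (@rcont_circ R rho).
have E := cint_lin (- f a) i1 i2.
rewrite cint_circ_kernel // mulr1 in E.
move: E; rewrite (_ : cint _ = 0); first by move/eqP; rewrite eq_sym subr_eq0 => /eqP ->.
rewrite -I0; apply: cint_ext => t _; have ne := circ_ne t ar.
rewrite /q /quot ifN; last by rewrite -subr_eq0.
by field.
Qed.

(** Both [f] and its derivative are Cauchy-type integrals of [f] over a circle. *)
Lemma hol_cder r f : hol r f -> hol r (cder f).
Proof.
move=> Hf a ar; pose rho := (nc a + r) / 2.
have [a1 a2] : nc a < rho /\ rho < r by rewrite /rho; split; lra.
have r0 := nc_gt0_ball a1.
have circr t : nc (circ rho t) < r by rewrite nc_circ // ltW.
have cf : rcont (fun t => f (circ rho t) * circ rho t).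
  apply: rcontM; last exact: rcont_circ.
  apply: rcont_comp; first exact: rcont_circ.
  by move=> t; apply: cdiffable_cont; exact: Hf.
have E w : nc w < rho ->
    cder f w = cint (fun t => (f (circ rho t) * circ rho t) / (circ rho t - w) ^+ 2).
  move=> wr; apply: cderE; have := cdiff_kernel1 wr cf.
  apply: (cdiff_near (k := rho - nc w)); first by rewrite subr_gt0.
  move=> z zw; rewrite -(cauchy_formula Hf) // -(subrK w z).
  by apply: le_lt_trans (ncD _ _) _; rewrite -ltrBrDr.
have H : hol rho (cder f); last exact: H.
apply: hol_ext; first by move=> z zr; rewrite (E z zr).
by move=> z zr; eexists; exact: cdiff_kernel2.
Qed.

(** The quotient has a primitive, so it is itself the derivative of a
    holomorphic function. *)
Lemma hol_divide r f b : nc b < r -> hol r f -> f b = 0 ->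
  exists2 q, hol r q & forall z, nc z < r -> f z = (z - b) * q z.
Proof.
move=> br Hf fb; have [P HP] := quot_primitive Hf br; exists (quot f b).
  have HPP : hol r P by move=> z zr; exists (quot f b z); exact: HP.
  by apply: hol_ext (hol_cder HPP) => z zr; exact: cderE (HP z zr).
move=> z zr; rewrite /quot fb; case: eqVneq => [->|zb]; first by rewrite fb subrr mul0r.
by rewrite subr0 mulrC divfK // subr_eq0.
Qed.

Lemma bernoulli_bounded (x K : R) : (forall n : nat, x ^+ n <= K) -> x <= 1.
Proof.
move=> H; rewrite leNgt; apply/negP => x1; pose y := x - 1.
have y0 : 0 < y by rewrite subr_gt0.
have B n : 1 + n%:R * y <= x ^+ n.
  elim: n => [|n IH]; first by rewrite mul0r addr0 expr0.
  rewrite exprS -natr1; have -> : x = 1 + y by rewrite /y; ring.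
  have n0 : 0 <= n%:R * y by rewrite mulr_ge0 // ltW.
  have yn : 0 <= y * (n%:R * y) by rewrite mulr_ge0 // ltW.
  have IH' : (1 + y) * (1 + n%:R * y) <= (1 + y) * (1 + y) ^+ n.
    rewrite ler_pM2l; last by lra.
    by have -> : 1 + y = x by rewrite /y; ring.
  by apply: le_trans IH'; lra.
have K0 : 0 <= K by apply: le_trans (H 0%N); rewrite expr0.
have := Num.Theory.archi_boundP (divr_ge0 K0 (ltW y0)).
rewrite ltr_pdivrMr // => Hn; have := le_trans (B _) (H (Num.bound (K / y))).
by rewrite leNgt => /negP; apply; lra.
Qed.

(** The Cauchy formula for [f ^+ n] loses a factor that does not depend on
    [n]; it disappears when [n] grows. *)
Lemma max_principle r rho f a M : hol r f -> rho < r -> nc a < rho ->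
  (forall z, nc z = rho -> nc (f z) <= M) -> nc (f a) <= M.
Proof.
move=> Hf rr ar HM; have r0 := nc_gt0_ball ar.
have M0 : 0 <= M.
  by apply: le_trans (HM (circ rho 0) (nc_circ _ (ltW r0))); exact: nc_ge0.
have H n : nc (f a) ^+ n <= M ^+ n * (rho / (rho - nc a)).
  have Hn := holX n Hf.
  rewrite -ncX (cauchy_formula Hn ar rr); apply: cint_bound.
    apply: rint_kernel => //; apply: rcontM; last exact: rcont_circ.
    apply: (rcont_comp (k := fun z => f z ^+ n)); first exact: rcont_circ.
    by move=> t; apply: cdiffable_cont; apply: Hn; rewrite nc_circ // ltW.
  move=> t _; have := circ_ne t ar; have := nc_circ t (ltW r0).
  move: (circ rho t) => c nn ne.
  rewrite expr1 !ncM ncX ncV nn -mulrA.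
  apply: ler_pM; rewrite ?exprn_ge0 ?nc_ge0 ?mulr_ge0 ?invr_ge0 ?nc_ge0 ?(ltW r0) //.
    by rewrite lerXn2r ?nnegrE ?nc_ge0 // HM.
  rewrite ler_pM2l // lef_pV2 ?posrE ?subr_gt0 ?nc_gt0 //.
  by apply: le_trans (ncB_ge _ _); rewrite nn.
have [M00|M1] := eqVneq M 0.
  have := H 1%N; rewrite M00 expr1 expr1 mul0r => /le_trans; apply.
  by [].
have {}M0 : 0 < M by rewrite lt_def M1.
rewrite -[M]mul1r -ler_pdivrMr //.
apply: (@bernoulli_bounded _ (rho / (rho - nc a))) => n.
by rewrite expr_div_n ler_pdivrMr ?exprn_gt0 // mulrC H.
Qed.

End Holomorphic.

(** * Schwarz lemma, Moebius maps and logarithms *)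

Section Schwarz.
Variable R : realType.
Local Notation C := R[i].
Implicit Types (f g q P F h : C -> C) (a b c p z w : C) (r : R).
Local Notation hol1 := (@hol R 1).

Lemma conjM z w : conjc (z * w) = conjc z * conjc w.
Proof. exact: rmorphM. Qed.

(** The maximum principle on circles of radius close to one. *)
Lemma schwarz_quotient F : hol1 F -> (forall z, nc z < 1 -> nc (z * F z) <= 1) ->
  forall z, nc z < 1 -> nc (F z) <= 1.
Proof.
move=> HF Hb a a1; rewrite leNgt; apply/negP => x1; set x := nc (F a) in x1.
have x0 : 0 < x by exact: lt_trans x1.
pose m := Num.max (nc a) x^-1; pose rho := (m + 1) / 2.
have m1 : m < 1 by rewrite gt_max a1 invf_lt1.
have am : nc a <= m by rewrite le_max lexx.
have xm : x^-1 <= m by rewrite le_max lexx orbT.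
have [r1 r2] : m < rho /\ rho < 1 by rewrite /rho; split; lra.
have r0 : 0 < rho by apply: le_lt_trans r1; rewrite (le_trans _ am) // nc_ge0.
have := @max_principle R 1 rho F a rho^-1 HF r2 (le_lt_trans am r1).
have H : forall z, nc z = rho -> nc (F z) <= rho^-1.
  move=> z zr; have := Hb z; rewrite zr => /(_ r2).
  by rewrite ncM zr mulrC -ler_pdivlMr // div1r.
move=> /(_ H); rewrite -/x leNgt => /negP; apply.
by rewrite invf_plt ?posrE //; exact: le_lt_trans xm r1.
Qed.

Lemma schwarz_div f : hol1 f -> (forall z, nc z < 1 -> nc (f z) <= 1) -> f 0 = 0 ->
  exists q, [/\ hol1 q, forall z, nc z < 1 -> f z = z * q z,
     forall z, nc z < 1 -> nc (q z) <= 1 & q 0 = cder f 0].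
Proof.
move=> Hf Hb f0; have z1 : nc (0 : C) < 1 by rewrite nc0.
have [q Hq E] := hol_divide z1 Hf f0.
have {}E z : nc z < 1 -> f z = z * q z by move=> /E; rewrite subr0.
exists q; split=> //.
  by apply: schwarz_quotient => // z zr; rewrite -E // Hb.
have [d Hd] := Hq 0 z1; apply/esym/cderE.
have := cdiffM (cdiff_id 0) Hd; rewrite mul1r mul0r addr0.
apply: (cdiff_near (k := 1)) => // w; rewrite subr0 => w1.
by rewrite E.
Qed.

Lemma schwarz f : hol1 f -> (forall z, nc z < 1 -> nc (f z) <= 1) -> f 0 = 0 ->
  forall z, nc z < 1 -> nc (f z) <= nc z.
Proof.
move=> Hf Hb f0 z zr; have [q [_ E Hq _]] := schwarz_div Hf Hb f0.
by rewrite E // ncM ler_piMr ?nc_ge0 // Hq.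
Qed.

Lemma schwarz_deriv f : hol1 f -> (forall z, nc z < 1 -> nc (f z) <= 1) -> f 0 = 0 ->
  nc (cder f 0) <= 1.
Proof.
by move=> Hf Hb f0; have [q [_ _ Hq <-]] := schwarz_div Hf Hb f0; apply: Hq; rewrite nc0.
Qed.

Lemma moebius_id p w : nc (1 - conjc p * w) ^+ 2 - nc (w - p) ^+ 2 =
  (1 - nc p ^+ 2) * (1 - nc w ^+ 2).
Proof. by rewrite !nc_sqr !ReImE ReJ ImJ; ring. Qed.

Lemma moebius_den p w : nc p < 1 -> nc w <= 1 -> 1 - conjc p * w != 0.
Proof.
move=> p1 w1; rewrite -nc_gt0; apply: lt_le_trans (ncB_ge _ _).
rewrite nc1 ncM ncJ subr_gt0; apply: le_lt_trans p1.
by rewrite ler_piMr ?nc_ge0.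
Qed.

Lemma sqr_le1 (x : R) : 0 <= x -> (x ^+ 2 <= 1) = (x <= 1).
Proof. by move=> x0; rewrite expr_le1. Qed.

Lemma moebius_le p w : nc p < 1 -> nc w <= 1 -> nc (w - p) <= nc (1 - conjc p * w).
Proof.
move=> p1 w1; rewrite -ler_sqr ?nnegrE ?nc_ge0 // -subr_ge0 moebius_id.
by rewrite mulr_ge0 // subr_ge0 sqr_le1 ?nc_ge0 // ltW.
Qed.

Definition mob b z := (z - b) / (1 - conjc b * z).

Lemma mob_le1 b z : nc b < 1 -> nc z <= 1 -> nc (mob b z) <= 1.
Proof.
move=> b1 z1; rewrite /mob ncM ncV ler_pdivrMr ?mul1r ?moebius_le //.
by rewrite nc_gt0 moebius_den.
Qed.

Lemma mob_lt1 b z : nc b < 1 -> nc z < 1 -> nc (mob b z) < 1.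
Proof.
move=> b1 z1; rewrite /mob ncM ncV ltr_pdivrMr; last first.
  by rewrite nc_gt0 moebius_den // ltW.
rewrite mul1r -ltr_sqr ?nnegrE ?nc_ge0 // -subr_gt0 moebius_id mulr_gt0 // subr_gt0;
by rewrite expr_lt1 ?nc_ge0.
Qed.

Lemma nc_mob b z : nc b < 1 -> nc z = 1 -> nc (mob b z) = 1.
Proof.
move=> b1 z1; have := moebius_id b z; rewrite z1 expr1n subrr mulr0 => /eqP.
rewrite subr_eq0 eqrXn2 ?nc_ge0 // => /eqP E.
rewrite /mob ncM ncV E divff // gt_eqF // -E nc_gt0 moebius_den //.
by rewrite z1.
Qed.

Lemma mob0 b : mob b b = 0. Proof. by rewrite /mob subrr mul0r. Qed.

Lemma mobK b z : nc b < 1 -> nc z < 1 -> mob (- b) (mob b z) = z.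
Proof.
move=> b1 z1; have d0 : 1 - conjc b * z != 0 by rewrite moebius_den // ltW.
have d1 : 1 - conjc b * b != 0 by rewrite moebius_den // ltW.
set y := mob b z; set e := 1 - conjc b * z in d0.
have E1 : y - - b = z * (1 - conjc b * b) / e by rewrite /y /mob -/e /e; field.
have E2 : 1 - conjc (- b) * y = (1 - conjc b * b) / e.
  by rewrite rmorphN /= /y /mob -/e /e; field.
by rewrite /mob E1 E2; field; rewrite d0.
Qed.

Lemma hol_mob r b : r * nc b <= 1 -> 0 < r -> hol r (mob b).
Proof.
move=> rb r0; apply: holM; first by apply: holB; [exact: hol_id|exact: hol_cst].
apply: holV; last by apply: holB; [exact: hol_cst|apply: holM; [exact: hol_cst|exact: hol_id]].
move=> z zr; rewrite -nc_gt0; apply: lt_le_trans (ncB_ge _ _).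
rewrite nc1 ncM ncJ subr_gt0; have [->|b0] := eqVneq b 0; first by rewrite nc0 mul0r.
by apply: lt_le_trans rb; rewrite mulrC ltr_pM2r ?nc_gt0.
Qed.

Lemma hol_mob1 b : nc b < 1 -> hol1 (mob b).
Proof. by move=> b1; apply: hol_mob; rewrite ?mul1r // ltW. Qed.

(** [schwarz_quotient] for an arbitrary zero, moved to the centre by an
    automorphism of the disk. *)
Lemma mob_quotient b F : nc b < 1 -> hol1 F ->
  (forall z, nc z < 1 -> nc (mob b z * F z) <= 1) ->
  forall z, nc z < 1 -> nc (F z) <= 1.
Proof.
move=> b1 HF Hb z z1; have nb1 : nc (- b) < 1 by rewrite ncN.
rewrite -(mobK b1 z1).
apply: (@schwarz_quotient (fun w => F (mob (- b) w))); last exact: mob_lt1.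
  apply: (@hol_comp R 1 1 (mob (- b)) F) => //; last exact: hol_mob1.
  by move=> w w1; exact: mob_lt1.
move=> w w1; have := Hb _ (mob_lt1 nb1 w1).
by rewrite -{1}[b]opprK mobK.
Qed.

Lemma hol_div_mob b f : nc b < 1 -> hol1 f -> f b = 0 ->
  exists2 g, hol1 g & forall z, nc z < 1 -> f z = mob b z * g z.
Proof.
move=> b1 Hf fb; have [q Hq E] := hol_divide b1 Hf fb.
exists (fun z => q z * (1 - conjc b * z)).
  by apply: holM => //; apply: holB; [exact: hol_cst|apply: holM; [exact: hol_cst|exact: hol_id]].
move=> z z1; rewrite E // /mob; field; exact: moebius_den b1 (ltW z1).
Qed.

Lemma schwarz_pick f : hol1 f -> (forall z, nc z < 1 -> nc (f z) <= 1) ->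
  nc (f 0) < 1 ->
  (forall z, nc z < 1 -> nc (f z - f 0) <= nc z * nc (1 - conjc (f 0) * f z)) /\
  nc (cder f 0) <= 1 - nc (f 0) ^+ 2.
Proof.
move=> Hf Hb p1; set p := f 0 in p1 *; pose s z := mob p (f z).
have den z : nc z < 1 -> 1 - conjc p * f z != 0 by move=> z1; rewrite moebius_den // Hb.
have z0 : nc (0 : C) < 1 by rewrite nc0.
have Hs : hol1 s.
  apply: holM; first by apply: holB => //; exact: hol_cst.
  by apply: holV => //; apply: holB; [exact: hol_cst|apply: holM => //; exact: hol_cst].
have Hs1 z : nc z < 1 -> nc (s z) <= 1 by move=> z1; rewrite mob_le1 // Hb.
have s0 : s 0 = 0 by rewrite /s mob0.
split=> [z z1|].
  have := schwarz Hs Hs1 s0 z1; rewrite /s /mob ncM ncV ler_pdivrMr //.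
  by rewrite nc_gt0 den.
have q0 : 0 < 1 - nc p ^+ 2 by rewrite subr_gt0 expr_lt1 ?nc_ge0.
have d0 : 1 - conjc p * p = ((1 - nc p ^+ 2)%:C)%C.
  by rewrite mulrC mulJ rmorphB rmorph1.
have := schwarz_deriv Hs Hs1 s0.
have -> : cder s 0 = cder f 0 / (1 - conjc p * p).
  apply: cderE; have Hd := cderP (Hf 0 z0).
  have H1 := cdiffB Hd (cdiff_cst p 0).
  have H2 := cdiffB (cdiff_cst 1 0) (cdiffZ (conjc p) Hd).
  have H3 := cdiffM H1 (cdiffV (f := fun z => 1 - conjc p * f z) (den 0 z0) H2).
  apply: cdiff_eq H3; rewrite -/p; field; exact: den z0.
by rewrite ncM ncV d0 nc_real gtr0_norm // ler_pdivrMr // mul1r.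
Qed.

(** Schwarz-Pick for [t * f], as [t] tends to one, gives
    [nc (f z - f 0) <= nc z * nc (f z - f 0)]. *)
Lemma strong_max f : hol1 f -> (forall z, nc z < 1 -> nc (f z) <= 1) ->
  nc (f 0) = 1 -> forall z, nc z < 1 -> f z = f 0.
Proof.
move=> Hf Hb n1 z z1; apply/eqP; rewrite -subr_eq0 -nc_eq0; apply/negPn/negP => D0.
set c := f 0 in n1 D0 *; set D := nc (f z - c) in D0.
have {}D0 : 0 < D by rewrite lt_def D0 nc_ge0.
have z0 := nc_ge0 z.
have key (t : R) : 0 < t < 1 -> t * D <= nc z * (D + (1 - t ^+ 2)).
  move=> /andP[t0 t1]; have tn : nc ((t%:C)%C : C) = t by rewrite nc_real gtr0_norm.
  pose ft z := (t%:C)%C * f z.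
  have Hft : hol1 ft by apply: holM => //; exact: hol_cst.
  have Bft w : nc w < 1 -> nc (ft w) <= 1.
    by move=> w1; rewrite /ft ncM tn mulr_ile1 ?nc_ge0 ?Hb // ltW.
  have ft0 : nc (ft 0) < 1 by rewrite /ft ncM tn n1 mulr1.
  have [/(_ z z1) + _] := schwarz_pick Hft Bft ft0.
  have -> : ft z - ft 0 = (t%:C)%C * (f z - c) by rewrite /ft -/c; ring.
  rewrite ncM tn => /le_trans; apply; rewrite ler_wpM2l //.
  have -> : 1 - conjc (ft 0) * ft z =
      conjc c * (c - f z) + ((1 - t ^+ 2)%:C)%C * (conjc c * f z).
    have cc : conjc c * c = 1 by rewrite mulrC mulJ n1 expr1n.
    have jt : conjc ((t%:C)%C : C) = (t%:C)%C by apply: eq_ReIm; rewrite /= ?oppr0.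
    by rewrite mulrBr cc /ft -/c conjM jt rmorphB rmorphXn rmorph1 /=; ring.
  apply: le_trans (ncD _ _) _; rewrite !ncM ncJ n1 !mul1r nc_real ncBC -/D lerD2l.
  have t2 : 0 <= 1 - t ^+ 2 by rewrite subr_ge0 expr_le1 ?ltW.
  by rewrite ger0_norm // ler_piMr // Hb.
(* small enough for [key] at [t = 1 - eta] to be absurd *)
pose eta := Num.min (2^-1) (D * (1 - nc z) / (2 * (2 + D))).
have zz : 0 < 1 - nc z by rewrite subr_gt0.
have e0 : 0 < eta by rewrite lt_min invr_gt0 ltr0n /= divr_gt0 ?mulr_gt0 //; lra.
have e1 : eta <= 2^-1 by rewrite ge_min lexx.
have e2 : eta * (2 * (2 + D)) <= D * (1 - nc z).
  by rewrite -ler_pdivlMr ?ge_min ?lexx ?orbT // mulr_gt0 //; lra.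
have /key : 0 < 1 - eta < 1 by apply/andP; split; lra.
have -> : 1 - (1 - eta) ^+ 2 = 2 * eta - eta ^+ 2 by ring.
have s1 : nc z * (D + (2 * eta - eta ^+ 2)) <= nc z * D + 2 * eta.
  have p1 : 0 <= nc z * eta ^+ 2 by rewrite mulr_ge0 // sqr_ge0.
  have p2 : nc z * eta <= eta by rewrite ler_piMl ?ltW.
  lra.
move=> /le_trans /(_ s1) H.
have e3 : 0 < eta * D by rewrite mulr_gt0.
lra.
Qed.

Lemma schwarz_rigid f : hol1 f -> (forall z, nc z < 1 -> nc (f z) <= 1) -> f 0 = 0 ->
  nc (cder f 0) = 1 -> forall z, nc z < 1 -> f z = z * cder f 0.
Proof.
move=> Hf Hb f0; have [q [Hq E Hq1 <-]] := schwarz_div Hf Hb f0 => n1 z z1.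
by rewrite E // (strong_max Hq Hq1 n1 z1).
Qed.

(** With [x] and [y] the moduli at the centre, Schwarz-Pick for the factors
    leaves the gap [(1 - x) * (1 - y) * (1 - x * y)] in Schwarz-Pick for the
    product. The same 1-jet is therefore attained by a Moebius map of a
    contraction, which stays in a smaller disk. *)
Lemma product_not_extremal h1 h2 : hol1 h1 -> hol1 h2 ->
  (forall z, nc z < 1 -> nc (h1 z) <= 1) -> (forall z, nc z < 1 -> nc (h2 z) <= 1) ->
  nc (h1 0) < 1 -> nc (h2 0) < 1 ->
  exists h m, [/\ hol1 h, m < 1, forall z, nc z < 1 -> nc (h z) <= m,
    h 0 = h1 0 * h2 0 & cder h 0 = cder (fun z => h1 z * h2 z) 0].
Proof.
move=> H1 H2 B1 B2 p1 p2; have z0 : nc (0 : C) < 1 by rewrite nc0.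
have [_ D1] := schwarz_pick H1 B1 p1; have [_ D2] := schwarz_pick H2 B2 p2.
set p := h1 0 * h2 0.
have np : nc p = nc (h1 0) * nc (h2 0) by rewrite ncM.
have Dp : cder (fun z => h1 z * h2 z) 0 = cder h1 0 * h2 0 + h1 0 * cder h2 0.
  by apply: cderE; exact: cdiffM (cderP (H1 0 z0)) (cderP (H2 0 z0)).
set d := cder (fun z => h1 z * h2 z) 0 in Dp *.
set x := nc (h1 0) in p1 np D1; set y := nc (h2 0) in p2 np D2.
have [x0 y0] : 0 <= x /\ 0 <= y by rewrite !nc_ge0.
have pn : nc p < 1 by rewrite np mulr_ilt1.
have Q0 : 0 < 1 - nc p ^+ 2 by rewrite subr_gt0 expr_lt1 ?nc_ge0.
have dn : nc d < 1 - nc p ^+ 2.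
  rewrite Dp; apply: le_lt_trans (ncD _ _) _; rewrite !ncM -/x -/y.
  have a1 := ler_wpM2r y0 D1; have a2 := ler_wpM2l x0 D2.
  apply: le_lt_trans (lerD a1 a2) _.
  have : 0 < (1 - x) * (1 - y) * (1 - x * y).
    by rewrite !mulr_gt0 ?subr_gt0 // mulr_ilt1.
  by move=> Hxy; rewrite -subr_gt0; move: Hxy; congr (_ < _); ring.
pose k := d / ((1 - nc p ^+ 2)%:C)%C.
have kn : nc k < 1 by rewrite ncM ncV nc_real gtr0_norm // ltr_pdivrMr // mul1r.
have kz z : nc z < 1 -> nc (k * z) <= nc k.
  by move=> z1; rewrite ncM ler_piMr ?nc_ge0 // ltW.
have np1 : nc (- p) < 1 by rewrite ncN.
pose eta := (1 - nc p ^+ 2) * (1 - nc k ^+ 2) / 4.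
have K0 : 0 < 1 - nc k ^+ 2 by rewrite subr_gt0 expr_lt1 ?nc_ge0.
have e0 : 0 < eta by rewrite divr_gt0 // mulr_gt0.
have kz1 z : nc z < 1 -> nc (k * z) <= 1 by move=> /kz /le_trans; apply; exact: ltW.
exists (fun z => mob (- p) (k * z)), (1 - eta / 2); split.
- apply: (@hol_comp R 1 1 (fun z => k * z) (mob (- p))); last exact: hol_mob1.
    by move=> z /kz /le_lt_trans; apply.
  by apply: holM; [exact: hol_cst|exact: hol_id].
- by rewrite ltrBlDr ltrDl divr_gt0.
- move=> z z1.
  have e1 : eta <= 1.
    rewrite ler_pdivrMr // mul1r; apply: (@le_trans _ _ (1 * 1)); last by lra.
    by apply: ler_pM; rewrite ?(ltW Q0) ?(ltW K0) // lerBlDr lerDl sqr_ge0.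
  rewrite -ler_sqr ?nnegrE ?nc_ge0 //; last by lra.
  apply: (@le_trans _ _ (1 - eta)); last first.
    by rewrite sqrrB expr1n mul1r -subr_ge0; have := sqr_ge0 (eta / 2); lra.
  have den : 0 < nc (1 - conjc (- p) * (k * z)) by rewrite nc_gt0 moebius_den ?kz1.
  rewrite /mob ncM ncV expr_div_n ler_pdivrMr ?exprn_gt0 //.
  have := moebius_id (- p) (k * z); set A := nc (1 - _) in den *; set B := nc (_ - _).
  rewrite ncN => E.
  have A2 : A <= 2.
    apply: le_trans (ncB _ _) _; rewrite nc1 ncM ncJ ncN.
    have : nc p * nc (k * z) <= 1 by rewrite mulr_ile1 ?nc_ge0 ?kz1 // ltW.
    lra.
  have A4 : A ^+ 2 <= 4.
    have -> : (4 : R) = 2 ^+ 2 by ring.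
    by rewrite lerXn2r ?nnegrE ?nc_ge0.
  have k2 : nc (k * z) ^+ 2 <= nc k ^+ 2 by rewrite lerXn2r ?nnegrE ?nc_ge0 ?kz.
  have F1 : (1 - nc p ^+ 2) * (1 - nc k ^+ 2) <= A ^+ 2 - B ^+ 2.
    by rewrite E ler_pM2l // lerD2l lerN2.
  have F2 : eta * A ^+ 2 <= eta * 4 by rewrite ler_pM2l.
  have F3 : eta * 4 = (1 - nc p ^+ 2) * (1 - nc k ^+ 2) by rewrite /eta divfK.
  rewrite F3 in F2; lra.
- by rewrite /mob !mulr0 subr0 divr1 sub0r opprK.
- apply: cderE.
  have J1 := cdiffB (cdiffZ k (cdiff_id 0)) (cdiff_cst (- p) 0).
  have J2 := cdiffB (cdiff_cst 1 0) (cdiffZ (conjc (- p)) (cdiffZ k (cdiff_id 0))).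
  have n0 : 1 - conjc (- p) * (k * 0) != 0 by rewrite !mulr0 subr0 oner_neq0.
  have J3 := cdiffM J1 (cdiffV (f := fun z => 1 - conjc (- p) * (k * z)) n0 J2).
  apply: cdiff_eq J3.
  have conjN1 : conjc (- p) = - conjc p by exact: rmorphN.
  rewrite /= !mulr0 subr0 conjN1.
  transitivity (k * (1 - p * conjc p)); first by field.
  have -> : 1 - p * conjc p = ((1 - nc p ^+ 2)%:C)%C by rewrite mulJ rmorphB rmorph1.
  rewrite /k divfK //.
  by rewrite -nc_gt0 nc_real normr_gt0 gt_eqF.
Qed.

Lemma hol_primitive k : hol1 k -> exists P, forall z, nc z < 1 -> cdiff P z (k z).
Proof.
move=> Hk; apply: (@primitive R 1 k 0); first by rewrite nc0.
  by move=> w w1; apply: cdiffable_cont; exact: Hk.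
by move=> w w1 _; exact: Hk.
Qed.

(** The logarithm is a primitive of the logarithmic derivative. *)
Lemma hol_log g : hol1 g -> (forall z, nc z < 1 -> g z != 0) ->
  exists2 u, hol1 u & forall z, nc z < 1 -> g z = cexp (u z).
Proof.
move=> Hg g0; have z0 : nc (0 : C) < 1 by rewrite nc0.
have Hk : hol1 (fun z => cder g z / g z).
  by apply: holM; [exact: hol_cder|exact: holV].
have [P HP] := hol_primitive Hk.
have [c Hc] := cexp_surj (g0 0 z0).
pose u z := P z + (c - P 0); exists u.
  by move=> z z1; eexists; exact: cdiffD (HP z z1) (cdiff_cst _ z).
move=> z z1; pose Q z := g z * cexp (- u z).
have dQ w : nc w < 1 -> cdiff Q w 0.
  move=> w1; have U := cdiffD (HP w w1) (cdiff_cst (c - P 0) w).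
  have := cdiffM (cderP (Hg w w1)) (cdiff_comp (cdiffN U) (cdiff_cexp (- u w))).
  by apply: cdiff_eq; rewrite /u; field; exact: g0.
have := const_of_deriv0 dQ z1; rewrite /Q.
have -> : u 0 = c by rewrite /u addrC subrK.
have E w : cexp w * cexp (- w) = 1 by rewrite -cexpD subrr cexp0.
rewrite -Hc E => H.
by rewrite -[LHS]mulr1 -(E (u z)) mulrA mulrAC H mul1r.
Qed.

End Schwarz.

(** * Extremal disks *)

Section Extremal.
Variable R : realType.
Local Notation C := R[i].
Local Notation hol1 := (@hol R 1).

Definition sq (n : nat) (v : 'I_n -> C) : R := \sum_(j < n) nc (v j) ^+ 2.

(** The square of the modulus of [c * exp (|v|^2 / 2)]: the domain is the set of
    points [(v, c)] of mass less than one. *)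
Definition mass n (v : 'I_n -> C) (c : C) : R := nc c ^+ 2 * expR (sq v).

Lemma sq_ge0 n (v : 'I_n -> C) : 0 <= sq v.
Proof. by apply: sumr_ge0 => j _; exact: sqr_ge0. Qed.

Lemma sq_coord n (v : 'I_n -> C) j : nc (v j) ^+ 2 <= sq v.
Proof.
rewrite /sq (bigD1 j) //= lerDl; apply: sumr_ge0 => i _; exact: sqr_ge0.
Qed.

Lemma mass_ltE n (v : 'I_n -> C) c : (nc c ^+ 2 < expR (- sq v)) = (mass v c < 1).
Proof. by rewrite expRN -[X in _ < X]mul1r ltr_pdivlMr // expR_gt0. Qed.

Lemma mass_coord n (v : 'I_n -> C) c : mass v c <= 1 ->
  nc c <= 1 /\ forall j, nc (v j) * nc c <= 1.
Proof.
rewrite /mass => H; have e1 : 1 <= expR (sq v).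
  by apply: le_trans (expR_ge1Dx _); rewrite lerDl sq_ge0.
have c2 := sqr_ge0 (nc c); split.
  rewrite -sqr_le1 ?nc_ge0 //; apply: le_trans H.
  by rewrite ler_peMr.
move=> j; rewrite -sqr_le1 ?mulr_ge0 ?nc_ge0 // exprMn mulrC; apply: le_trans H.
rewrite ler_wpM2l //; apply: le_trans (sq_coord v j) _.
by apply: le_trans (expR_ge1Dx _); rewrite lerDr.
Qed.

(** The derivative is stretched by the factor [t]. *)
Definition same_jet n (z z' : 'I_n -> C -> C) (w w' : C -> C) (t : R) :=
  [/\ forall j, z' j 0 = z j 0, w' 0 = w 0,
      forall j, cder (z' j) 0 = (t%:C)%C * cder (z j) 0 &
      cder w' 0 = (t%:C)%C * cder w 0].

(** What being a geodesic for the Kobayashi metric provides, freed from the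
    infimum in its definition. *)
Definition extremal n (z : 'I_n -> C -> C) (w : C -> C) :=
  forall z' w' (t : R), 1 < t -> (forall j, hol1 (z' j)) -> hol1 w' ->
    (forall l, nc l < 1 -> mass (z' ^~ l) (w' l) < 1) ->
    same_jet z z' w w' t -> False.

(** The gap between [h] and the unit circle leaves room to stretch. The
    coordinates of [z'] may be unbounded, but their products with [g] are not:
    hence perturbations proportional to [g]. *)
Lemma slack n (z z' : 'I_n -> C -> C) (w g h : C -> C) (m : R) :
  extremal z w -> (forall j, hol1 (z' j)) -> hol1 g -> hol1 h ->
  (forall l, nc l < 1 -> mass (z' ^~ l) (g l) <= 1) ->
  m < 1 -> (forall l, nc l < 1 -> nc (h l) <= m) -> g 0 != 0 ->
  same_jet z z' w (fun l => h l * g l) 1 -> False.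
Proof.
move=> ext Hz Hg Hh HM m1 Hm g0 [J1 J2 J3 J4].
have l0 : nc (0 : C) < 1 by rewrite nc0.
have m0 : 0 <= m by apply: le_trans (nc_ge0 _) (Hm 0 l0).
pose z1 j := cder (z j) 0; pose w1 := cder w 0.
have ng0 : 0 < nc (g 0) by rewrite nc_gt0.
pose N := 1 + \sum_j nc (z1 j) + nc w1; pose K := N / nc (g 0).
have sz : 0 <= \sum_j nc (z1 j) by apply: sumr_ge0 => j _; exact: nc_ge0.
have N0 : 0 < N by rewrite /N; have := nc_ge0 w1; lra.
have zN j : nc (z1 j) <= N.
  have : nc (z1 j) <= \sum_j nc (z1 j).
    rewrite (bigD1 j) //= lerDl; apply: sumr_ge0 => i _; exact: nc_ge0.
  by rewrite /N; have := nc_ge0 w1; lra.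
have wN : nc w1 <= N by rewrite /N; lra.
have K0 : 0 < K by rewrite divr_gt0.
pose d := 1 - m; have d0 : 0 < d by rewrite subr_gt0.
have d1 : d <= 1 by rewrite lerBlDr lerDl.
have n0 : 0 <= n%:R :> R by [].
(* [kap] bounds each perturbation relative to [g]. It leaves [h] below
   [1 - d / 2] and adds at most [n * (2 * kap + kap ^+ 2) <= d / 2] to [|z|^2] *)
pose kap := d / (6 * (n%:R + 1)).
have kap0 : 0 < kap by rewrite divr_gt0 // mulr_gt0 //; lra.
have kapE : kap * (6 * (n%:R + 1)) = d by rewrite /kap divfK // gt_eqF // mulr_gt0 //; lra.
have nk : 0 <= n%:R * kap by rewrite mulr_ge0 // ltW.
have kap6 : 6 * kap <= d by lra.
clearbody kap.
pose e := kap / K; have e0 : 0 < e by rewrite divr_gt0.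
have eK : e * K = kap by rewrite /e divfK // gt_eqF.
clearbody e.
pose pert c l := ((e%:C)%C * (c / g 0)) * (l * g l).
have pertB c l : nc l < 1 -> nc c <= N -> nc (pert c l) <= kap * nc (g l).
  move=> l1 cN; rewrite /pert !ncM nc_real ger0_norm ?(ltW e0) // ncV.
  rewrite -eK; apply: ler_pM; rewrite ?mulr_ge0 ?invr_ge0 ?nc_ge0 ?(ltW e0) //.
    by rewrite ler_pM2l // /K ler_pM2r ?invr_gt0.
  by rewrite ler_piMl ?nc_ge0 // ltW.
have holp c : hol1 (pert c).
  apply: holM; first exact: hol_cst.
  by apply: holM => //; exact: hol_id.
have pert0 c : pert c 0 = 0 by rewrite /pert mul0r mulr0.
have dpert c : cdiff (pert c) 0 ((e%:C)%C * c).
  have [dg Hdg] := Hg 0 l0.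
  have := cdiffZ ((e%:C)%C * (c / g 0)) (cdiffM (cdiff_id 0) Hdg).
  by apply: cdiff_eq; rewrite mul1r mul0r addr0; field.
have Hhg : hol1 (fun l => h l * g l) by exact: holM.
apply: (ext (fun j l => z' j l + pert (z1 j) l) (fun l => h l * g l + pert w1 l) (1 + e)).
- by rewrite ltrDl.
- by move=> j; apply: holD.
- by apply: holD.
- move=> l l1; have := HM l l1; set v := (fun j => z' j l) => Mv.
  have [gl1 vg] := mass_coord Mv.
  have gl0 := nc_ge0 (g l).
  pose eta := n%:R * (2 * kap + kap ^+ 2).
  have sq' : sq (fun j => z' j l + pert (z1 j) l) <= sq v + eta.
    have -> : eta = \sum_(j < n) (2 * kap + kap ^+ 2).
      by rewrite sumr_const card_ord /eta mulr_natl.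
    rewrite /sq -big_split /=; apply: ler_sum => j _.
    have B := pertB _ _ l1 (zN j); have P0 := nc_ge0 (pert (z1 j) l).
    have V0 := nc_ge0 (v j).
    apply: (@le_trans _ _ ((nc (v j) + nc (pert (z1 j) l)) ^+ 2)).
      by rewrite lerXn2r ?nnegrE ?addr_ge0 ?nc_ge0 // ncD.
    rewrite sqrrD -addrA lerD2l; apply: lerD.
      rewrite -mulr_natl ler_pM2l //; apply: (le_trans (ler_wpM2l V0 B)).
      by rewrite mulrCA ler_piMr ?(ltW kap0) // vg.
    rewrite lerXn2r ?nnegrE ?(ltW kap0) ?P0 //; apply: le_trans B _.
    by rewrite ler_piMr // ltW.
  have nw : nc (h l * g l + pert w1 l) <= (m + kap) * nc (g l).
    apply: le_trans (ncD _ _) _; rewrite mulrDl lerD ?pertB // ncM ler_wpM2r //.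
    exact: Hm.
  have mk0 : 0 <= m + kap by rewrite addr_ge0 // ltW.
  have x2 : m + kap <= 1 - d / 2 by rewrite /d; rewrite /d in kap6 d1 d0; lra.
  have etad : eta <= d / 2.
    have k2 : kap ^+ 2 <= kap by rewrite expr2 ler_piMr ?ltW //; lra.
    have : n%:R * (kap ^+ 2) <= n%:R * kap by rewrite ler_wpM2l.
    by rewrite /eta; lra.
  have ex : expR (d / 2) * (1 - d / 2) <= 1.
    have := expR_ge1Dx (- (d / 2)); rewrite expRN => H.
    by rewrite -ler_pdivlMl ?expR_gt0 // mulr1.
  rewrite /mass.
  apply: (@le_lt_trans _ _ ((1 - d / 2) ^+ 2 * (mass v (g l) * expR (d / 2)))).
    have -> : (1 - d / 2) ^+ 2 * (mass v (g l) * expR (d / 2)) =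
      ((1 - d / 2) * nc (g l)) ^+ 2 * expR (sq v + d / 2) by rewrite /mass expRD; ring.
    apply: ler_pM; rewrite ?sqr_ge0 ?expR_ge0 //.
      rewrite lerXn2r ?nnegrE ?nc_ge0 ?mulr_ge0 //; first by lra.
      by apply: le_trans nw _; rewrite ler_wpM2r.
    by rewrite ler_expR; apply: le_trans sq' _; rewrite lerD2l.
  apply: (@le_lt_trans _ _ (1 - d / 2)); last by lra.
  rewrite expr2 -mulrA ler_piMr //; first by lra.
  rewrite mulrCA mulr_ile1 //.
  - by rewrite /mass mulr_ge0 ?sqr_ge0 ?expR_ge0.
  - by rewrite mulr_ge0 ?expR_ge0 //; lra.
  - by rewrite mulrC.
- split.
  + by move=> j; rewrite pert0 addr0 J1.
  + by rewrite pert0 addr0 J2.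
  + move=> j; apply: cderE; have := cdiffD (cderP (Hz j 0 l0)) (dpert (z1 j)).
    by apply: cdiff_eq; rewrite J3 rmorphD rmorph1 /z1; ring.
  + apply: cderE; have := cdiffD (cderP (Hhg 0 l0)) (dpert w1).
    by apply: cdiff_eq; rewrite J4 rmorphD rmorph1 /w1; ring.
Qed.

(** In the slice [w = 0] disks can be stretched at will, which rules out a
    double zero of [w] at the centre. *)
Lemma extremal_w_jet n (z : 'I_n -> C -> C) (w : C -> C) :
  extremal z w -> ~ (w 0 = 0 /\ cder w 0 = 0).
Proof.
move=> ext [w0 dw0].
pose zz j l := z j 0 + cder (z j) 0 * l.
pose S := \sum_j (nc (z j 0) + nc (cder (z j) 0)) ^+ 2.
pose c : C := ((expR (- S / 2))%:C)%C.
have c0 : 0 < expR (- S / 2) by exact: expR_gt0.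
apply: (@slack n z zz w (fun=> c) (fun=> 0) 0 ext).
- by move=> j; apply: holD; [exact: hol_cst|apply: holM; [exact: hol_cst|exact: hol_id]].
- exact: hol_cst.
- exact: hol_cst.
- move=> l l1; rewrite /mass /c nc_real gtr0_norm // -expRM_natr -expRD.
  rewrite -[X in _ <= X]expR0 ler_expR.
  suff : sq (zz^~ l) <= S by lra.
  apply: ler_sum => j _; rewrite lerXn2r ?nnegrE ?addr_ge0 ?nc_ge0 //.
  by apply: le_trans (ncD _ _) _; rewrite lerD2l ncM ler_piMr ?nc_ge0 // ltW.
- exact: ltr01.
- by move=> l _; rewrite nc0.
- by rewrite -nc_gt0 nc_real normr_gt0 gt_eqF.
- split.
  + by move=> j; rewrite /zz mulr0 addr0.
  + by rewrite mul0r w0.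
  + by move=> j; rewrite rmorph1 mul1r; apply: cderE; exact: cdiff_affine.
  + rewrite dw0 mulr0; apply: cderE.
    by apply: cdiff_ext (cdiff_cst 0 0) => ?; rewrite mul0r.
Qed.

(** Supporting function: at a point where [z] takes the value [c], the
    holomorphic function [g * exp (<z, c> - |c|^2 / 2)] has the modulus of
    [g * exp (|z|^2 / 2)], and it is not larger elsewhere. *)
Definition support n (c v : 'I_n -> C) (x : C) : C :=
  x * cexp (\sum_j conjc (c j) * v j - ((sq c / 2)%:C)%C).

Lemma Re_sum (I : Type) (r : seq I) (F : I -> C) :
  Re (\sum_(i <- r) F i) = \sum_(i <- r) Re (F i).
Proof. by elim/big_rec2: _ => // i x y _ <-; rewrite ReD. Qed.

Lemma support_le n (c v : 'I_n -> C) x : nc (support c v x) ^+ 2 <= mass v x.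
Proof.
rewrite /support ncM exprMn /mass ler_wpM2l ?sqr_ge0 // nc_cexp -expRM_natr ler_expR.
rewrite ReD ReN ReC Re_sum.
suff : 2 * \sum_j Re (conjc (c j) * v j) <= sq v + sq c by lra.
rewrite mulr_sumr /sq -big_split /=; apply: ler_sum => j _.
rewrite !nc_sqr Re_mul ReJ ImJ.
have := sqr_ge0 (Re (c j) - Re (v j)); have := sqr_ge0 (Im (c j) - Im (v j)).
by rewrite !sqrrB; lra.
Qed.

Lemma support_eq n (c : 'I_n -> C) x : nc (support c c x) ^+ 2 = mass c x.
Proof.
rewrite /support ncM exprMn /mass nc_cexp -expRM_natr; congr (_ * expR _).
rewrite ReD ReN ReC Re_sum.
have -> : \sum_i Re (conjc (c i) * c i) = sq c.
  by apply: eq_bigr => j _; rewrite Re_mul ReJ ImJ nc_sqr; ring.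
by lra.
Qed.

Lemma hol_support n (c : 'I_n -> C) (z : 'I_n -> C -> C) g :
  (forall j, hol1 (z j)) -> hol1 g -> hol1 (fun l => support c (z ^~ l) (g l)).
Proof.
move=> Hz Hg; apply: holM => //; apply: hol_cexp; apply: holB; last exact: hol_cst.
by apply: hol_sum => j; apply: holM => //; exact: hol_cst.
Qed.

(** The Schwarz lemma, applied at each point to the supporting function there:
    this is the maximum principle for [log |g|^2 + |z|^2] without subharmonic
    functions. *)
Lemma mass_div_mob n (z : 'I_n -> C -> C) g b : nc b < 1 ->
  (forall j, hol1 (z j)) -> hol1 g ->
  (forall l, nc l < 1 -> mass (z ^~ l) (mob b l * g l) <= 1) ->
  forall l, nc l < 1 -> mass (z ^~ l) (g l) <= 1.
Proof.
move=> b1 Hz Hg HM a a1; pose c j := z j a.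
rewrite -[mass _ _](support_eq c) sqr_le1 ?nc_ge0 //.
apply: (mob_quotient b1 (hol_support c Hz Hg)) => // l l1.
rewrite -sqr_le1 ?nc_ge0 //.
have -> : mob b l * support c (z^~ l) (g l) = support c (z^~ l) (mob b l * g l).
  by rewrite /support mulrA.
by apply: le_trans (support_le _ _ _) _; exact: HM.
Qed.

(** Finite Blaschke products, by what the factor carrying the zeros is used
    for. *)
Definition blaschke (b : C -> C) := exists rho : R, [/\ 1 < rho, hol rho b,
  forall l, nc l < 1 -> nc (b l) <= 1 & forall l, nc l = 1 -> nc (b l) = 1].

Lemma blaschke1 : blaschke (fun=> 1).
Proof.
exists 2; split; [lra|exact: hol_cst| |] => l _; by rewrite nc1.
Qed.

Lemma blaschke_mob b : nc b < 1 -> blaschke (mob b).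
Proof.
move=> b1; exists (2 / (1 + nc b)); have b0 := nc_ge0 b.
have bp : 0 < 1 + nc b by lra.
split.
- by rewrite ltr_pdivlMr // mul1r; lra.
- apply: hol_mob; last by rewrite divr_gt0.
  by rewrite mulrAC ler_pdivrMr // mul1r; lra.
- by move=> l l1; rewrite mob_le1 // ltW.
- by move=> l l1; rewrite nc_mob.
Qed.

(** With two zeros the last coordinate would contain a product of two Moebius
    maps, which is not extremal. A zero at the centre is divided out first:
    this keeps the remaining factor from vanishing there. *)
Lemma extremal_factor n (z : 'I_n -> C -> C) (w : C -> C) :
  (forall j, hol1 (z j)) -> hol1 w ->
  (forall l, nc l < 1 -> mass (z ^~ l) (w l) < 1) -> extremal z w ->
  exists b g, [/\ blaschke b, hol1 g, forall l, nc l < 1 -> w l = b l * g l,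
    forall l, nc l < 1 -> g l != 0 &
    forall l, nc l < 1 -> mass (z ^~ l) (g l) <= 1].
Proof.
move=> Hz Hw HM ext; have l0 : nc (0 : C) < 1 by rewrite nc0.
have [nz|] := pselect (forall l, nc l < 1 -> w l != 0).
  exists (fun=> 1), w; split => //; first exact: blaschke1.
    by move=> l _; rewrite mul1r.
  by move=> l /HM /ltW.
move=> nnz.
have [b [b1 wb bb]] : exists b, [/\ nc b < 1, w b = 0 & w 0 = 0 -> b = 0].
  have [w0|w0] := eqVneq (w 0) 0; first by exists 0.
  apply: contrapT => H; apply: nnz => l l1; apply/eqP => wl; apply: H.
  by exists l; split => // wz; rewrite wz eqxx in w0.
have [g Hg E] := hol_div_mob b1 Hw wb.
have Mg l : nc l < 1 -> mass (z ^~ l) (g l) <= 1.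
  by move=> l1; apply: (mass_div_mob b1 Hz Hg) => // k k1; rewrite -E // ltW ?HM.
have g0 : g 0 != 0.
  have [w0|] := eqVneq (w 0) 0; last by rewrite E // mulf_eq0 negb_or => /andP[].
  apply/eqP => gz; apply: (extremal_w_jet ext); split => //.
  have := cdiffM (cdiff_id 0) (cderP (Hg 0 l0)); rewrite gz mulr0 mul0r addr0 => H.
  apply: cderE; apply: (cdiff_near (k := 1)) H => // l; rewrite subr0 => l1.
  by rewrite E // (bb w0) /mob subr0 conjc0 mul0r subr0 divr1.
exists (mob b), g; split => //; first exact: blaschke_mob.
move=> b2 b21; apply/eqP => gb2.
have [g2 Hg2 E2] := hol_div_mob b21 Hg gb2.
have Mg2 l : nc l < 1 -> mass (z ^~ l) (g2 l) <= 1.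
  by move=> l1; apply: (mass_div_mob b21 Hz Hg2) => // k k1; rewrite -E2 // Mg.
have g20 : g2 0 != 0 by move: g0; rewrite E2 // mulf_eq0 negb_or => /andP[].
have m1 l : nc l < 1 -> nc (mob b l) <= 1 by move=> l1; rewrite mob_le1 // ltW.
have m2 l : nc l < 1 -> nc (mob b2 l) <= 1 by move=> l1; rewrite mob_le1 // ltW.
have [h [m [Hh m_1 hm h0 dh]]] := product_not_extremal (hol_mob1 b1) (hol_mob1 b21)
  m1 m2 (mob_lt1 b1 l0) (mob_lt1 b21 l0).
have Hmm : hol1 (fun l => mob b l * mob b2 l) by apply: holM; exact: hol_mob1.
apply: (slack ext Hz Hg2 Hh Mg2 m_1 hm g20); split => //.
- by rewrite h0 E // E2 // mulrA.
- by move=> j; rewrite rmorph1 mul1r.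
- rewrite rmorph1 mul1r.
  have A := cdiffM (cderP (Hh 0 l0)) (cderP (Hg2 0 l0)).
  have B := cdiffM (cderP (Hmm 0 l0)) (cderP (Hg2 0 l0)).
  rewrite (cderE A) h0 dh; apply/esym/cderE; apply: (cdiff_near (k := 1)) B => // l.
  by rewrite subr0 => l1; rewrite E // E2 // mulrA.
Qed.

End Extremal.

(** * The Schwarz lemma of the ball *)

Section Ball.
Variable R : realType.
Local Notation C := R[i].
Local Notation hol1 := (@hol R 1).

Definition dot (m : nat) (e v : 'I_m -> C) : C := \sum_i conjc (e i) * v i.

Lemma nc_sum (I : Type) (r : seq I) (F : I -> C) :
  nc (\sum_(i <- r) F i) <= \sum_(i <- r) nc (F i).
Proof.
elim/big_rec2: _ => [|i x y _ H]; first by rewrite nc0.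
by apply: le_trans (ncD _ _) _; rewrite lerD2l.
Qed.

Lemma dot_le1 m (e v : 'I_m -> C) : sq e <= 1 -> sq v <= 1 -> nc (dot e v) <= 1.
Proof.
move=> e1 v1; apply: le_trans (nc_sum _ _) _.
apply: (@le_trans _ _ (\sum_i (nc (e i) ^+ 2 + nc (v i) ^+ 2) / 2)).
  apply: ler_sum => i _; rewrite ncM ncJ.
  by have := sqr_ge0 (nc (e i) - nc (v i)); rewrite sqrrB; lra.
rewrite -mulr_suml big_split /= -/(sq e) -/(sq v); lra.
Qed.

Lemma dot_self m (v : 'I_m -> C) : dot v v = ((sq v)%:C)%C.
Proof.
rewrite /dot /sq rmorph_sum; apply: eq_bigr => i _.
by rewrite mulrC mulJ.
Qed.

Lemma sqZ m (c : C) (v : 'I_m -> C) : sq (fun i => c * v i) = nc c ^+ 2 * sq v.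
Proof. by rewrite /sq mulr_sumr; apply: eq_bigr => i _; rewrite ncM exprMn. Qed.

Lemma dotZl m (c : C) (e v : 'I_m -> C) : dot (fun i => c * e i) v = conjc c * dot e v.
Proof. by rewrite /dot mulr_sumr; apply: eq_bigr => i _; rewrite conjM mulrA. Qed.

Lemma unit_direction m (v : 'I_m -> C) : 0 < sq v ->
  exists2 e : 'I_m -> C, sq e = 1 & dot e v = ((Num.sqrt (sq v))%:C)%C.
Proof.
move=> v0; pose r := Num.sqrt (sq v).
have r0 : 0 < r by rewrite sqrtr_gt0.
have r2 : r ^+ 2 = sq v by rewrite sqr_sqrtr // ltW.
exists (fun i => ((r^-1)%:C)%C * v i).
  rewrite sqZ nc_real ger0_norm ?invr_ge0 ?ltW // -r2; field; rewrite gt_eqF //.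
rewrite dotZl dot_self -/r -r2.
have -> : conjc ((r^-1)%:C)%C = ((r^-1)%:C)%C by apply: eq_ReIm; rewrite /= ?oppr0.
by rewrite -rmorphM /=; congr (_%:C)%C; field; rewrite gt_eqF.
Qed.

Lemma sq_le0 m (v : 'I_m -> C) : sq v <= 0 -> forall i, v i = 0.
Proof.
move=> H i; apply/eqP; rewrite -nc_eq0 -sqrf_eq0 eq_le sqr_ge0 andbT.
exact: le_trans (sq_coord v i) H.
Qed.

Section VectorSchwarz.
Variables (m : nat) (G : 'I_m -> C -> C).
Hypothesis HG : forall i, hol1 (G i).
Hypothesis G1 : forall l, nc l < 1 -> sq (G ^~ l) <= 1.
Hypothesis G0 : forall i, G i 0 = 0.

Let l0 : nc (0 : C) < 1. Proof. by rewrite nc0. Qed.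

Let s e l := dot e (G ^~ l).

Let hol_s e : hol1 (s e).
Proof. by apply: hol_sum => i; apply: holM => //; exact: hol_cst. Qed.

Let s0 e : s e 0 = 0.
Proof. by rewrite /s /dot big1 // => i _; rewrite G0 mulr0. Qed.

Let ds e : cder (s e) 0 = dot e (fun i => cder (G i) 0).
Proof. by apply: cderE; apply: cdiff_sum => i; apply: cdiffZ; exact: cderP (HG i l0). Qed.

Let s1 e : sq e <= 1 -> forall l, nc l < 1 -> nc (s e l) <= 1.
Proof. by move=> e1 l l1; apply: dot_le1 => //; exact: G1. Qed.

Lemma vec_schwarz_deriv : sq (fun i => cder (G i) 0) <= 1.
Proof.
set v := fun i => _; have [v0|v0] := leP (sq v) 0; first exact: le_trans v0 ler01.
have [e e1 ev] := unit_direction v0; have e1' : sq e <= 1 by rewrite e1.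
have := schwarz_deriv (hol_s e) (s1 e1') (s0 e).
rewrite ds -/v ev nc_real ger0_norm ?sqrtr_ge0 // => H.
by rewrite -(sqr_sqrtr (ltW v0)) sqr_le1 ?sqrtr_ge0.
Qed.

Lemma vec_schwarz_le l : nc l < 1 -> sq (G ^~ l) <= nc l ^+ 2.
Proof.
move=> l1; set v := G ^~ l; have [v0|v0] := leP (sq v) 0.
  exact: le_trans v0 (sqr_ge0 _).
have [e e1 ev] := unit_direction v0; have e1' : sq e <= 1 by rewrite e1.
have := schwarz (hol_s e) (s1 e1') (s0 e) l1.
rewrite /s -/v ev nc_real ger0_norm ?sqrtr_ge0 // => H.
by rewrite -(sqr_sqrtr (ltW v0)) lerXn2r ?nnegrE ?sqrtr_ge0 ?nc_ge0.
Qed.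

(** The component along the derivative is linear by the one-dimensional lemma,
    and it already exhausts the norm allowed by [vec_schwarz_le]. *)
Lemma vec_schwarz_rigid : 1 <= sq (fun i => cder (G i) 0) ->
  forall i l, nc l < 1 -> G i l = l * cder (G i) 0.
Proof.
set v := fun i => _ => v1.
have {}v1 : sq v = 1 by apply/eqP; rewrite eq_le v1 vec_schwarz_deriv.
have v1' : sq v <= 1 by rewrite v1.
have sv : cder (s v) 0 = 1 by rewrite ds -/v dot_self v1.
move=> i l l1.
have sl : s v l = l.
  by rewrite (schwarz_rigid (hol_s v) (s1 v1') (s0 v)) // sv ?nc1 // mulr1.
have H : sq (fun i => G i l - l * v i) <= 0.
  have -> : sq (fun i => G i l - l * v i) =
      sq (G ^~ l) - 2 * Re (conjc l * dot v (G ^~ l)) + nc l ^+ 2 * sq v.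
    rewrite /dot mulr_sumr Re_sum mulr_sumr /sq mulr_sumr -sumrN -!big_split /=.
    apply: eq_bigr => j _.
    by rewrite !nc_sqr !(Re_mul, Im_mul, ReD, ImD, ReN, ImN, ReJ, ImJ); ring.
  have dl : dot v (G ^~ l) = l by exact: sl.
  rewrite dl v1 [conjc l * l]mulrC mulJ ReC mulr1.
  have := vec_schwarz_le l1; lra.
by apply/eqP; rewrite -subr_eq0; apply/eqP; exact: (sq_le0 H i).
Qed.

End VectorSchwarz.
End Ball.

(** * The Siegel domain and the exponential covering *)

Section Siegel.
Variable R : realType.
Local Notation C := R[i].
Local Notation hol1 := (@hol R 1).

Lemma Re_div (p q : C) : q != 0 -> Re (p / q) = Re (p * conjc q) / nc q ^+ 2.
Proof.
move=> q0; have n0 : nc q ^+ 2 != 0 by rewrite expf_neq0 // nc_eq0.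
have -> : p * conjc q = (p / q) * ((nc q ^+ 2)%:C)%C by rewrite -mulJ; field.
by rewrite (Re_mul (p / q)) (ReC (nc q ^+ 2)) (ImC (nc q ^+ 2)) mulr0 subr0; field; rewrite nc_eq0.
Qed.

Variable n : nat.
Implicit Types (a v : 'I_n -> C) (x y s : R).

(** The Cayley transform from the ball to the Siegel domain
    [2 Re U + |zeta|^2 < 0], followed by the translation of the Heisenberg
    group that moves the centre to [a] and by the exponential covering map
    [(zeta, U) -> (zeta, exp U)]. *)
Definition cayley_U x (W : C) : C := - (x%:C)%C * ((1 + W) / (1 - W)).

Definition siegel_z a s v (W : C) (j : 'I_n) : C := a j + (s%:C)%C * (v j / (1 - W)).

Definition siegel_lift a y (U : C) v : C :=
  U + Complex 0 y - \sum_j conjc (a j) * v j + ((sq a / 2)%:C)%C.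

Definition siegel_g a x y s v W : C :=
  cexp (siegel_lift a y (cayley_U x W) (siegel_z a s v W)).

Lemma mass_lift a y U v :
  mass v (cexp (siegel_lift a y U v)) = expR (2 * Re U + sq (fun j => v j - a j)).
Proof.
rewrite /mass nc_cexp -expRM_natr -expRD; congr expR.
have -> : sq (fun j => v j - a j) =
    sq v - 2 * Re (\sum_j conjc (a j) * v j) + sq a.
  rewrite Re_sum mulr_sumr /sq -sumrN -!big_split /=; apply: eq_bigr => j _.
  by rewrite !nc_sqr !(Re_mul, Im_mul, ReD, ImD, ReN, ImN, ReJ, ImJ); ring.
by rewrite /siegel_lift !ReD ReN (ReC (sq a / 2)) /=; lra.
Qed.

Lemma Re_cayley x W : 1 - W != 0 ->
  Re (cayley_U x W) = - x * (1 - nc W ^+ 2) / nc (1 - W) ^+ 2.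
Proof.
move=> W1; rewrite /cayley_U Re_mul ReN ImN (ReC x) (ImC x) oppr0 mul0r subr0 Re_div //.
rewrite -mulrA; congr (_ * (_ / _)).
by rewrite nc_sqr Re_mul ReJ ImJ !(ReD, ImD, ReN, ImN, Re1, Im1); ring.
Qed.

(** For positive [x] the mass is below one exactly where the defining function
    of the ball is positive: this is the biholomorphism of the ball with the Siegel domain. *)
Lemma mass_siegel a x y s v W : s ^+ 2 = 2 * x -> 1 - W != 0 ->
  mass (siegel_z a s v W) (siegel_g a x y s v W) =
  expR (- (2 * x * (1 - nc W ^+ 2 - sq v) / nc (1 - W) ^+ 2)).
Proof.
move=> sx W1; rewrite mass_lift Re_cayley //; congr expR.
have -> : sq (fun j => siegel_z a s v W j - a j) = 2 * x * sq v / nc (1 - W) ^+ 2.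
  rewrite -sx -[s ^+ 2]real_normK ?num_real // -nc_real.
  rewrite /sq mulr_sumr mulr_suml; apply: eq_bigr => j _.
  have -> : siegel_z a s v W j - a j = (s%:C)%C * (v j / (1 - W)) by rewrite /siegel_z; ring.
  by rewrite !ncM ncV !exprMn exprVn mulrA.
by field; rewrite nc_eq0.
Qed.

(** The 1-jet at the centre depends on the disk in the ball only through its
    1-jet: competitors may be constructed in the ball. *)
Lemma siegel_jet a x y s (Z : 'I_n -> C -> C) (W : C -> C) (dZ : 'I_n -> C) (dW : C) :
  (forall j, Z j 0 = 0) -> W 0 = 0 -> (forall j, cdiff (Z j) 0 (dZ j)) ->
  cdiff W 0 dW ->
  (forall j, cdiff (fun l => siegel_z a s (Z ^~ l) (W l) j) 0 ((s%:C)%C * dZ j)) /\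
  cdiff (fun l => siegel_g a x y s (Z ^~ l) (W l)) 0
    (siegel_g a x y s (fun=> 0) 0 *
     (- (2 * x)%:C%C * dW - \sum_j conjc (a j) * ((s%:C)%C * dZ j))).
Proof.
move=> Z0 W0 HZ HW.
have HD := cdiffB (cdiff_cst 1 0) HW.
have D0 : (1 : C) - W 0 != 0 by rewrite W0 subr0 oner_neq0.
have HV := cdiffV (f := fun l => 1 - W l) D0 HD.
have Hz j : cdiff (fun l => siegel_z a s (Z ^~ l) (W l) j) 0 ((s%:C)%C * dZ j).
  have := cdiffD (cdiff_cst (a j) 0) (cdiffZ (s%:C)%C (cdiffM (HZ j) HV)).
  by apply: cdiff_eq; rewrite Z0 W0; field.
split=> //.
have HU := cdiffZ (- (x%:C)%C) (cdiffM (cdiffD (cdiff_cst 1 0) HW) HV).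
have HS := cdiff_sum (index_enum 'I_n) (fun j => cdiffZ (conjc (a j)) (Hz j)).
have HL := cdiffD (cdiffB (cdiffD HU (cdiff_cst (Complex 0 y) 0)) HS)
  (cdiff_cst ((sq a / 2)%:C)%C 0).
have H := cdiff_comp HL (cdiff_cexp _).
rewrite /siegel_g /siegel_lift /cayley_U.
eapply cdiff_eq; [|exact: H].
rewrite W0; refine (f_equal2 (fun p q => cexp p * q) _ _).
  refine (f_equal2 (fun p q => p - q + _) erefl _).
  by apply: eq_bigr => j _; rewrite /siegel_z Z0.
rewrite addr0 rmorphM rmorph_nat.
refine (f_equal2 (fun p q => p - q) _ erefl).
by field.
Qed.

Lemma hol_siegel_z r a s (Z : 'I_n -> C -> C) (W : C -> C) j :
  (forall j, hol r (Z j)) -> hol r W -> (forall l, nc l < r -> 1 - W l != 0) ->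
  hol r (fun l => siegel_z a s (Z ^~ l) (W l) j).
Proof.
move=> HZ HW W1; apply: holD; first exact: hol_cst.
apply: holM; first exact: hol_cst.
apply: holM => //; apply: holV => //; apply: holB => //; exact: hol_cst.
Qed.

Lemma hol_siegel_g r a x y s (Z : 'I_n -> C -> C) (W : C -> C) :
  (forall j, hol r (Z j)) -> hol r W -> (forall l, nc l < r -> 1 - W l != 0) ->
  hol r (fun l => siegel_g a x y s (Z ^~ l) (W l)).
Proof.
move=> HZ HW W1; apply: hol_cexp.
apply: holD; last exact: hol_cst.
apply: holB.
  apply: holD; last exact: hol_cst.
  apply: holM; first exact: hol_cst.
  apply: holM; first by apply: holD => //; exact: hol_cst.
  by apply: holV => //; apply: holB => //; exact: hol_cst.
by apply: hol_sum => j; apply: holM; [exact: hol_cst|exact: hol_siegel_z].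
Qed.

End Siegel.

(** * Extremal disks are explicit *)

Section Main.
Variable R : realType.
Local Notation C := R[i].
Local Notation hol1 := (@hol R 1).

Lemma massM n (v : 'I_n -> C) c x : mass v (c * x) = nc c ^+ 2 * mass v x.
Proof. by rewrite /mass ncM exprMn mulrA. Qed.

Lemma lift_split n (a v : 'I_n -> C) y U :
  cexp (siegel_lift a y U v) = cexp U * cexp (siegel_lift a y 0 v).
Proof. by rewrite -cexpD; congr cexp; rewrite /siegel_lift; ring. Qed.

Lemma mass_lift0 n (a : 'I_n -> C) y : mass a (cexp (siegel_lift a y 0 a)) = 1.
Proof.
rewrite mass_lift Re0 mulr0 add0r; have -> : sq (fun j => a j - a j) = 0.
  by rewrite /sq big1 // => j _; rewrite subrr nc0 expr0n.
exact: expR0.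
Qed.

Lemma sq_recl n (G : 'I_n.+1 -> C) :
  sq G = nc (G ord0) ^+ 2 + sq (fun j => G (lift ord0 j)).
Proof. by rewrite /sq big_ord_recl. Qed.

(** Half of the logarithm splits off: the last coordinate is, up to a constant,
    a product of two maps of the disk as in [product_not_extremal]. *)
Lemma extremal_slice n (z : 'I_n -> C -> C) (w b U : C -> C) (a : 'I_n -> C) (y : R) :
  (forall j, hol1 (z j)) -> hol1 w -> extremal z w ->
  (forall l, nc l < 1 -> forall j, z j l = a j) ->
  hol1 b -> (forall l, nc l < 1 -> nc (b l) <= 1) ->
  hol1 U -> (forall l, nc l < 1 -> Re (U l) <= 0) -> Re (U 0) < 0 ->
  (forall l, nc l < 1 -> w l = b l * cexp (siegel_lift a y (U l) (z ^~ l))) -> False.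
Proof.
move=> Hz Hw ext za Hb b1 HU U1 U0 E; have l0 : nc (0 : C) < 1 by rewrite nc0.
pose c := cexp (siegel_lift a y 0 a).
have za' l : nc l < 1 -> z ^~ l = a by move=> l1; apply/funext => j; exact: za.
pose e l := cexp (2^-1 * U l).
have He : hol1 e by apply: hol_cexp; apply: holM => //; exact: hol_cst.
have ee l : e l * e l = cexp (U l) by rewrite -cexpD; congr cexp; field.
have ne l : nc (e l) ^+ 2 = expR (Re (U l)) by rewrite expr2 -ncM ee nc_cexp.
have e1 l : nc l < 1 -> nc (e l) <= 1.
  by move=> l1; rewrite -sqr_le1 ?nc_ge0 // ne expR_le1 U1.
have e01 : nc (e 0) < 1.
  by rewrite -(@expr_lt1 _ 2) ?nc_ge0 // ne expR_lt1.
have H2 : hol1 (fun l => b l * e l) by exact: holM.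
have be1 l : nc l < 1 -> nc (b l * e l) <= 1.
  by move=> l1; rewrite ncM mulr_ile1 ?nc_ge0 ?b1 ?e1.
have be0 : nc (b 0 * e 0) < 1.
  by rewrite ncM; apply: le_lt_trans e01; rewrite ler_piMl ?nc_ge0 // b1.
have [h [m [Hh m1 hm h0 dh]]] := product_not_extremal He H2 e1 be1 e01 be0.
have wE l : nc l < 1 -> w l = e l * (b l * e l) * c.
  move=> l1; rewrite E // lift_split za' // -/c -ee; ring.
apply: (@slack _ n z z w (fun=> c) h m ext) => //.
- exact: hol_cst.
- by move=> l l1; rewrite za' // mass_lift0.
- exact: cexp_neq0.
- split => //.
  + by rewrite h0 wE.
  + by move=> j; rewrite rmorph1 mul1r.
  + rewrite rmorph1 mul1r.
    have A := cdiffM (cderP (Hh 0 l0)) (cdiff_cst c 0).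
    have B := cdiffM (cderP (holM He H2 l0)) (cdiff_cst c 0).
    rewrite (cderE A) h0 dh; apply/esym/cderE; apply: (cdiff_near (k := 1)) B => // l.
    by rewrite subr0 => l1; rewrite wE.
Qed.

(** The zero-free factor has a logarithm, which lifts the disk to the Siegel
    domain and hence to the ball. There extremality forces equality in the
    Schwarz lemma, so that the disk is linear, and all formulas continue past
    the circle unless the line reaches the point at infinity of the Siegel
    domain. *)
Lemma extremal_extends n (z : 'I_n -> C -> C) (w : C -> C) :
  (forall j, hol1 (z j)) -> hol1 w ->
  (forall l, nc l < 1 -> mass (z ^~ l) (w l) < 1) -> extremal z w ->
  exists (rho : R) (Z : 'I_n -> C -> C) (W : C -> C),
  [/\ 1 < rho, forall j, hol rho (Z j), hol rho W,
    forall l, nc l < 1 -> (forall j, Z j l = z j l) /\ W l = w l &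
    forall l, nc l = 1 -> mass (Z ^~ l) (W l) = 1].
Proof.
move=> Hz Hw HM ext; have l0 : nc (0 : C) < 1 by rewrite nc0.
have [b [g [[rb [rb1 Hb b1 bc]] Hg E g0 Mg]]] := extremal_factor Hz Hw HM ext.
have [u Hu gu] := hol_log Hg g0.
have Hb1 : hol1 b by apply: hol_sub Hb; exact: ltW.
pose a j := z j 0.
pose U0 l := u l + \sum_j conjc (a j) * z j l - ((sq a / 2)%:C)%C.
(* the rotation by [y] makes the logarithm real at the centre *)
pose y := Im (U0 0); pose U l := U0 l - Complex 0 y.
have HU : hol1 U.
  apply: holB; last exact: hol_cst.
  apply: holB; last exact: hol_cst.
  by apply: holD => //; apply: hol_sum => j; apply: holM => //; exact: hol_cst.
have gE l : nc l < 1 -> g l = cexp (siegel_lift a y (U l) (z ^~ l)).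
  by move=> l1; rewrite gu //; congr cexp; rewrite /siegel_lift /U /U0; ring.
have HS l : nc l < 1 -> 2 * Re (U l) + sq (fun j => z j l - a j) <= 0.
  by move=> l1; have := Mg l l1; rewrite gE // mass_lift expR_le1.
have ReU l : nc l < 1 -> Re (U l) <= 0.
  by move=> l1; have := HS l l1; have := sq_ge0 (fun j => z j l - a j); lra.
pose x := - Re (U 0).
have x0 : 0 <= x by rewrite oppr_ge0 ReU.
have U00 : U 0 = - (x%:C)%C.
  by apply: eq_ReIm; rewrite /x ?ReN ?ImN /= ?opprK // /U ImD ImN /= subrr oppr0.
have wE l : nc l < 1 -> w l = b l * cexp (siegel_lift a y (U l) (z ^~ l)).
  by move=> l1; rewrite E // gE.
have [xz|xn0] := eqVneq x 0.
  (* [(z, g)] touches the boundary at the centre, so [z] and [g] are constant *)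
  pose F l := cexp (U l).
  have nF l : nc (F l) = expR (Re (U l)) by exact: nc_cexp.
  have F1 l : nc l < 1 -> nc (F l) <= 1 by move=> l1; rewrite nF expR_le1 ReU.
  have F0 : F 0 = 1 by rewrite /F U00 xz oppr0 cexp0.
  have Fc l : nc l < 1 -> F l = 1.
    have HF : hol1 F by exact: hol_cexp.
    have nF0 : nc (F 0) = 1 by rewrite F0 nc1.
    by move=> l1; rewrite (strong_max HF F1 nF0 l1) F0.
  have Re0' l : nc l < 1 -> Re (U l) = 0.
    move=> l1; have := nF l; rewrite Fc // nc1 -expR0 => /expR_inj; exact: esym.
  have za l : nc l < 1 -> forall j, z j l = a j.
    move=> l1 j; apply/eqP; rewrite -subr_eq0; apply/eqP.
    apply: (sq_le0 (v := fun j => z j l - a j)).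
    by have := HS l l1; rewrite Re0' // mulr0 add0r.
  pose c := cexp (siegel_lift a y 0 a).
  exists rb, (fun j _ => a j), (fun l => b l * c); split => //.
  - by move=> j; exact: hol_cst.
  - by apply: holM => //; exact: hol_cst.
  - move=> l l1; split; first by move=> j; rewrite za.
    rewrite wE // lift_split -/(F l) Fc // mul1r; congr (_ * cexp (siegel_lift _ _ _ _)).
    by apply/funext => j; rewrite za.
  - by move=> l l1; rewrite massM mass_lift0 bc // expr1n mulr1.
have {xn0 x0} x0 : 0 < x by rewrite lt_def xn0.
have ReU0 : Re (U 0) < 0 by rewrite -oppr_gt0.
pose s := Num.sqrt (2 * x).
have s2 : s ^+ 2 = 2 * x by rewrite sqr_sqrtr // mulr_ge0 // ltW.
have s0 : 0 < s by rewrite sqrtr_gt0 mulr_gt0.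
have xc0 : (x%:C)%C != 0 :> C by rewrite -nc_gt0 nc_real normr_gt0 gt_eqF.
have sc0 : (s%:C)%C != 0 :> C by rewrite -nc_gt0 nc_real normr_gt0 gt_eqF.
have sc2 : (s%:C)%C * (s%:C)%C = 2 * (x%:C)%C :> C.
  by rewrite -rmorphM -expr2 s2 rmorphM rmorph_nat.
have D0 l : nc l < 1 -> U l - (x%:C)%C != 0.
  move=> l1; apply/eqP => H; have := ReU l l1.
  have -> : U l = (x%:C)%C by apply/eqP; rewrite -subr_eq0 H.
  by rewrite ReC leNgt x0.
pose W l := (U l + (x%:C)%C) / (U l - (x%:C)%C).
pose Z j l := - (s%:C)%C * ((z j l - a j) / (U l - (x%:C)%C)).
have HD : hol1 (fun l => (U l - (x%:C)%C)^-1).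
  by apply: holV => //; apply: holB => //; exact: hol_cst.
have HW : hol1 W by apply: holM => //; apply: holD => //; exact: hol_cst.
have HZ j : hol1 (Z j).
  apply: holM; first exact: hol_cst.
  by apply: holM => //; apply: holB => //; exact: hol_cst.
have W1 l : nc l < 1 -> 1 - W l = - (2 * (x%:C)%C) / (U l - (x%:C)%C).
  by move=> l1; rewrite /W; field; exact: D0.
have W10 l : nc l < 1 -> 1 - W l != 0.
  by move=> l1; rewrite W1 // mulf_neq0 ?invr_eq0 ?D0 // oppr_eq0 mulf_neq0 //.
have UE l : nc l < 1 -> U l = cayley_U x (W l).
  move=> l1; rewrite /cayley_U W1 // /W; field.
  by rewrite xc0 D0.
have zE l : nc l < 1 -> forall j, z j l = siegel_z a s (Z ^~ l) (W l) j.
  move=> l1 j; rewrite /siegel_z W1 // /Z.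
  have -> : (s%:C)%C * (- (s%:C)%C * ((z j l - a j) / (U l - (x%:C)%C)) /
      (- (2 * (x%:C)%C) / (U l - (x%:C)%C))) =
      ((s%:C)%C * (s%:C)%C) * ((z j l - a j) / (2 * (x%:C)%C)).
    by field; rewrite xc0 D0.
  by rewrite sc2; field.
have zE' l : nc l < 1 -> z ^~ l = siegel_z a s (Z ^~ l) (W l).
  by move=> l1; apply/funext => j; exact: zE.
have gS l : nc l < 1 -> g l = siegel_g a x y s (Z ^~ l) (W l).
  by move=> l1; rewrite gE // UE // zE'.
have W0 : W 0 = 0 by rewrite /W U00 addNr mul0r.
have Z0 j : Z j 0 = 0 by rewrite /Z subrr mul0r mulr0.
pose G (i : 'I_n.+1) l := if unlift ord0 i is Some j then Z j l else W l.
have G_0 : G ord0 = W by apply/funext => l; rewrite /G unlift_none.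
have G_S j : G (lift ord0 j) = Z j by apply/funext => l; rewrite /G liftK.
have HG i : hol1 (G i).
  by case: (unliftP ord0 i) => [j|] ->; rewrite ?G_0 ?G_S.
have sqG l : sq (G ^~ l) = nc (W l) ^+ 2 + sq (Z ^~ l).
  by rewrite sq_recl G_0; congr (_ + sq _); apply/funext => j; rewrite G_S.
have G1 l : nc l < 1 -> sq (G ^~ l) <= 1.
  move=> l1; rewrite sqG.
  have -> : sq (Z ^~ l) = 2 * x * sq (fun j => z j l - a j) / nc (U l - (x%:C)%C) ^+ 2.
    rewrite -s2 -[s ^+ 2]real_normK ?num_real // -nc_real.
    rewrite /sq mulr_sumr mulr_suml; apply: eq_bigr => j _.
    by rewrite /Z !ncM ncN ncV !exprMn exprVn mulrA.
  rewrite /W ncM ncV expr_div_n -mulrDl ler_pdivrMr ?exprn_gt0 ?nc_gt0 ?D0 // mul1r.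
  have e1 : nc (U l + (x%:C)%C) ^+ 2 = nc (U l - (x%:C)%C) ^+ 2 + 4 * x * Re (U l).
    move: (U l) => c.
    by rewrite !nc_sqr !(ReD, ImD, ReN, ImN) (ReC x) (ImC x); ring.
  rewrite e1.
  have := ler_wpM2l (ltW x0) (HS l l1); rewrite mulr0; lra.
have G0 i : G i 0 = 0 by rewrite /G; case: unlift => [j|]; [exact: Z0|exact: W0].
pose v j := cder (Z j) 0; pose dW := cder W 0.
have sqdG : sq (fun i => cder (G i) 0) = nc dW ^+ 2 + sq v.
  by rewrite sq_recl G_0; congr (_ + sq _); apply/funext => j; rewrite G_S.
have dG1 := vec_schwarz_deriv HG G1 G0; rewrite sqdG in dG1.
have [dzS dgS] := siegel_jet a x y s Z0 W0 (fun j => cderP (HZ j 0 l0)) (cderP (HW 0 l0)).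
have ZZ0 : Z^~ 0 = fun=> 0 by apply/funext => j; exact: Z0.
have [lt1|ge1] := ltP (nc dW ^+ 2 + sq v) 1.
  (* the linear disk with the same derivative stays in a smaller ball *)
  exfalso; pose Zc j l := v j * l; pose Wc l := dW * l.
  have vq := sq_ge0 v.
  have dW1 : nc dW < 1 by rewrite -(@expr_lt1 _ 2) ?nc_ge0 //; lra.
  have Wc1 l : nc l < 1 -> nc (Wc l) < 1.
    by move=> l1; apply: le_lt_trans dW1; rewrite ncM ler_piMr ?nc_ge0 // ltW.
  have Wc0 l : nc l < 1 -> 1 - Wc l != 0.
    move=> /Wc1 H; rewrite -nc_gt0; apply: lt_le_trans (ncB_ge _ _).
    by rewrite nc1 subr_gt0.
  have HZc j : hol1 (Zc j) by apply: holM; [exact: hol_cst|exact: hol_id].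
  have HWc : hol1 Wc by apply: holM; [exact: hol_cst|exact: hol_id].
  have Zc0 j : Zc j 0 = 0 by rewrite /Zc mulr0.
  have Wc00 : Wc 0 = 0 by rewrite /Wc mulr0.
  have dZc j : cdiff (Zc j) 0 (v j) by have := cdiffZ (v j) (cdiff_id 0); rewrite mulr1.
  have dWc : cdiff Wc 0 dW by have := cdiffZ dW (cdiff_id 0); rewrite mulr1.
  have [dzc dgc] := siegel_jet a x y s Zc0 Wc00 dZc dWc.
  (* on this disk the logarithm of the mass is at most [- 2 * eta], because the
     denominator [nc (1 - Wc l) ^+ 2] in [mass_siegel] is at most 4 *)
  pose eta := x * (1 - (nc dW ^+ 2 + sq v)) / 4.
  have eta0 : 0 < eta by rewrite divr_gt0 // mulr_gt0 // subr_gt0.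
  pose gc l := siegel_g a x y s (Zc ^~ l) (Wc l).
  have Hgc : hol1 gc by exact: hol_siegel_g.
  pose ep : C := ((expR eta)%:C)%C; pose em : C := ((expR (- eta))%:C)%C.
  have epm : em * ep = 1 by rewrite -rmorphM -expRD addNr expR0 rmorph1.
  have prodE l : b l * em * (ep * gc l) = b l * gc l.
    by rewrite -mulrA (mulrA em) epm mul1r.
  have ZcZ0 : Zc^~ 0 = fun=> 0 by apply/funext => j; exact: Zc0.
  have gc0 : gc 0 = g 0 by rewrite gS // /gc ZZ0 W0 ZcZ0 Wc00.
  apply: (@slack _ n z (fun j l => siegel_z a s (Zc ^~ l) (Wc l) j) w
    (fun l => ep * gc l) (fun l => b l * em) (expR (- eta)) ext).
  - by move=> j; exact: hol_siegel_z.
  - by apply: holM => //; exact: hol_cst.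
  - by apply: holM => //; exact: hol_cst.
  - move=> l l1; rewrite massM nc_real ger0_norm ?expR_ge0 //.
    have -> : (fun j => siegel_z a s (Zc^~ l) (Wc l) j) = siegel_z a s (Zc^~ l) (Wc l) by [].
    rewrite mass_siegel ?Wc0 // -expRM_natr -expRD expR_le1 subr_le0.
    have n0 : 0 < nc (1 - Wc l) ^+ 2 by rewrite exprn_gt0 // nc_gt0 Wc0.
    rewrite ler_pdivlMr //.
    have n4 : nc (1 - Wc l) ^+ 2 <= 4.
      have -> : (4 : R) = 2 ^+ 2 by ring.
      rewrite lerXn2r ?nnegrE ?nc_ge0 //; apply: le_trans (ncB _ _) _.
      by have := Wc1 l l1; rewrite nc1; lra.
    have sZ : sq (Zc ^~ l) = nc l ^+ 2 * sq v.
      by rewrite -sqZ; congr sq; apply/funext => j; rewrite /Zc mulrC.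
    have sW : nc (Wc l) ^+ 2 = nc l ^+ 2 * nc dW ^+ 2 by rewrite ncM exprMn mulrC.
    have l2 : nc l ^+ 2 <= 1 by rewrite sqr_le1 ?nc_ge0 // ltW.
    have P0 : 0 <= nc dW ^+ 2 + sq v by rewrite addr_ge0 ?sqr_ge0.
    have lP : nc l ^+ 2 * (nc dW ^+ 2 + sq v) <= nc dW ^+ 2 + sq v by rewrite ler_piMl.
    apply: (@le_trans _ _ (eta * 2 * 4)); first by rewrite ler_pM2l // mulr_gt0.
    have -> : eta * 2 * 4 = 2 * x * (1 - (nc dW ^+ 2 + sq v)) by rewrite /eta; field.
    by rewrite ler_pM2l ?mulr_gt0 // sZ sW; lra.
  - by rewrite expR_lt1 oppr_lt0.
  - move=> l l1; rewrite ncM nc_real ger0_norm ?expR_ge0 // ler_piMl ?expR_ge0 //.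
    exact: b1.
  - by rewrite mulf_neq0 ?cexp_neq0 // -nc_gt0 nc_real normr_gt0 gt_eqF // expR_gt0.
  - split.
    + by move=> j; rewrite zE // ZcZ0 Wc00 ZZ0 W0.
    + by rewrite prodE gc0 E.
    + move=> j; rewrite rmorph1 mul1r (cderE (dzc j)); apply/esym/cderE.
      apply: (cdiff_near (k := 1)) (dzS j) => // l.
      by rewrite subr0 => l1; rewrite zE.
    + rewrite rmorph1 mul1r.
      have db := cderP (Hb1 0 l0).
      have B := cdiffM (g := gc) db dgc.
      rewrite (cderE (cdiff_ext (fun l => esym (prodE l)) B)) gc0.
      have gc0' : siegel_g a x y s (Z^~ 0) (W 0) = g 0 by rewrite gS.
      have B' := cdiffM (g := fun l => siegel_g a x y s (Z^~ l) (W l)) db dgS.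
      rewrite gc0' in B'; apply/esym/cderE.
      apply: (cdiff_near (k := 1)) B' => // l.
      by rewrite subr0 => l1; rewrite E // gS.
(* equality in the Schwarz lemma: the disk is linear in the ball *)
have eq1 : nc dW ^+ 2 + sq v = 1 by apply/eqP; rewrite eq_le dG1 ge1.
have rig := vec_schwarz_rigid HG G1 G0; rewrite sqdG in rig.
have WL l : nc l < 1 -> W l = l * dW by move=> l1; have := rig ge1 ord0 l l1; rewrite G_0.
have ZL l j : nc l < 1 -> Z j l = l * v j.
  by move=> l1; have := rig ge1 (lift ord0 j) l l1; rewrite G_S.
have vq := sq_ge0 v.
(* the line through the point at infinity of the Siegel domain has constant
   first coordinates *)
have [dW1|dW1] := leP 1 (nc dW).
  exfalso; have v0 : sq v <= 0.
    by have : 1 <= nc dW ^+ 2; [rewrite expr_ge1 ?nc_ge0|lra].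
  apply: (extremal_slice Hz Hw ext _ Hb1 b1 HU ReU ReU0 wE) => l l1 j.
  by rewrite zE // /siegel_z ZL // (sq_le0 v0 j) mulr0 mul0r mulr0 addr0.
pose r0 := 2 / (1 + nc dW); have dWp := nc_ge0 dW.
have r01 : 1 < r0 by rewrite ltr_pdivlMr ?mul1r; lra.
have r0W : r0 * nc dW < 1.
  by rewrite /r0 mulrAC ltr_pdivrMr ?mul1r; lra.
pose rho := Num.min rb r0.
have rho1 : 1 < rho by rewrite lt_min rb1 r01.
have rhob : rho <= rb by rewrite ge_min lexx.
have rho0 : rho <= r0 by rewrite ge_min lexx orbT.
have ne l : nc l < rho -> 1 - l * dW != 0.
  move=> lr; rewrite -nc_gt0; apply: lt_le_trans (ncB_ge _ _).
  rewrite nc1 subr_gt0 ncM; apply: le_lt_trans r0W.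
  by rewrite ler_wpM2r // ltW // (lt_le_trans lr).
have Hl c : hol rho (fun l => l * c) by apply: holM; [exact: hol_id|exact: hol_cst].
exists rho, (fun j l => siegel_z a s (fun j => l * v j) (l * dW) j),
  (fun l => b l * siegel_g a x y s (fun j => l * v j) (l * dW)); split => //.
- by move=> j; apply: (@hol_siegel_z R n rho a s (fun j l => l * v j) (fun l => l * dW)).
- apply: holM; first exact: hol_sub Hb.
  exact: (@hol_siegel_g R n rho a x y s (fun j l => l * v j) (fun l => l * dW)).
- move=> l l1; have ZLf : Z^~ l = fun j => l * v j by apply/funext => j; exact: ZL.
  by split; [move=> j; rewrite zE // ZLf WL|rewrite E // gS // ZLf WL].
- move=> l l1.
  have -> : (fun j => siegel_z a s (fun j => l * v j) (l * dW) j) =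
    siegel_z a s (fun j => l * v j) (l * dW) by [].
  rewrite massM bc // expr1n mul1r mass_siegel ?ne ?l1 //.
  by rewrite sqZ ncM l1 mul1r expr1n mul1r -addrA -opprD eq1 subrr mulr0 mul0r oppr0 expR0.
Qed.

End Main.

(** * Smoothness of holomorphic maps with values in row vectors *)

Section Bridge.
Variable R : realType.
Local Notation C := R[i].
Implicit Types (z w l : C).

Lemma unit_diskE z : unit_disk z = (nc z < 1) :> Prop.
Proof. by rewrite /unit_disk /= lt1C. Qed.

Lemma nbhs_ncP z (A : set C) :
  nbhs z A <-> exists2 k : R, 0 < k & forall w, nc (w - z) < k -> A w.
Proof.
split=> [/nbhs_ballP[e /= /pos_complex[k k0 ->] H]|[k k0 H]].
  exists k => // w wk; apply: H; rewrite /ball /= distrC.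
  exact: etrans (norm_ltE _ _) wk.
apply/nbhs_ballP; exists (k%:C)%C => /=; first by rewrite ltcR.
move=> w; rewrite /ball /= distrC => wk; apply: H.
exact: etrans (esym (norm_ltE _ _)) wk.
Qed.

Lemma open_ball0 (r : R) : open [set z : C | nc z < r].
Proof.
rewrite openE => z /= zr; apply/nbhs_ncP; exists (r - nc z); first by rewrite subr_gt0.
move=> w wz /=; rewrite -(subrK z w); apply: le_lt_trans (ncD _ _) _.
by rewrite -ltrBrDr.
Qed.

Lemma closure_unit_disk l : closure unit_disk l -> nc l <= 1.
Proof.
move=> H; rewrite leNgt; apply/negP => l1.
have [|w []] := H [set w : C | nc (w - l) < nc l - 1].
  by apply/nbhs_ncP; exists (nc l - 1) => //; rewrite subr_gt0.
rewrite unit_diskE => w1 /=; have := ncB_ge l (l - w).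
by rewrite opprB addrCA subrr addr0 ncBC; lra.
Qed.

Lemma boundary_unit_disk l : boundary unit_disk l -> nc l = 1.
Proof.
move=> [/closure_unit_disk l1 ni]; apply/eqP; rewrite eq_le l1 /= leNgt.
apply/negP => l1'; apply: ni; have := @open_ball0 1; rewrite openE => /(_ l l1').
by apply: filterS => w /=; rewrite unit_diskE.
Qed.

Lemma is_derive_coord N (f : C -> 'rV[C]_N) z j : derivable f z 1 ->
  cdiff (fun l => f l 0 j) z (derive1 f z 0 j).
Proof.
move=> df; apply/cdiffP; rewrite derive1E.
have H : (fun h : C => h^-1 *: (f (h *: 1 + z) - f z)) @ 0^' --> 'D_1 f z by exact: df.
have H2 : (fun h : C => h^-1 *: (f (h *: (1 : C) + z) 0 j - f z 0 j)) @ 0^' --> 'D_1 f z 0 j.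
  have -> : (fun h : C => h^-1 *: (f (h *: (1 : C) + z) 0 j - f z 0 j)) =
      (fun M : 'rV[C]_N => M 0 j) \o (fun h : C => h^-1 *: (f (h *: 1 + z) - f z)).
    by apply/funext => h; rewrite /= !mxE.
  exact: (@continuous_cvg _ _ _ _ _ _ (fun M : 'rV[C]_N => M 0 j) _
    (@coord_continuous C 1 N 0 j ('D_1 f z)) H).
split; first by apply/cvg_ex; exists ('D_1 f z 0 j).
exact/cvg_lim.
Qed.

Lemma derivable_coord N (f : C -> 'rV[C]_N) z :
  (forall j, cdiffable (fun l => f l 0 j) z) -> derivable f z 1.
Proof.
move=> H; apply/derivable1_diffP.
have -> : f = \sum_(j < N) (fun l => f l 0 j *: (delta_mx 0 j : 'rV[C]_N)).
  apply/funext => l; rewrite fct_sumE; exact: row_sum_delta.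
apply: differentiable_sum => j; apply: differentiableZl.
apply/derivable1_diffP; have [d /cdiffP Hd] := H j; exact: ex_derive.
Qed.

Lemma continuous_ncP (u : C -> R) z :
  (forall e : R, 0 < e -> exists2 k : R, 0 < k &
    forall w, nc (w - z) < k -> `|u w - u z| <= e) -> {for z, continuous u}.
Proof.
move=> H; have F : Filter (nbhs z) by exact: nbhs_filter.
apply/(@cvgrPdist_le _ _ _ (nbhs z) F) => e e0; apply/nbhs_ncP.
have [k k0 Hk] := H e e0; exists k => // w /Hk.
by rewrite distrC.
Qed.

Lemma rderive_hol (r : R) (f : C -> C) (c v : C) (u : C -> R) z : hol r f ->
  (forall z, nc z < r -> u z = Re (c * f z)) -> nc z < r ->
  is_derive (0 : R) (1 : R) (fun t : R => u (z + t%:C%C * v))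
    (Re (c * (cder f z * v))).
Proof.
move=> Hf uE zr.
have z0 : z + v * ((0 : R)%:C)%C = z by rewrite rmorph0 mulr0 addr0.
have d0 := cderP (Hf z zr); rewrite -{1}z0 in d0.
have := rdiff_Re c (rdiff_comp (rdiff_lin z v 0) d0).
apply: near_eq_is_derive; apply/nbhs_ballP.
have v0 : 0 < nc v + 1 by rewrite ltr_wpDl ?nc_ge0.
exists ((r - nc z) / (nc v + 1)) => /=; first by rewrite divr_gt0 // subr_gt0.
move=> t; rewrite /ball /= sub0r normrN ltr_pdivlMr // => tr.
rewrite [t%:C%C * v]mulrC uE //; apply: le_lt_trans (ncD _ _) _.
rewrite -ltrBrDl ncM nc_real; apply: le_lt_trans tr.
by rewrite mulrC ler_wpM2l // lerDl ler01.
Qed.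

Lemma Re_hol_continuous (r : R) (f : C -> C) (c : C) (u : C -> R) : hol r f ->
  (forall z, nc z < r -> u z = Re (c * f z)) ->
  forall z, nc z < r -> {for z, continuous u}.
Proof.
move=> Hf uE z zr; apply: continuous_ncP => e e0.
have [d Hd] := Hf z zr; have [l l0 Hl] := cdiff_cont (cdiffZ c Hd) e0.
exists (Num.min l (r - nc z)); first by rewrite lt_min l0 subr_gt0.
move=> w; rewrite lt_min => /andP[wl wr].
have wr' : nc w < r.
  by rewrite -(subrK z w); apply: le_lt_trans (ncD _ _) _; rewrite -ltrBrDr.
rewrite !uE //.
have -> : Re (c * f w) - Re (c * f z) = Re (c * f w - c * f z) by rewrite ReD ReN.
by apply: le_trans (Re_le_nc _) _; exact: Hl.
Qed.

(** Real and imaginary parts of holomorphic functions are smooth, by induction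
    on the order: their partial derivatives are of the same form, with
    the derivative of [f] in place of [f]. *)
Lemma Ck_hol (k : nat) (r : R) (f : C -> C) (c : C) (u : C -> R) : hol r f ->
  (forall z, nc z < r -> u z = Re (c * f z)) -> Ck k [set z : C | nc z < r] u.
Proof.
elim: k f c u => [|k IH] f c u Hf uE; have cu := Re_hol_continuous Hf uE; first by split.
split=> //; split.
- move=> z zr; split.
    by have [] := rderive_hol 1 Hf uE zr.
  by have [] := rderive_hol 'i%C Hf uE zr.
- apply: (IH (cder f) c _ (hol_cder Hf)) => z zr.
  have D := rderive_hol 1 Hf uE zr.
  by rewrite /rderive derive1E derive_val mulr1.
- apply: (IH (cder f) (c * 'i%C) _ (hol_cder Hf)) => z zr.
  have D := rderive_hol 'i%C Hf uE zr.
  by rewrite /rderive derive1E derive_val -mulrA [_ * 'i%C]mulrC.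
Qed.

Lemma smooth_hol N (r : R) (f : C -> 'rV[C]_N) :
  (forall j, hol r (fun l => f l 0 j)) -> smooth_on [set z : C | nc z < r] f.
Proof.
move=> H j k; split.
  by apply: (Ck_hol k (c := 1) (H j)) => z _; rewrite mul1r.
apply: (Ck_hol k (c := - 'i%C) (H j)) => z _.
by rewrite Re_mul /=; ring.
Qed.

End Bridge.

(** * Geodesics of the Fock-Bargmann-Hartogs domain *)

Section Domain.
Variables (R : realType) (n : nat).
Local Notation C := R[i].
Local Notation D := (@fock_bargmann_hartogs R n 1).

Definition mkrow (z : 'I_n -> C -> C) (w : C -> C) (l : C) : 'rV[C]_(n + 1) :=
  row_mx (\row_j z j l) (\row_(j < 1) w l).

Lemma mkrowE z w l : (forall j, mkrow z w l 0 (lshift 1 j) = z j l) /\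
  (forall k, mkrow z w l 0 (rshift n k) = w l).
Proof. by split=> j; rewrite ?row_mxEl ?row_mxEr mxE. Qed.

Lemma mkrow_hol (r : R) z w : (forall j, hol r (z j)) -> hol r w ->
  forall j, hol r (fun l => mkrow z w l 0 j).
Proof.
move=> Hz Hw j; case: (split_ordP j) => k ->.
  by apply: hol_ext (Hz k) => l _; rewrite (mkrowE z w l).1.
by apply: hol_ext Hw => l _; rewrite (mkrowE z w l).2.
Qed.

Lemma domainE (p : 'rV[C]_(n + 1)) :
  D p = (mass (fun j => p 0 (lshift 1 j)) (p 0 (rshift n 0)) < 1) :> Prop.
Proof.
rewrite /fock_bargmann_hartogs /= /sqnorm big_ord1 mxE -mass_ltE.
congr (is_true (_ < expR (- _))).
by apply: eq_bigr => j _; rewrite mxE.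
Qed.

Lemma hol_coord (f : C -> 'rV[C]_(n + 1)) j : holomorphic_disk D f ->
  hol 1 (fun l => f l 0 j).
Proof.
move=> [df _] l l1; exists (derive1 f l 0 j); apply: is_derive_coord; apply: df.
by rewrite unit_diskE.
Qed.

(** Stretching the derivative at the centre by [t] would bring the Kobayashi
    metric down to [t^-1], whereas it is one in the direction of a geodesic. *)
Lemma geodesic_extremal (phi : C -> 'rV[C]_(n + 1)) :
  kobayashi_geodesic D (phi 0) (derive1 phi 0) phi -> derive1 phi 0 <> 0 ->
  extremal (fun j l => phi l 0 (lshift 1 j)) (fun l => phi l 0 (rshift n 0)).
Proof.
move=> [Hphi _ [al al1 alK]] nz z' w' t t1 Hz' Hw' HM [J1 J2 J3 J4].
have al_1 : al = 1.
  apply/eqP; rewrite -subr_eq0; apply/negPn/negP => a0; apply: nz.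
  apply: (scalerI a0); rewrite scalerBl al1 scale1r subrr scaler0 //.
have K1 : kobayashi D (phi 0) (derive1 phi 0) = 1%:E by rewrite -alK al_1 nc1.
pose f := mkrow z' w'.
have t0 : 0 < t by exact: lt_trans t1.
have Hf : holomorphic_disk D f.
  split=> [l|_ [l l1 <-]].
    rewrite unit_diskE => l1; apply: derivable_coord => j.
    exact: mkrow_hol Hz' Hw' j l l1.
  rewrite unit_diskE in l1; rewrite domainE (mkrowE z' w' l).2.
  have -> : (fun j => f l 0 (lshift 1 j)) = z' ^~ l.
    by apply/funext => j; rewrite (mkrowE z' w' l).1.
  exact: HM.
have d0 : unit_disk (0 : C) by exact: disk0.
have c0 : nc (0 : C) < 1 by rewrite nc0.
have dphi j : cder (fun l => phi l 0 j) 0 = derive1 phi 0 0 j.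
  by apply: cderE; apply: is_derive_coord; exact: Hphi.1.
have df j : cder (fun l => f l 0 j) 0 = derive1 f 0 0 j.
  by apply: cderE; apply: is_derive_coord; exact: Hf.1.
have E1 : f 0 = phi 0.
  apply/rowP => j; case: (split_ordP j) => k ->.
    by rewrite (mkrowE z' w' 0).1 J1.
  by rewrite (mkrowE z' w' 0).2 J2; congr (phi 0 0 (rshift n _)); rewrite ord1.
have E2 : derive1 f 0 = (t%:C)%C *: derive1 phi 0.
  apply/rowP => j.
  have -> : ((t%:C)%C *: derive1 phi 0) 0 j = (t%:C)%C * derive1 phi 0 0 j by exact: mxE.
  apply: etrans (esym (df j)) _; apply: etrans (congr1 _ (dphi j)).
  case: (split_ordP j) => k ->.
    have -> : (fun l => f l 0 (lshift 1 k)) = z' k.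
      by apply/funext => l; rewrite (mkrowE z' w' l).1.
    exact: J3.
  have -> : (fun l => f l 0 (rshift n k)) = w'.
    by apply/funext => l; rewrite (mkrowE z' w' l).2.
  by rewrite (ord1 k) J4.
have tt : ((t^-1)%:C)%C * (t%:C)%C = 1 :> C.
  by rewrite -rmorphM mulVf ?rmorph1 // gt_eqF.
have : (kobayashi D (phi 0%R) (derive1 phi 0%R) <= (t^-1)%R%:E)%E.
  apply: ereal_inf_lbound; exists ((t^-1)%:C)%C.
    exists f; split; [exact: Hf|exact: E1|].
    by rewrite E2 scalerA tt scale1r.
  by rewrite nc_real ger0_norm // invr_ge0 ltW.
by rewrite K1 lee_fin leNgt invf_lt1 // t1.
Qed.

End Domain.

Theorem corollary1p4 (R : realType) (n : nat) (hn : (1 <= n)%N)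
    (phi : R[i] -> 'rV[R[i]]_(n + 1))
    (hphi : kobayashi_geodesic (@fock_bargmann_hartogs R n 1)
      (phi 0) (derive1 phi 0) phi)
    (hphi' : derive1 phi 0 <> 0) :
  exists psi : R[i] -> 'rV[R[i]]_(n + 1),
    smooth_extension phi psi /\
    psi @` boundary unit_disk `<=` boundary (@fock_bargmann_hartogs R n 1).
Proof.
have ext := geodesic_extremal hphi hphi'.
have [Hphi _ _] := hphi.
pose z (j : 'I_n) l := phi l 0 (lshift 1 j); pose w l := phi l 0 (rshift n 0).
have Hz j : hol 1 (z j) by exact: hol_coord.
have Hw : hol 1 w by exact: hol_coord.
have HM l : nc l < 1 -> mass (z ^~ l) (w l) < 1.
  move=> l1; have : fock_bargmann_hartogs (phi l).
    by apply: Hphi.2; exists l => //; rewrite unit_diskE.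
  by rewrite domainE.
have [rho [Z [W [rho1 HZ HW E bd]]]] := extremal_extends Hz Hw HM ext.
pose psi := mkrow Z W.
have psiE l : unit_disk l -> psi l = phi l.
  rewrite unit_diskE => l1; have [EZ EW] := E l l1.
  apply/rowP => j; case: (split_ordP j) => k ->.
    by rewrite (mkrowE Z W l).1 EZ.
  by rewrite (mkrowE Z W l).2 EW /w (ord1 k).
have Hpsi := mkrow_hol HZ HW.
exists psi; split.
  split=> //; exists [set l | nc l < rho]; split.
  - exact: open_ball0.
  - by move=> l /closure_unit_disk /le_lt_trans; apply.
  - exact: smooth_hol.
move=> _ [l bl <-]; have l1 := boundary_unit_disk bl.
split; last first.
  move=> /interior_subset; rewrite domainE (mkrowE Z W l).2.
  have -> : (fun j => psi l 0 (lshift 1 j)) = Z ^~ l.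
    by apply/funext => j; rewrite (mkrowE Z W l).1.
  by rewrite bd // ltxx.
(* the boundary point is a limit of points of the disk inside the domain *)
move=> B HB; have cpsi : {for l, continuous psi}.
  apply: differentiable_continuous; apply/derivable1_diffP.
  by apply: derivable_coord => j; apply: Hpsi; rewrite l1.
have [k [kd kB]] := bl.1 _ (cpsi B HB).
exists (psi k); split=> //; rewrite psiE //; apply: Hphi.2.
by exists k.
Qed.
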